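(* Let $q\in[0,n-1)$ and let $\Theta:C\setminus\{o\}\to(0,\infty)$ be continuous and positively homogeneous of degree $-q$. For every nonzero finite Borel measure $\mu$ on $\Omega_{C^\circ}$ there exists a $(C,\Theta)$-close set $E$ such that $S^\Theta_{n-1}(E,\eta)=\mu(\eta)$ for all Borel sets $\eta\subset\Omega_{C^\circ}$. Moreover, if $\omega\subset\Omega_{C^\circ}$ is a nonempty compact set and $K,L$ are $C$-pseudo-cones that are $C$-determined by $\omega$ with $S^\Theta_{n-1}(K,\cdot)=S^\Theta_{n-1}(L,\cdot)=\mu$, then $K=L$.
   Context: $C\subset\mathbb{R}^n$ ($n\ge2$) is a pointed closed convex cone with nonempty interior; $C^\circ=\{y:\langle x,y\rangle\le0\ \forall x\in C\}$; $\Omega_{C^\circ}=\mathbb{S}^{n-1}\cap\operatorname{int}C^\circ$. A $C$-pseudo-cone is a nonempty closed convex set $E$ with $o\notin E$, $\lambda x\in E$ for all $x\in E,\lambda\ge1$, and recession cone equal to $C$. $\overline{V}_\Theta(E)=\int_{C\setminus E}\Theta\,d\mathcal{H}^n$; a $(C,\Theta)$-close set is a $C$-pseudo-cone with $\overline{V}_\Theta(E)<\infty$. The effective boundary is $\partial_eE=E\cap\operatorname{cl}(C\setminus E)$, $\nu_E$ is the outer unit normal (defined $\mathcal{H}^{n-1}$-a.e. on $\partial E$), and the weighted surface area measure is $S^\Theta_{n-1}(E,\eta)=\int_{\{x\in\partial_eE:\ \nu_E(x)\in\eta\}}\Theta(x)\,d\mathcal{H}^{n-1}(x)$ for Borel $\eta\subset\mathbb{S}^{n-1}$.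 With $h_K(u)=\sup_{x\in K}\langle x,u\rangle$ and $H^-(u,\alpha)=\{x:\langle x,u\rangle\le\alpha\}$, a set $K$ is $C$-determined by $\omega$ if $K=C\cap\bigcap_{u\in\omega}H^-(u,h_K(u))$. *)

(* Defs.v *)
From HB Require Import structures.
From mathcomp Require Import all_boot all_order all_algebra.
From mathcomp Require Import all_classical all_reals all_analysis.
Set Implicit Arguments. Unset Strict Implicit. Unset Printing Implicit Defensive.
Import Order.TTheory GRing.Theory Num.Theory.
Import numFieldNormedType.Exports.
Local Open Scope classical_set_scope.
Local Open Scope ring_scope.

Section ConeDefs.
Variables (R : realType) (n : nat).
Local Notation vec := 'rV[R]_n.

Definition dotv (x y : vec) : R := \sum_(i < n) x ord0 i * y ord0 i.
Definition enorm (x : vec) : R := Num.sqrt (dotv x x).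

Definition convex_set (A : set vec) : Prop :=
  forall x y (t : R), A x -> A y -> 0 <= t -> t <= 1 -> A ((1 - t) *: x + t *: y).

Definition is_cone (C : set vec) : Prop :=
  forall x (l : R), C x -> 0 <= l -> C (l *: x).

Definition proper_cone (C : set vec) : Prop :=
  [/\ is_cone C, convex_set C, closed C,
      C `&` [set x | C (- x)] = [set 0] & interior C !=set0].

Definition polar (C : set vec) : set vec :=
  [set y | forall x, C x -> dotv x y <= 0].
Definition usphere : set vec := [set u | enorm u = 1].
Definition Omega (C : set vec) : set vec := usphere `&` interior (polar C).

Definition recession (E : set vec) : set vec :=
  [set y | forall x (l : R), E x -> 0 <= l -> E (x + l *: y)].

Definition pseudo_cone (C E : set vec) : Prop :=
  [/\ E !=set0, closed E, convex_set E, ~ E 0 &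
      (forall x (l : R), E x -> 1 <= l -> E (l *: x))] /\ recession E = C.

(* Hausdorff measures H^s (s natural), with the standard normalisation
   omega_s / 2^s, omega_s the volume of the unit ball of R^s. *)
Fixpoint ball_vol (k : nat) : R :=
  match k with
  | 0 => 1
  | 1 => 2
  | (k'.+2) as k2 => (2 * pi / k2%:R) * ball_vol k'
  end.

Definition diam (U : set vec) : \bar R :=
  ereal_sup ([set 0%E] `|` [set (enorm (x - y))%:E | x in U & y in U]).

Definition hausdorff_delta (s : nat) (delta : R) (A : set vec) : \bar R :=
  ereal_inf [set v | exists U : nat -> set vec,
     [/\ A `<=` \bigcup_i U i, (forall i, (diam (U i) <= delta%:E)%E) &
         v = (\sum_(0 <= i <oo) ((ball_vol s / 2 ^+ s)%:E * diam (U i) ^+ s))%E]].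

Definition hausdorff (s : nat) (A : set vec) : \bar R :=
  ereal_sup [set hausdorff_delta s d A | d in [set d : R | 0 < d]].

(* integral over A of a nonnegative function f w.r.t. H^s, written via the
   layer-cake (Cavalieri) formula: int_0^oo H^s(A ∩ {f > t}) dt *)
Definition hint (s : nat) (f : vec -> R) (A : set vec) : \bar R :=
  (\int[@lebesgue_measure R]_(t in `[0%R, +oo[%classic)
      hausdorff s (A `&` [set x | (t < f x)%R]))%E.

Definition Vtheta (C : set vec) (Theta : vec -> R) (E : set vec) : \bar R :=
  hint n Theta (C `\` E).
Definition close_set (C : set vec) (Theta : vec -> R) (E : set vec) : Prop :=
  pseudo_cone C E /\ (Vtheta C Theta E < +oo)%E.

Definition eff_boundary (C E : set vec) : set vec := E `&` closure (C `\` E).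
Definition outer_normal (E : set vec) (x u : vec) : Prop :=
  enorm u = 1 /\ forall y, E y -> dotv (y - x) u <= 0.
Definition nu_preimage (C E : set vec) (eta : set vec) : set vec :=
  [set x | eff_boundary C E x /\
     exists u, [/\ eta u, outer_normal E x u &
                   forall v, outer_normal E x v -> v = u]].
Definition Stheta (C : set vec) (Theta : vec -> R) (E : set vec)
  (eta : set vec) : \bar R := hint n.-1 Theta (nu_preimage C E eta).

Definition supp_fun (K : set vec) (u : vec) : \bar R :=
  ereal_sup [set (dotv x u)%:E | x in K].
Definition C_determined (C K omega : set vec) : Prop :=
  K = C `&` [set x | forall u, omega u -> ((dotv x u)%:E <= supp_fun K u)%E].

Definition borelRV : measurableType _ := g_sigma_algebraType (@open vec).

End ConeDefs.

(* Main.v *)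
Require Import Defs.
From HB Require Import structures.
From mathcomp Require Import all_boot all_order all_algebra.
From mathcomp Require Import all_classical all_reals all_analysis.
From mathcomp Require Import measurable_realfun.
From mathcomp Require Import ring lra zify.
Set Implicit Arguments.
Unset Strict Implicit.
Unset Printing Implicit Defensive.
Import Order.TTheory GRing.Theory Num.Theory.
Import numFieldNormedType.Exports.
Local Open Scope classical_set_scope.
Local Open Scope ring_scope.

(** Project along a vector e of int C onto R^m, m = n - 1. Every C-pseudo-cone is then the epigraph of a convex function t on
    R^m, Lipschitz with a constant that depends on C only. Surface area differs from projected area by a factor Jac that is a
    continuous function of the normal, so S_E = mu amounts to T_t = nu, where nu = mu / Jac and T_t(eta) is the integral of Theta
    over the points of the graph of t with normal in eta, with respect to H^m on R^m. The points with two normals, and the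
    points of the boundary of C with a normal in Omega, are negligible: they meet each parallel line, resp. each ray, at most
    once, hence have infinitely many disjoint translates, resp. dilates, in a bounded set.

    Existence. T is homogeneous of degree m - q > 0, which bounds t(0) from both sides. For a discrete nu, Perron's method gives
    a polyhedral solution: raising one facet decreases the areas of the others. In general nu is approximated by discrete
    measures; along a subsequence the solutions converge pointwise, the area of a compact set of normals is upper
    semicontinuous, and the total area is lower semicontinuous. The volume of C \ E is finite because q < n near the
    origin, and because far from the origin it is controlled by the total projected area.

    Uniqueness. If L is not contained in K, take l > 1 such that l L is almost, but not quite, contained in K. Where l L leaves K
    the two graphs are uniformly close, so the projected areas of the two boundaries over that bounded open set are nearly
    equal; but these compare to T_(l L) = l^(m-q) T_L and T_K = T_L on the set of normals whose support values increase from K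
    to l L, a contradiction. *)

(** * Euclidean space *)

(** [hausdorff m] on R^m is never identified with Lebesgue measure: it scales correctly and is
    positive and finite on the unit cube, and uniqueness of Haar measure then gives the area factor
    of each hyperplane. Graphs need no differentiability: where normals are close to u, chords are
    nearly orthogonal to u, so that piece of the graph is almost isometric to its shadow on the
    hyperplane. Over the common base R^m, limits of areas follow from Fatou and dominated
    convergence.

    The obstacle to existence is that Omega is not compact, so area could escape towards its
    boundary along the approximating sequence. A squeeze excludes this: nu(U) <= T(U) for relatively
    open U, from semicontinuity on compact sets, against T(Omega) <= Itot <= nu(Omega), where Itot
    counts the whole graph off the boundary of C, whatever its normals. The condition q < n - 1
    enters as m - q > 0: it gives the a priori bounds on t(0) and the strict growth of area under
    dilation. *)

Section Euclid.
Variables (R : realType).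
Implicit Types n : nat.

Lemma lip_continuous (V W : normedModType R) (f : V -> W) (k : R) :
  (forall x y, `|f x - f y| <= k * `|x - y|) -> continuous f.
Proof.
move=> H x; have k1 : 0 < `|k| + 1 by rewrite ltr_wpDl.
apply/cvgrPdist_lt => e e0; near=> y.
apply: (le_lt_trans (H x y)).
apply: (@le_lt_trans _ _ ((`|k| + 1) * `|x - y|)).
  by rewrite ler_wpM2r// (le_trans (ler_norm k))// lerDl.
rewrite mulrC -ltr_pdivlMr//; near: y.
by apply: cvgr_dist_lt; [exact: cvg_id|rewrite divr_gt0].
Unshelve. all: by end_near. Qed.

Lemma dotvC n (x y : 'rV[R]_n) : dotv x y = dotv y x.
Proof. by apply: eq_bigr => i _; rewrite mulrC. Qed.

Lemma dotvDl n (x y z : 'rV[R]_n) : dotv (x + y) z = dotv x z + dotv y z.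
Proof. by rewrite -big_split; apply: eq_bigr => i _; rewrite mxE mulrDl. Qed.

Lemma dotvZl n a (x z : 'rV[R]_n) : dotv (a *: x) z = a * dotv x z.
Proof. by rewrite /dotv mulr_sumr; apply: eq_bigr => i _; rewrite mxE mulrA. Qed.

Lemma dotvNl n (x z : 'rV[R]_n) : dotv (- x) z = - dotv x z.
Proof. by rewrite -scaleN1r dotvZl mulN1r. Qed.

Lemma dotvBl n (x y z : 'rV[R]_n) : dotv (x - y) z = dotv x z - dotv y z.
Proof. by rewrite dotvDl dotvNl. Qed.

Lemma dotv0l n (z : 'rV[R]_n) : dotv 0 z = 0.
Proof. by rewrite -(scale0r 0) dotvZl mul0r. Qed.

Lemma dotvDr n (x y z : 'rV[R]_n) : dotv z (x + y) = dotv z x + dotv z y.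
Proof. by rewrite dotvC dotvDl !(dotvC z). Qed.

Lemma dotvZr n a (x z : 'rV[R]_n) : dotv z (a *: x) = a * dotv z x.
Proof. by rewrite dotvC dotvZl (dotvC z). Qed.

Lemma dotvNr n (x z : 'rV[R]_n) : dotv z (- x) = - dotv z x.
Proof. by rewrite dotvC dotvNl (dotvC z). Qed.

Lemma dotvBr n (x y z : 'rV[R]_n) : dotv z (x - y) = dotv z x - dotv z y.
Proof. by rewrite dotvDr dotvNr. Qed.

Lemma dotv0r n (z : 'rV[R]_n) : dotv z 0 = 0.
Proof. by rewrite dotvC dotv0l. Qed.

Lemma dotvv_ge0 n (x : 'rV[R]_n) : 0 <= dotv x x.
Proof. by apply: sumr_ge0 => i _; rewrite -expr2 sqr_ge0. Qed.

Lemma enorm_ge0 n (x : 'rV[R]_n) : 0 <= enorm x.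
Proof. exact: sqrtr_ge0. Qed.
#[local] Hint Resolve enorm_ge0 : core.

Lemma enormE n (x : 'rV[R]_n) : enorm x ^+ 2 = dotv x x.
Proof. by rewrite sqr_sqrtr// dotvv_ge0. Qed.

Lemma enorm0 n : enorm (0 : 'rV[R]_n) = 0.
Proof. by rewrite /enorm dotv0l sqrtr0. Qed.

Lemma enormZ n a (x : 'rV[R]_n) : enorm (a *: x) = `|a| * enorm x.
Proof. by rewrite /enorm dotvZl dotvZr mulrA -expr2 sqrtrM ?sqr_ge0// sqrtr_sqr. Qed.

Lemma enormN n (x : 'rV[R]_n) : enorm (- x) = enorm x.
Proof. by rewrite -scaleN1r enormZ normrN1 mul1r. Qed.

Lemma enormC n (x y : 'rV[R]_n) : enorm (x - y) = enorm (y - x).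
Proof. by rewrite -enormN opprB. Qed.

Lemma norm_le_enorm n (x : 'rV[R]_n) : `|x| <= enorm x.
Proof.
rewrite -[`|x|]/(mx_norm x) mx_normrE; apply: bigmax_le => // -[i j] _ /=.
rewrite -sqrtr_sqr ler_wsqrtr// /dotv (bigD1 j)//= (ord1 i) expr2 lerDl.
by apply: sumr_ge0 => k _; rewrite -expr2 sqr_ge0.
Qed.

Lemma coord_le_norm n (x : 'rV[R]_n) i : `|x ord0 i| <= `|x|.
Proof. 
rewrite -[`|x|]/(mx_norm x) mx_normrE.
by apply: (le_bigmax _ (fun ij => `|x ij.1 ij.2|) (ord0, i)).
Qed.

Lemma enorm_le_norm n (x : 'rV[R]_n) : enorm x <= n%:R * `|x|.
Proof.
rewrite -(@ger0_norm _ (n%:R * _)) ?mulr_ge0// -sqrtr_sqr ler_wsqrtr//.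
apply: (@le_trans _ _ (\sum_(i < n) `|x| ^+ 2)).
  apply: ler_sum => i _; rewrite -expr2 -real_normK ?num_real//.
  by rewrite lerXn2r ?nnegrE// coord_le_norm.
rewrite sumr_const card_ord exprMn -[X in X <= _]mulr_natl ler_wpM2r ?sqr_ge0//.
by rewrite -natrX ler_nat; case: n x => // n _; rewrite expnS leq_pmulr.
Qed.

Lemma enorm_eq0 n (x : 'rV[R]_n) : (enorm x == 0) = (x == 0).
Proof.
apply/eqP/eqP => [x0|->]; last exact: enorm0.
by apply/eqP; rewrite -normr_eq0 eq_le normr_ge0 -x0 norm_le_enorm.
Qed.

Lemma enorm_gt0 n (x : 'rV[R]_n) : (0 < enorm x) = (x != 0).
Proof. by rewrite lt_def enorm_ge0 enorm_eq0 andbT. Qed.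

Lemma dotv_le n (x y : 'rV[R]_n) : dotv x y <= enorm x * enorm y.
Proof.
have [->|y0] := eqVneq y 0; first by rewrite dotv0r enorm0 mulr0.
have ey : 0 < enorm y by rewrite enorm_gt0.
have := dotvv_ge0 (enorm y ^+ 2 *: x - dotv x y *: y).
rewrite !(dotvBl, dotvBr, dotvZl, dotvZr) -!enormE (dotvC y x).
set a := enorm x; set b := enorm y; set c := dotv x y => H.
have H2 : c ^+ 2 <= (a * b) ^+ 2.
  rewrite -(@ler_pM2l _ (b ^+ 2)) ?exprn_gt0//.
  by rewrite -subr_ge0; apply: (le_trans H); rewrite le_eqVlt; apply/orP; left; apply/eqP; ring.
apply: (le_trans (ler_norm c)); rewrite -(@ger0_norm _ (a * b)) ?mulr_ge0 ?enorm_ge0//.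
by rewrite -!sqrtr_sqr ler_wsqrtr.
Qed.

Lemma norm_dotv_le n (x y : 'rV[R]_n) : `|dotv x y| <= enorm x * enorm y.
Proof. by rewrite ler_norml dotv_le andbT lerNl -dotvNl (le_trans (dotv_le _ _))// enormN. Qed.

Lemma enormD n (x y : 'rV[R]_n) : enorm (x + y) <= enorm x + enorm y.
Proof.
rewrite -(@ger0_norm _ (enorm x + _)) ?addr_ge0// -sqrtr_sqr ler_wsqrtr//.
rewrite dotvDl !dotvDr (dotvC y x) sqrrD -!enormE.
have := dotv_le x y; set c := dotv x y; set a := enorm x; set b := enorm y.
by rewrite mulr2n; lra.
Qed.

Lemma enormB_le n (x y z : 'rV[R]_n) : enorm (x - z) <= enorm (x - y) + enorm (y - z).
Proof. by rewrite (le_trans _ (enormD _ _))// addrA subrK. Qed.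

Lemma enorm_lip n (x y : 'rV[R]_n) : `|enorm x - enorm y| <= enorm (x - y).
Proof.
have H (a b : 'rV[R]_n) : enorm a - enorm b <= enorm (a - b).
  by rewrite lerBlDr (le_trans _ (enormD _ _))// subrK.
by rewrite ler_norml H andbT lerNl opprB enormC H.
Qed.

Lemma enorm_continuous n : continuous (@enorm R n).
Proof.
apply: (@lip_continuous _ _ _ n%:R) => x y.
by rewrite (le_trans (enorm_lip x y))// enorm_le_norm.
Qed.

Lemma dotv_continuous n (u : 'rV[R]_n) : continuous (fun x : 'rV[R]_n => dotv x u).
Proof.
apply: (@lip_continuous _ _ _ (n%:R * enorm u)) => x y.
rewrite -dotvBl (le_trans (norm_dotv_le _ _))// mulrAC ler_wpM2r//.
exact: enorm_le_norm.
Qed.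

Lemma dotv_continuousr n (u : 'rV[R]_n) : continuous (dotv u).
Proof.
suff -> : dotv u = (fun x => dotv x u) by exact: dotv_continuous.
by apply/funext => x; rewrite dotvC.
Qed.

Lemma closed_continuous_le (T : topologicalType) (f g : T -> R) :
  continuous f -> continuous g -> closed [set x | f x <= g x].
Proof.
move=> cf cg; rewrite (_ : mkset _ = (fun x => g x - f x) @^-1` [set y | 0 <= y]).
  apply: preimage_closed; first by move=> x _; apply: cvgB; [exact: cg|exact: cf].
  exact: closed_ge.
by apply/seteqP; split => x /=; rewrite subr_ge0.
Qed.

Lemma open_continuous_lt (T : topologicalType) (f g : T -> R) :
  continuous f -> continuous g -> open [set x | f x < g x].
Proof.
move=> cf cg; rewrite -closedC.
rewrite (_ : ~` _ = [set x | g x <= f x]); first exact: closed_continuous_le.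
by apply/seteqP; split => x /=; rewrite leNgt => /negP.
Qed.

Lemma closed_continuous_eq (T : topologicalType) (f g : T -> R) :
  continuous f -> continuous g -> closed [set x | f x = g x].
Proof.
move=> cf cg; rewrite (_ : mkset _ = [set x | f x <= g x] `&` [set x | g x <= f x]).
  by apply: closedI; apply: closed_continuous_le.
apply/seteqP; split => x /=; first by move=> ->.
by move=> [h1 h2]; apply/eqP; rewrite eq_le h1.
Qed.

Lemma compact_enorm_le n (r : R) (F : set 'rV[R]_n) :
  closed F -> (forall x, F x -> enorm x <= r) -> compact F.
Proof.
move=> cF Fr; apply: bounded_closed_compact => //.
exists r; split; first exact: num_real.
by move=> s rs x Fx /=; rewrite (le_trans (norm_le_enorm x))// (le_trans (Fr _ Fx))// ltW.
Qed.

Lemma usphere_closed n : closed (@usphere R n).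
Proof. by apply: closed_continuous_eq; [exact: enorm_continuous|exact: cst_continuous]. Qed.

Lemma enball_nbhs n (x : 'rV[R]_n) r : 0 < r -> nbhs x [set y | enorm (x - y) < r].
Proof.
move=> r0; apply: open_nbhs_nbhs; split; last by rewrite /= subrr enorm0.
apply: open_continuous_lt; last exact: cst_continuous.
apply: (@lip_continuous _ _ _ n%:R) => y z.
rewrite (le_trans (enorm_lip _ _))// (le_trans (enorm_le_norm _))//.
have -> : x - y - (x - z) = z - y by rewrite opprB addrC addrA subrK.
by rewrite distrC.
Qed.

Lemma nbhs_enball n (x : 'rV[R]_n) (A : set 'rV[R]_n) : nbhs x A ->
  exists2 r, 0 < r & forall y, enorm (x - y) < r -> A y.
Proof.
move=> /nbhs_ballP[r /= r0 H]; exists r => // y xy; apply: H.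
rewrite -ball_normE /ball_ /=.
by rewrite (le_lt_trans (norm_le_enorm _)).
Qed.

End Euclid.
#[global] Hint Extern 0 (is_true (@Order.le _ _ _ (enorm _))) => solve [apply: enorm_ge0] : core.

(** * Hausdorff measures *)

Section DoubleSum.
Context (R : realType).
Local Open Scope ereal_scope.

Lemma nneseries_pair (a : nat -> nat -> \bar R) : (forall i j, 0 <= a i j) ->
  exists h : nat -> nat * nat, (forall p, exists k, h k = p) /\
    \sum_(k <oo) a (h k).1 (h k).2 = \sum_(i <oo) \sum_(j <oo) a i j.
Proof.
move=> a0; have /card_esym/ppcard_eqP[f] := card_nat2.
exists f; split=> [p|].
  by exists (f^-1%FUN p); rewrite invK ?inE.
rewrite nneseries_esumT// -(@reindex_esum _ _ _ setT setT f (fun p => a p.1 p.2)); last first.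
  exact: bij.
rewrite nneseries_esumT; last by move=> i; apply: nneseries_ge0.
under [RHS]eq_esum do rewrite nneseries_esumT//.
rewrite esum_esum//; congr (esum _ _).
by apply/seteqP; split => // -[i j].
Qed.

Lemma ereal_sup_add_le (S T : set (\bar R)) (M : \bar R) :
  (forall x, S x -> 0 <= x) -> (forall x, T x -> 0 <= x) -> S !=set0 -> T !=set0 ->
  (forall x y, S x -> T y -> x + y <= M) -> ereal_sup S + ereal_sup T <= M.
Proof.
move=> S0 T0 [x0 Sx0] [y0 Ty0] H.
have [->|Moo] := eqVneq M +oo; first exact: leey.
have fS x : S x -> x \is a fin_num.
  move=> Sx; rewrite ge0_fin_numE ?S0// (@le_lt_trans _ _ M)//; last by rewrite ltey.
  by rewrite (le_trans _ (H _ _ Sx Ty0))// leeDl// T0.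
have M0 : 0 <= M by apply: le_trans (H _ _ Sx0 Ty0); apply: adde_ge0; [exact: S0|exact: T0].
have fM : M \is a fin_num by rewrite ge0_fin_numE// ltey.
have TM : ereal_sup T <= M.
  by apply: ge_ereal_sup => y Ty; rewrite (le_trans _ (H _ _ Sx0 Ty))// leeDr// S0.
have fT : ereal_sup T \is a fin_num.
  rewrite ge0_fin_numE ?(le_lt_trans TM) ?ltey//.
  by rewrite (le_trans (T0 _ Ty0))// ereal_sup_ubound.
rewrite -leeBrDr//; apply: ge_ereal_sup => x Sx; rewrite leeBrDr//.
rewrite addeC -leeBrDr ?fS//; apply: ge_ereal_sup => y Ty; rewrite leeBrDr ?fS//.
by rewrite addeC H.
Qed.

End DoubleSum.

Section Hausdorff.
Context (R : realType).
Local Open Scope ereal_scope.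

Lemma ball_vol_gt0 k : (0 < ball_vol R k)%R.
Proof.
suff : (0 < ball_vol R k)%R /\ (0 < ball_vol R k.+1)%R by case.
elim: k => [|k [h1 h2]]; first by split=> /=; [exact: ltr01|exact: ltr0Sn].
by split=> //; rewrite [ball_vol _ _]/= mulr_gt0// divr_gt0// mulr_gt0// pi_gt0.
Qed.

Definition hcst (s : nat) : R := (ball_vol R s / 2 ^+ s)%R.

Lemma hcst_gt0 s : (0 < hcst s)%R.
Proof. by rewrite divr_gt0// ball_vol_gt0. Qed.

Variable n : nat.
Implicit Types (A B : set 'rV[R]_n).

Lemma diam_ge0 (U : set 'rV[R]_n) : 0 <= diam U.
Proof. by apply: ereal_sup_ubound; left. Qed.

Lemma diam0 : diam (set0 : set 'rV[R]_n) = 0.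
Proof.
apply/eqP; rewrite eq_le diam_ge0 andbT; apply: ge_ereal_sup => _ [->|[]]//.
Qed.

Lemma diam_ub (U : set 'rV[R]_n) x y : U x -> U y -> (enorm (x - y))%:E <= diam U.
Proof. by move=> Ux Uy; apply: ereal_sup_ubound; right; exists x => //; exists y. Qed.

Lemma diam_le (U : set 'rV[R]_n) (d : \bar R) : 0 <= d -> (forall x y, U x -> U y -> (enorm (x - y))%:E <= d) ->
  diam U <= d.
Proof. by move=> d0 H; apply: ge_ereal_sup => _ [->|[x Ux [y Uy <-]]]//; apply: H. Qed.

Lemma le_diam (U V : set 'rV[R]_n) : U `<=` V -> diam U <= diam V.
Proof. by move=> UV; apply: diam_le (diam_ge0 _) _ => x y /UV Vx /UV Vy; apply: diam_ub. Qed.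

Definition hweight s (U : set 'rV[R]_n) : \bar R := (hcst s)%:E * diam U ^+ s.

Lemma hweight_ge0 s (U : set 'rV[R]_n) : 0 <= hweight s U.
Proof. by rewrite mule_ge0 ?lee_fin ?(ltW (hcst_gt0 _))// expe_ge0// diam_ge0. Qed.

(** The exponent is a successor here and in all that follows: since [0 ^+ 0 = 1], in dimension 0
    even the empty set would have weight 1 and every countable cover an infinite sum. *)
Lemma hweight0 s : hweight s.+1 set0 = 0.
Proof. by rewrite /hweight diam0 expeS mul0e mule0. Qed.

Lemma lee_expe k (x y : \bar R) : 0 <= x -> x <= y -> x ^+ k <= y ^+ k.
Proof.
move=> x0 xy; elim: k => [|k IH]; first by [].
by rewrite !expeS lee_pmul// expe_ge0.
Qed.

Lemma le_hweight s (U V : set 'rV[R]_n) : diam U <= diam V -> hweight s U <= hweight s V.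
Proof.
move=> UV; apply: lee_wpmul2l; first by rewrite lee_fin ltW// hcst_gt0.
by apply: lee_expe => //; apply: diam_ge0.
Qed.

Definition hcover d A (U : nat -> set 'rV[R]_n) :=
  A `<=` \bigcup_i U i /\ forall i, diam (U i) <= d%:E.

Lemma hdelta_le s d A U : hcover d A U ->
  hausdorff_delta s d A <= \sum_(i <oo) hweight s (U i).
Proof. by case=> h1 h2; apply: ereal_inf_lbound; exists U. Qed.

Lemma hdelta_ge s d A x : (forall U, hcover d A U -> x <= \sum_(i <oo) hweight s (U i)) ->
  x <= hausdorff_delta s d A.
Proof. by move=> H; apply: le_ereal_inf_tmp => _ [U [h1 h2 ->]]; apply: H. Qed.

Lemma hdelta_ge0 s d A : 0 <= hausdorff_delta s d A.
Proof. by apply: hdelta_ge => U _; apply: nneseries_ge0 => *; apply: hweight_ge0. Qed.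

Lemma le_hdelta s d A B : A `<=` B -> hausdorff_delta s d A <= hausdorff_delta s d B.
Proof. by move=> AB; apply: hdelta_ge => U [h1 h2]; apply: hdelta_le; split => // x /AB /h1. Qed.

Lemma hdelta_anti s d d' A : (d <= d')%R -> hausdorff_delta s d' A <= hausdorff_delta s d A.
Proof.
move=> dd; apply: hdelta_ge => U [h1 h2]; apply: hdelta_le; split => // i.
by rewrite (le_trans (h2 i))// lee_fin.
Qed.

Lemma hdelta0 s d : (0 < d)%R -> hausdorff_delta s.+1 d (set0 : set 'rV[R]_n) = 0.
Proof.
move=> d0; apply/eqP; rewrite eq_le hdelta_ge0 andbT.
apply: le_trans (hdelta_le s.+1 (U := fun=> set0) _) _.
  by split => // i; rewrite diam0 lee_fin ltW.
by rewrite eseries0// => i _ _; rewrite hweight0.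
Qed.

Lemma hdelta_adherent s d A (e : R) : (0 < e)%R -> hausdorff_delta s d A != +oo ->
  exists2 U, hcover d A U &
    \sum_(i <oo) hweight s (U i) <= hausdorff_delta s d A + e%:E.
Proof.
move=> e0 Aoo.
have fA : hausdorff_delta s d A \is a fin_num by rewrite ge0_fin_numE ?hdelta_ge0// ltey.
have [_ [U [h1 h2 ->]] /ltW h3] := lb_ereal_inf_adherent e0 fA.
by exists U.
Qed.

Lemma hdelta_sigma_subadditive s d : sigma_subadditive (@hausdorff_delta R n s d).
Proof.
move=> A; have [[i ioo]|] := pselect (exists i, hausdorff_delta s d (A i) = +oo).
  rewrite (eseries_pinfty _ _ ioo) ?leey// => k _.
  by rewrite -ltNye (lt_le_trans _ (hdelta_ge0 _ _ _)).
rewrite -forallNE => Aoo.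
apply/lee_addgt0Pr => e e0.
apply: le_trans (epsilon_trick _ (fun k => hdelta_ge0 s d (A k)) (ltW e0)).
have /choice[G PG] : forall k, exists U, hcover d (A k) U /\
    \sum_(i <oo) hweight s (U i) <= hausdorff_delta s d (A k) + (e / (2 ^ k.+1)%:R)%:E.
  move=> k.
  have e1 : (0 < e / (2 ^ k.+1)%:R)%R by rewrite divr_gt0// ltr0n expn_gt0.
  by have [U h1 h2] := hdelta_adherent e1 (introN eqP (Aoo k)); exists U.
have [h [hsurj hE]] := @nneseries_pair R (fun i j => hweight s (G i j)) (fun i j => hweight_ge0 _ _).
apply: le_trans (hdelta_le s (U := fun k => G (h k).1 (h k).2) _) _.
  split=> [x [i _ /(PG i).1.1 [j _ Gx]]|k]; last exact: (PG _).1.2.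
  by have [k hk] := hsurj (i, j); exists k => //; rewrite hk.
rewrite hE; apply: lee_nneseries => [i _ _|i _]; last exact: (PG i).2.
by apply: nneseries_ge0 => *; apply: hweight_ge0.
Qed.

Lemma hausdorff_ge0 s A : 0 <= hausdorff s A.
Proof. by apply: (@le_trans _ _ (hausdorff_delta s 1 A)); [exact: hdelta_ge0|apply: ereal_sup_ubound; exists 1%R => //=]. Qed.

Lemma hdelta_le_hausdorff s d A : (0 < d)%R -> hausdorff_delta s d A <= hausdorff s A.
Proof. by move=> d0; apply: ereal_sup_ubound; exists d. Qed.

Lemma hausdorff_le s A x : (forall d, (0 < d)%R -> hausdorff_delta s d A <= x) -> hausdorff s A <= x.
Proof. by move=> H; apply: ge_ereal_sup => _ [d d0 <-]; apply: H. Qed.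

Lemma le_hausdorff s A B : A `<=` B -> hausdorff s A <= hausdorff s B.
Proof.
move=> AB; apply: hausdorff_le => d d0.
by apply: le_trans (hdelta_le_hausdorff _ _ d0); apply: le_hdelta.
Qed.

Lemma hausdorff0 s : hausdorff s.+1 (set0 : set 'rV[R]_n) = 0.
Proof.
apply/eqP; rewrite eq_le hausdorff_ge0 andbT.
by apply: hausdorff_le => d d0; rewrite hdelta0.
Qed.

Lemma hausdorff_sigma_subadditive s : sigma_subadditive (@hausdorff R n s).
Proof.
move=> A; apply: hausdorff_le => d d0.
apply: le_trans (hdelta_sigma_subadditive s d A) _.
apply: lee_nneseries => [i _ _|i _]; first exact: hdelta_ge0.
exact: hdelta_le_hausdorff.
Qed.

(** A covering set of diameter at most [g / 2] cannot meet both [A] and [B], so a fine cover of the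
    union splits into a cover of each at no extra cost. *)
Lemma hausdorff_metric s A B (g : R) : (0 < g)%R ->
  (forall x y, A x -> B y -> (g <= enorm (x - y))%R) ->
  hausdorff s.+1 A + hausdorff s.+1 B <= hausdorff s.+1 (A `|` B).
Proof.
move=> g0 gap; apply: ereal_sup_add_le.
- by move=> _ [d d0 <-]; apply: hdelta_ge0.
- by move=> _ [d d0 <-]; apply: hdelta_ge0.
- by exists (hausdorff_delta s.+1 1 A); exists 1%R => //=.
- by exists (hausdorff_delta s.+1 1 B); exists 1%R => //=.
move=> _ _ [d1 /= d10 <-] [d2 /= d20 <-].
pose d : R := Num.min (Num.min d1 d2) (g / 2)%R.
have d0 : (0 < d)%R by rewrite /d !lt_min d10 d20 divr_gt0.
apply: le_trans (hdelta_le_hausdorff _ _ d0).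
apply: le_trans (leeD (@hdelta_anti s.+1 d d1 A _) (@hdelta_anti s.+1 d d2 B _)) _.
- by rewrite /d !ge_min lexx.
- by rewrite /d !ge_min lexx orbT.
apply: hdelta_ge => U [h1 h2].
apply: le_trans (leeD (hdelta_le s.+1 (U := fun i => U i `&` A) _) (hdelta_le s.+1 (U := fun i => U i `&` B) _)) _.
- split=> [x Ax|i]; first by have [i _ Ux] := h1 x (or_introl Ax); exists i.
  by apply: le_trans (h2 i); apply: le_diam => x [].
- split=> [x Ax|i]; first by have [i _ Ux] := h1 x (or_intror Ax); exists i.
  by apply: le_trans (h2 i); apply: le_diam => x [].
rewrite -nneseriesD; try by move=> *; apply: hweight_ge0.
apply: lee_nneseries => [i _ _|i _]; first by rewrite adde_ge0// hweight_ge0.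
have [->|/set0P[x [Ux Ax]]] := eqVneq (U i `&` A) set0.
  by rewrite hweight0 add0e; apply: le_hweight; apply: le_diam => x [].
have [->|/set0P[y [Uy By]]] := eqVneq (U i `&` B) set0.
  by rewrite hweight0 adde0; apply: le_hweight; apply: le_diam => z [].
have := le_trans (diam_ub Ux Uy) (h2 i); rewrite lee_fin => h3.
have := le_trans (gap _ _ Ax By) h3.
by rewrite /d !le_min => /andP[_]; rewrite leNgt ltr_pdivrMr// ltr_pMr// ltr1n.
Qed.

End Hausdorff.

HB.instance Definition _ (R : realType) n s := isOuterMeasure.Build R 'rV[R]_n (@hausdorff R n s.+1)
  (@hausdorff0 R n s) (@hausdorff_ge0 R n s.+1) (@le_hausdorff R n s.+1)
  (@hausdorff_sigma_subadditive R n s.+1).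

Section Lipschitz.
Context (R : realType).
Local Open Scope ereal_scope.

(** Stated for two parametrizations of one set [A], so that graphs, planes and base sets can be
    compared without inverting a map. *)
Lemma hausdorff_lipschitz (T : Type) k n s (f : T -> 'rV[R]_n) (g : T -> 'rV[R]_k) (L : R) (A : set T) :
  (0 < L)%R -> (forall x y, A x -> A y -> (enorm (f x - f y) <= L * enorm (g x - g y))%R) ->
  hausdorff s.+1 (f @` A) <= (L ^+ s.+1)%:E * hausdorff s.+1 (g @` A).
Proof.
move=> L0 lip; apply: hausdorff_le => d d0.
have dL : (0 < d / L)%R by rewrite divr_gt0.
apply: (@le_trans _ _ ((L ^+ s.+1)%:E * hausdorff_delta s.+1 (d / L) (g @` A))); last first.
  apply: lee_wpmul2l; first by rewrite lee_fin exprn_ge0// ltW.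
  exact: hdelta_le_hausdorff.
rewrite -lee_pdivrMl ?exprn_gt0//; apply: hdelta_ge => U [h1 h2].
rewrite lee_pdivrMl ?exprn_gt0// -nneseriesZl; last by move=> *; apply: hweight_ge0.
have HD i : diam (f @` (A `&` g @^-1` U i)) <= L%:E * diam (U i).
  apply: diam_le; first by rewrite mule_ge0 ?lee_fin ?(ltW L0)// diam_ge0.
  move=> _ _ [x [Ax Ux] <-] [y [Ay Uy] <-].
  apply: (@le_trans _ _ (L%:E * (enorm (g x - g y))%:E)); first by rewrite -EFinM lee_fin lip.
  by apply: lee_wpmul2l; [rewrite lee_fin ltW|exact: diam_ub].
apply: le_trans (hdelta_le s.+1 (U := fun i => f @` (A `&` g @^-1` U i)) _) _.
  split=> [_ [x Ax <-]|i].
    have [|i _ Ux] := h1 (g x); first by exists x.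
    by exists i => //; exists x.
  apply: le_trans (HD i) _; apply: le_trans (lee_wpmul2l _ (h2 i)) _; first by rewrite lee_fin ltW.
  by rewrite -EFinM lee_fin mulrC divfK// gt_eqF.
apply: lee_nneseries => [i _ _|i _]; first exact: hweight_ge0.
rewrite /hweight muleCA; apply: lee_wpmul2l; first by rewrite lee_fin ltW// hcst_gt0.
apply: le_trans (lee_expe s.+1 (diam_ge0 _) (HD i)) _.
rewrite EFin_expe; elim: s.+1 => [|j IH]; first by rewrite mule1.
rewrite !expeS [X in _ <= X](_ : _ = L%:E * diam (U i) * (L%:E ^+ j * diam (U i) ^+ j)); last first.
  by rewrite muleACA.
apply: lee_pmul => //; first by rewrite mule_ge0 ?lee_fin ?(ltW L0)// diam_ge0.
by apply: expe_ge0; rewrite mule_ge0 ?lee_fin ?(ltW L0)// diam_ge0.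
Qed.

End Lipschitz.

(** * Metric outer measures and the Carathéodory criterion *)

Section MetricOuter.
Context (R : realType) (m : nat) (mu : {outer_measure set 'rV[R]_m -> \bar R}).
Local Open Scope ereal_scope.
Hypothesis mu_metric : forall A B (g : R), (0 < g)%R ->
  (forall x y, A x -> B y -> (g <= enorm (x - y))%R) -> mu A + mu B <= mu (A `|` B).

Lemma metric_outer_bigU (A : nat -> set 'rV[R]_m) N :
  (forall i j, (i < j)%N -> exists2 g, (0 < g)%R & forall x y, A i x -> A j y -> (g <= enorm (x - y))%R) ->
  \sum_(0 <= i < N) mu (A i) <= mu (\bigcup_(i in `I_N) A i).
Proof.
move=> sep; elim: N => [|N IH]; first by rewrite big_geq// outer_measure_ge0.
rewrite big_nat_recr//=.
have [g g0 Hg] : exists2 g, (0 < g)%R & forall x y, (\bigcup_(i in `I_N) A i) x -> A N y -> (g <= enorm (x - y))%R.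
  suff : forall k, (k <= N)%N -> exists2 g, (0 < g)%R & forall x y, (\bigcup_(i in `I_k) A i) x -> A N y -> (g <= enorm (x - y))%R by apply.
  elim=> [_|k IHk kN]; first by exists 1%R => // x y [].
  have [g1 g10 H1] := IHk (ltnW kN); have [g2 g20 H2] := sep _ _ kN.
  exists (Num.min g1 g2); first by rewrite lt_min g10.
  move=> x y [i /= ik Ax] ANy; rewrite ge_min.
  move: ik; rewrite ltnS leq_eqVlt => /orP[/eqP ik|ik].
    by rewrite (H2 x y) ?orbT// -ik.
  by rewrite (H1 x y)//; exists i.
apply: le_trans (leeD2r _ IH) _; apply: le_trans (mu_metric g0 Hg) _.
by apply: le_outer_measure => x [[i /= iN Ax]|Ax]; [exists i => //=; rewrite (ltn_trans iN)|exists N => /=].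
Qed.

(** [C k] is the part of [X] at distance at least [1/(k+1)] from [F], so metric additivity applies
    to it and [X] cut by [F]. What is missing is covered by the shells [S i] with [i >= k], and
    these tails tend to 0 because the measures of the shells are summable. *)
Lemma metric_outer_closed (F : set 'rV[R]_m) : closed F -> mu.-caratheodory F.
Proof.
move=> cF; apply: le_caratheodory_measurable => X.
have [->|Xoo] := eqVneq (mu X) +oo; first exact: leey.
have fX : mu X \is a fin_num by rewrite ge0_fin_numE ?outer_measure_ge0// ltey.
have fXF : mu (X `&` F) \is a fin_num.
  rewrite ge0_fin_numE ?outer_measure_ge0// (@le_lt_trans _ _ (mu X)) ?ltey//.
  by apply: le_outer_measure => x [].
rewrite addeC -leeBrDr//.
pose C k := [set x | (X `&` ~` F) x /\ forall y, F y -> (k.+1%:R^-1 <= enorm (x - y))%R].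
pose S k := C k.+1 `\` C k.
have HC k : mu (C k) <= mu X - mu (X `&` F).
  rewrite leeBrDr//.
  have := @mu_metric (C k) (X `&` F) k.+1%:R^-1%R.
  move=> /(_ _ _)/le_trans; apply => //.
    by move=> x y [_ H] [_ Fy]; apply: H.
  by apply: le_outer_measure => x [[[]]|[]].
have Ssep i j : (i.+1 < j)%N -> exists2 g, (0 < g)%R & forall x y, S i x -> S j y -> (g <= enorm (x - y))%R.
  move=> ij; exists (i.+2%:R^-1 - j.+1%:R^-1)%R.
    by rewrite subr_gt0 ltf_pV2 ?posrE// ltr_nat ltnS.
  move=> x y [[_ Hx] _] [[Xy Hy1] Hy]; rewrite lerBlDr.
  have [z Fz yz] : exists2 z, F z & (enorm (y - z) < j.+1%:R^-1)%R.
    apply: contrapT => H; apply: Hy; split => // z Fz.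
    by rewrite leNgt; apply/negP => zz; apply: H; exists z.
  apply: le_trans (Hx _ Fz) _; apply: le_trans (enormB_le x y z) _.
  by rewrite lerD2l ltW.
(* Nonadjacent shells are separated, so those of one parity [o] have total measure at most
   [mu X]. *)
have sum1 (o : nat) N : \sum_(0 <= i < N) mu (S (i.*2 + o)%N) <= mu X.
  apply: le_trans (metric_outer_bigU (A := fun i => S (i.*2 + o)%N) _ _) _.
    by move=> i j ij; apply: Ssep; lia.
  by apply: le_outer_measure => x [i _ [[[]]]].
have tot : \sum_(0 <= i <oo) mu (S i) < +oo.
  apply: (@le_lt_trans _ _ (mu X + mu X)); last by rewrite ltey_eq fin_numD fX.
  apply: lime_le; first by apply: is_cvg_nneseries => *; apply: outer_measure_ge0.
  apply: nearW => N.
  apply: (@le_trans _ _ (\sum_(0 <= i < N.*2) mu (S i))).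
    rewrite -addnn (big_cat_nat _ (leq_addl N N))//= ?leq_addr//.
    by rewrite leeDl// sume_ge0// => *; apply: outer_measure_ge0.
  apply: le_trans (leeD (sum1 0%N N) (sum1 1%N N)).
  rewrite -big_split/=; elim: N => [|N IH]; first by rewrite !big_geq.
  by rewrite doubleS !big_nat_recr//= addn0 addn1 -addeA leeD2r.
have XC k : mu (X `&` ~` F) <= mu X - mu (X `&` F) + \sum_(k <= i <oo) mu (S i).
  apply: le_trans (leeD (HC k) (outer_measure_sigma_subadditive_tail mu k S)).
  apply: le_trans (outer_measureU2 _ _ _); apply: le_outer_measure => x [Xx nFx].
  have [d d0 Hd] : exists2 d, (0 < d)%R & forall y, F y -> (d <= enorm (x - y))%R.
    have /nbhs_enball[r r0 Hr] : nbhs x (~` F).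
      by apply: open_nbhs_nbhs; split => //; rewrite openC.
    by exists r => // y Fy; rewrite leNgt; apply/negP => /Hr.
  have [j Hj] : exists j, C j x.
    exists (Num.truncn (d^-1)); split=> // y Fy.
    apply: le_trans (Hd _ Fy); rewrite invf_ple ?posrE//.
    by rewrite ltW// truncnS_gt.
  have HexC : exists j, `[<C j x>] by exists j; apply/asboolP.
  have := ex_minnP HexC; move=> [i /asboolP Ci imin].
  have [ik|ki] := leqP i k.
    left; split=> // y Fy; apply: le_trans (Ci.2 _ Fy).
    by rewrite lef_pV2 ?posrE// ler_nat ltnS.
  right; case: i => // i in Ci imin ki *.
  exists i; first by rewrite /= => iS; move: ki; rewrite ltnS leqNgt iS.
  split=> // Ci'; have := imin i (introT (asboolP _) Ci'); by rewrite ltnn.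
have := nneseries_tail_cvg tot (fun k _ => outer_measure_ge0 mu (S k)).
move=> tail.
have fB : mu X - mu (X `&` F) \is a fin_num by rewrite fin_numB fX.
have Hl : (mu X - mu (X `&` F) + \sum_(N <= i <oo) mu (S i)) @[N --> \oo] --> mu X - mu (X `&` F).
  rewrite -[X in _ --> X]adde0; apply: cvgeD => //; first exact: fin_num_adde_defr.
  exact: cvg_cst.
rewrite -(cvg_lim _ Hl)//; apply: lime_ge; first by apply/cvg_ex; eexists; exact: Hl.
by apply: nearW => k; exact: XC.
Qed.

Lemma metric_outer_borel (A : set (borelRV R m)) : measurable A -> mu.-caratheodory A.
Proof.
move=> mA; have : (measurable : set (set (caratheodory_type mu))) A; last by [].
move: A mA; apply: smallest_sub; first exact: (@sigma_algebra_measurable _ (caratheodory_type mu)).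
move=> A oA; rewrite -(setCK A); apply: (@measurableC _ (caratheodory_type mu)).
by apply: metric_outer_closed; rewrite closedC.
Qed.

Lemma metric_outer_sigma_additive : semi_sigma_additive (mu : set (borelRV R m) -> \bar R).
Proof.
move=> F mF tF mUF.
apply: (@caratheodory_measure_sigma_additive _ _ mu) => //.
  by move=> i; apply: metric_outer_borel.
exact: metric_outer_borel.
Qed.

End MetricOuter.

(** * Hausdorff measures of parametrized sets *)

(** Positivity of the scale is carried by its type, so that an instance can be declared: for a
    negative scale there is no cover and the empty set would get [+oo]. *)
Lemma hdelta_posnum0 (R : realType) n s (d : {posnum R}) :
  hausdorff_delta s.+1 d%:num (set0 : set 'rV[R]_n) = 0%E.
Proof. exact: hdelta0. Qed.

HB.instance Definition _ (R : realType) n s (d : {posnum R}) :=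
  isOuterMeasure.Build R 'rV[R]_n (@hausdorff_delta R n s.+1 d%:num)
  (@hdelta_posnum0 R n s d) (@hdelta_ge0 R n s.+1 d%:num) (@le_hdelta R n s.+1 d%:num)
  (@hdelta_sigma_subadditive R n s.+1 d%:num).

Section Borel.
Context (R : realType) (n : nat).

Lemma open_borel (A : set 'rV[R]_n) : open A -> measurable (A : set (borelRV R n)).
Proof. by move=> oA; apply: sub_sigma_algebra. Qed.

Lemma closed_borel (A : set 'rV[R]_n) : closed A -> measurable (A : set (borelRV R n)).
Proof.
by move=> cA; rewrite -(setCK A); apply: measurableC; apply: open_borel; rewrite openC.
Qed.

Lemma continuous_measurable (f : 'rV[R]_n -> R) : continuous f ->
  measurable_fun setT (f : borelRV R n -> R).
Proof.
move=> cf; apply: (measurability _ (RGenOInfty.measurableE R)) => _ [_ [x ->] <-].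
rewrite setTI; apply: open_borel; rewrite set_itvoy.
exact: (open_continuous_lt (@cst_continuous _ _ x) cf).
Qed.

Lemma continuous_preimage_borel k (f : 'rV[R]_n -> 'rV[R]_k) (A : set (borelRV R k)) :
  continuous f -> measurable A -> measurable (f @^-1` A : set (borelRV R n)).
Proof.
move=> cf mA; rewrite -[X in measurable X]setTI.
have : measurable_fun setT (f : borelRV R n -> borelRV R k); last by apply.
apply: (@measurability _ _ (borelRV R n) (borelRV R k) setT f (@open _) erefl) => _ [U oU <-].
rewrite setTI; apply: open_borel; apply: open_comp => //.
Qed.

End Borel.

Section ImageMeasure.
Context (R : realType).
Local Open Scope ereal_scope.

(** The lower bound keeps separated sets separated, so the Hausdorff measure of images is again a
    metric outer measure on the parameter space, and areas of graphs become Borel measures on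
    R^m. *)
Record expanding_map m n := ExpandingMap {
  emap :> 'rV[R]_m -> 'rV[R]_n ;
  emapP : exists2 c : R, (0 < c)%R &
    forall x y, (c * enorm (x - y) <= enorm (emap x - emap y))%R }.

Context (m n s : nat).

Definition himage (f : expanding_map m n) (A : set 'rV[R]_m) : \bar R := hausdorff s.+1 (f @` A).

Lemma himage0 f : himage f set0 = 0.
Proof. by rewrite /himage image_set0 hausdorff0. Qed.

Lemma himage_ge0 f A : 0 <= himage f A.
Proof. exact: hausdorff_ge0. Qed.

Lemma le_himage f : {homo himage f : A B / A `<=` B >-> A <= B}.
Proof. by move=> A B AB; apply: le_hausdorff; apply: image_subset. Qed.

Lemma himage_sigma_subadditive f : sigma_subadditive (himage f).
Proof.
by move=> A; rewrite /himage image_bigcup; apply: outer_measure_sigma_subadditive.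
Qed.

HB.instance Definition _ f := isOuterMeasure.Build R 'rV[R]_m (himage f)
  (himage0 f) (himage_ge0 f) (@le_himage f) (@himage_sigma_subadditive f).

Lemma himage_metric f A B (g : R) : (0 < g)%R ->
  (forall x y, A x -> B y -> (g <= enorm (x - y))%R) -> himage f A + himage f B <= himage f (A `|` B).
Proof.
move=> g0 H; have [c c0 Hc] := emapP f; rewrite /himage image_setU.
apply: (@hausdorff_metric _ _ _ _ _ (c * g)%R); first by rewrite mulr_gt0.
move=> _ _ [x Ax <-] [y By <-]; apply: le_trans (Hc x y).
by rewrite ler_wpM2l ?(ltW c0)// H.
Qed.

Definition hmeas (f : expanding_map m n) : set (borelRV R m) -> \bar R := himage f.

Lemma hmeas_semi_sigma_additive f : semi_sigma_additive (hmeas f).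
Proof. by apply: (@metric_outer_sigma_additive _ _ (himage f)); exact: himage_metric. Qed.

HB.instance Definition _ f := isMeasure.Build _ (borelRV R m) R (hmeas f)
  (himage0 f) (himage_ge0 f) (@hmeas_semi_sigma_additive f).

End ImageMeasure.
Arguments hmeas {R m n} s f.

Lemma idmap_expanding (R : realType) m : exists2 c : R, 0 < c &
  forall x y : 'rV[R]_m, c * enorm (x - y) <= enorm (x - y).
Proof. by exists 1 => // x y; rewrite mul1r. Qed.

Definition idmap_ (R : realType) m : expanding_map R m m := ExpandingMap (@idmap_expanding R m).

(** A multiple of Lebesgue measure; the constant never has to be known, only that the unit cube has
    positive finite measure. *)
Definition lam (R : realType) p : {measure set (borelRV R p.+1) -> \bar R} := hmeas p (idmap_ R p.+1).

(** * The unit cube has positive and finite Hausdorff measure *)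

Section Cubes.
Context (R : realType) (p : nat).
Local Notation m := p.+1.
Implicit Types v x : 'rV[R]_m.

Lemma lamE A : lam R p A = hausdorff m A.
Proof. by rewrite /lam/= /hmeas /himage /= image_id. Qed.

Definition cube v (r : R) : set 'rV[R]_m := [set x | forall i, v ord0 i <= x ord0 i < v ord0 i + r].

Lemma cube_borel v r : measurable (cube v r : set (borelRV R m)).
Proof.
rewrite (_ : cube v r = \bigcap_(i in [set: 'I_m]) ([set x | v ord0 i <= x ord0 i] `&` [set x | x ord0 i < v ord0 i + r])).
  apply: fin_bigcap_measurable; first exact: finite_finset.
  move=> i _; apply: measurableI.
    by apply: closed_borel; apply: closed_continuous_le; [exact: cst_continuous|exact: coord_continuous].
  by apply: open_borel; apply: open_continuous_lt; [exact: coord_continuous|exact: cst_continuous].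
by apply/seteqP; split=> x H i; [move=> _; apply/andP/H|apply/andP; exact: (H i I)].
Qed.

Lemma cube_dist v r x y : cube v r x -> cube v r y -> enorm (x - y) <= m%:R * r.
Proof.
move=> Hx Hy; apply: le_trans (enorm_le_norm _) _; rewrite ler_wpM2l//.
rewrite -[`|_|]/(mx_norm _) mx_normrE; apply: bigmax_le => [|[i j] _].
  by have /andP[h1 h2] := Hx ord0; have := le_lt_trans h1 h2; rewrite ltrDl => /ltW.
rewrite !mxE (ord1 i) ler_norml; have := Hx j; have := Hy j; lra.
Qed.

Lemma cubeE v r : 0 < r -> cube v r = (fun x => v + r *: x) @` cube 0 1.
Proof.
move=> r0; apply/seteqP; split=> [x Hx|_ [x Hx <-] i].
  exists (r^-1 *: (x - v)); last by rewrite scalerA divff ?gt_eqF// scale1r addrC subrK.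
  move=> i; rewrite !mxE add0r; have /andP[h1 h2] := Hx i.
  by rewrite mulr_ge0 ?invr_ge0 ?(ltW r0) ?subr_ge0//= mulrC ltr_pdivrMr// mul1r ltrBlDl.
rewrite !mxE; have := Hx i; rewrite !mxE add0r => /andP[h1 h2].
by rewrite lerDl mulr_ge0 ?(ltW r0)//= ltrD2l gtr_pMr.
Qed.

Local Open Scope ereal_scope.

Lemma outer_measure_fin (T : Type) (mu : {outer_measure set T -> \bar R}) (I : finType) (A : I -> set T) :
  mu (\bigcup_(i in [set: I]) A i) <= \sum_(i : I) mu (A i).
Proof.
suff H (l : seq I) : mu (\bigcup_(i in [set i | i \in l]) A i) <= \sum_(i <- l) mu (A i).
  apply: le_trans (H (index_enum I)); apply: le_outer_measure => x [i _ Ax].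
  by exists i => //=; rewrite mem_index_enum.
elim: l => [|i l IH].
  rewrite big_nil; apply: (@le_trans _ _ (mu set0)); last by rewrite outer_measure0.
  by apply: le_outer_measure => x [i /=]; rewrite in_nil.
rewrite big_cons; apply: le_trans (leeD2l _ IH); apply: le_trans (outer_measureU2 _ _ _).
apply: le_outer_measure => x [j /=]; rewrite in_cons => /orP[/eqP->|jl] Ax; first by left.
by right; exists j.
Qed.

Lemma hdelta_le_hweight n s d (A : set 'rV[R]_n) : (0 < d)%R -> diam A <= d%:E ->
  hausdorff_delta s.+1 d A <= hweight s.+1 A.
Proof.
move=> d0 Ad; apply: le_trans (@hdelta_le _ _ s.+1 d A (fun i => if i == 0%N then A else set0) _) _.
  by split=> [x Ax|i]; [exists 0%N|case: ifP => // _; rewrite diam0 lee_fin ltW].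
rewrite nneseries_recl//; last by move=> *; apply: hweight_ge0.
rewrite eseries0 ?adde0//= => i i0 _; rewrite gtn_eqF// hweight0//.
Qed.

(** A grid of [N ^ m] cubes of side [1/N], each of diameter at most [m/N], has total weight
    [hcst R m * m ^ m], whatever the mesh. *)
Lemma lam_cube_fin : lam R p (cube 0 1) < +oo.
Proof.
rewrite lamE; apply: (@le_lt_trans _ _ (hcst R m * m%:R ^+ m)%:E); last exact: ltry.
apply: hausdorff_le => d d0.
pose N := (Num.truncn (m%:R / d)).+1.
have N0 : (0 < N%:R :> R)%R by rewrite ltr0n.
have mN : (m%:R * N%:R^-1 <= d)%R.
  by rewrite ler_pdivrMr// mulrC -ler_pdivrMr// ltW// truncnS_gt.
have -> : d = (PosNum d0)%:num by [].
apply: (@le_trans _ _ (\sum_(g : {ffun 'I_m -> 'I_N})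
    hausdorff_delta m d (cube (\row_i ((g i)%:R / N%:R)%R) N%:R^-1))).
  apply: le_trans (@outer_measure_fin _ (@hausdorff_delta R m m (PosNum d0)%:num
    : {outer_measure set _ -> \bar R}) _ _); apply: le_outer_measure => x Hx.
  have Hg i : (Num.truncn (x ord0 i * N%:R) < N)%N.
    rewrite -(ltr_nat R); have /andP[h1 h2] := Hx i; move: h1 h2; rewrite mxE add0r => h1 h2.
    apply: (@le_lt_trans _ _ (x ord0 i * N%:R)%R); first by rewrite truncn_le// mulr_ge0.
    by rewrite gtr_pMl.
  exists [ffun i => Ordinal (Hg i)] => //= i.
  have /andP[h1 h2] := Hx i; move: h1 h2; rewrite !mxE add0r ffunE /= => h1 h2.
  rewrite ler_pdivrMr// truncn_le ?mulr_ge0//=.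
  by rewrite -[X in (_ < _ + X)%R]mul1r -mulrDl ltr_pdivlMr// natr1 truncnS_gt.
apply: (@le_trans _ _ (\sum_(g : {ffun 'I_m -> 'I_N}) (hcst R m * (m%:R / N%:R) ^+ m)%:E)).
  apply: lee_sum => g _.
  have D : diam (cube (\row_i ((g i)%:R / N%:R)%R) N%:R^-1) <= (m%:R / N%:R)%:E.
    by apply: diam_le => [|x y Hx Hy]; rewrite lee_fin ?divr_ge0//; exact: (cube_dist Hx Hy).
  apply: le_trans (hdelta_le_hweight _ d0 (le_trans D _)) _; first by rewrite lee_fin.
  rewrite EFinM; apply: lee_wpmul2l; first by rewrite lee_fin ltW// hcst_gt0.
  by rewrite EFin_expe; apply: lee_expe => //; apply: diam_ge0.
rewrite sumEFin lee_fin sumr_const card_ffun !card_ord -[X in (X <= _)%R]mulr_natl natrX.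
by rewrite mulrCA -exprMn [(N%:R * _)%R]mulrCA divff ?mulr1// gt_eqF.
Qed.

(* Integrating the covering inequality one coordinate at a time avoids any product measure. *)
Lemma box_cover k (w : nat -> \bar R) (a b : nat -> nat -> R) :
  (forall i, 0 <= w i) -> (forall i j, (a i j <= b i j)%R) ->
  (forall x : nat -> R, (forall j, (0 <= x j < 1)%R) ->
     1 <= \sum_(i <oo) w i * (\prod_(j < k) \1_(`[a i j, b i j]%classic) (x j))%:E) ->
  1 <= \sum_(i <oo) w i * (\prod_(j < k) (b i j - a i j))%:E.
Proof.
elim: k w => [|k IH] w w0 ab H.
  have := H (fun=> 0%R) (fun=> introT andP (conj (lexx _) ltr01)).
  by under eq_eseriesr do rewrite big_ord0; under [in X in _ -> X]eq_eseriesr do rewrite big_ord0.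
have := IH (fun i => w i * (b i k - a i k)%:E).
under [in X in _ -> X]eq_eseriesr => i _ do rewrite big_ord_recr/= mulrC EFinM muleA.
apply => [i|//|x x01]; first by rewrite mule_ge0// lee_fin subr_ge0.
pose D : set R := `[0%R, 1%R[%classic.
have Dmu : (@lebesgue_measure R) D = 1 by rewrite lebesgue_measure_itv /= lte_fin ltr01 sube0.
have -> : 1 = \int[@lebesgue_measure R]_(t in D) (cst 1 t) :> \bar R.
  by rewrite integral_cst//= ?Dmu ?mul1e//; exact: measurable_itv.
pose P i := (\prod_(j < k) \1_(`[a i j, b i j]%classic) (x j))%R : R.
have P0 i : (0 <= P i)%R by apply: prodr_ge0 => j _; rewrite indicE.
apply: (@le_trans _ _ (\int[@lebesgue_measure R]_(t in D)
    (\sum_(i <oo) (w i * (P i)%:E) * (\1_(`[a i k, b i k]%classic) t)%:E))).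
  apply: ge0_le_integral => //; first exact: measurable_itv.
  - apply: (@ge0_emeasurable_sum _ _ _ D (fun i t => (w i * (P i)%:E) * (\1_(`[a i k, b i k]%classic) t)%:E) xpredT) => [i t _ _|i _]; first by rewrite !mule_ge0// lee_fin// indicE.
    apply: measurable_funeM; apply/measurable_EFinP; apply: measurable_indic; exact: measurable_itv.
  - move=> t; rewrite /D set_itvco /= => tD.
    have H0 j : (0 <= (if j == k then t else x j) < 1)%R by case: ifP.
    have := H _ H0; move/le_trans; apply; rewrite le_eqVlt; apply/orP; left; apply/eqP; apply: eq_eseriesr => i _.
    rewrite big_ord_recr/= eqxx EFinM muleA; congr (_ * _%:E * _).
    by apply: eq_bigr => j _; rewrite ltn_eqF.
have mD : measurable D by exact: measurable_itv.
have mI i : measurable_fun D (fun t => (\1_(`[a i k, b i k]%classic) t)%:E : \bar R).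
  by apply/measurable_EFinP; apply: measurable_indic; exact: measurable_itv.
rewrite integral_nneseries; try exact: mD; try (by move=> i; apply: measurable_funeM; exact: mI);
  try (by move=> i t _; rewrite !mule_ge0// lee_fin// indicE).
apply: lee_nneseries => [i _ _|i _].
  by apply: integral_ge0 => t _; rewrite !mule_ge0// lee_fin// indicE.
rewrite ge0_integralZl; last 4 first.
- exact: mD.
- exact: mI.
- by move=> t _; rewrite lee_fin indicE.
- by rewrite mule_ge0// lee_fin.
rewrite integral_indic//=.
rewrite -/(P i) -[X in _ <= X]muleA [X in _ <= _ * X]muleC [X in _ <= X]muleA.
apply: lee_wpmul2l; first by rewrite mule_ge0// lee_fin.
apply: (@le_trans _ _ ((@lebesgue_measure R) `[a i k, b i k]%classic)).
  by apply: le_measure; rewrite ?inE; [apply: measurableI; exact: measurable_itv|exact: measurable_itv|move=> t []].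
rewrite lebesgue_measure_itv/=; case: ifP => _; first by rewrite EFinB.
by rewrite lee_fin subr_ge0.
Qed.

(** A covering set of diameter d lies in the box of side 2d centred at one of its points, so
    [box_cover] bounds the sum of the [(2 d) ^ m] from below by 1. Empty covering sets get the
    arbitrary centre 0. *)
Lemma lam_cube_gt0 : 0 < lam R p (cube 0 1).
Proof.
apply: (@lt_le_trans _ _ (hcst R m / 2 ^+ m)%:E); first by rewrite lte_fin divr_gt0// hcst_gt0.
rewrite lamE; apply: le_trans (hdelta_le_hausdorff _ _ ltr01).
apply: hdelta_ge => U [cov dU].
pose d i : R := fine (diam (U i)).
have dE i : diam (U i) = (d i)%:E.
  by rewrite fineK// ge0_fin_numE ?diam_ge0// (le_lt_trans (dU i))// ltry.
have d0 i : (0 <= d i)%R by rewrite -lee_fin -dE diam_ge0.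
have [y Hy] : exists y : nat -> 'rV[R]_m, forall i, U i !=set0 -> U i (y i).
  have /choice[y Hy] : forall i, exists z, U i !=set0 -> U i z; last by exists y.
  by move=> i; have [[z Uz]|H] := pselect (U i !=set0); [exists z|exists 0%R].
pose a i j := (y i ord0 (inord j) - d i)%R; pose b i j := (y i ord0 (inord j) + d i)%R.
have := @box_cover m (fun=> 1) a b (fun=> lee01) _ _.
have H1 i j : (a i j <= b i j)%R by have := d0 i; rewrite /a /b; lra.
have H2 : (forall x : nat -> R, (forall j, (0 <= x j < 1)%R) ->
     1 <= \sum_(i <oo) 1 * (\prod_(j < m) \1_(`[a i j, b i j]%classic) (x j))%:E :> \bar R).
  move=> x x01; have [|i _ Ux] := cov (\row_j x j); first by move=> j; rewrite !mxE add0r.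
  apply: le_trans (nneseries_lim_ge i.+1 _); last first.
    by move=> j _ _; rewrite mul1e lee_fin prodr_ge0// => l _; rewrite indicE.
  rewrite big_nat_recr//= -[X in X <= _]add0e; apply: leeD.
    by apply: sume_ge0 => j _; rewrite mul1e lee_fin prodr_ge0// => l _; rewrite indicE.
  rewrite mul1e big1// => j _; rewrite indicE mem_set//= in_itv/=.
  have := le_trans _ (diam_ub Ux (Hy i (ex_intro _ _ Ux))); move=> /(_ (`|x j - y i ord0 j|)%:E).
  rewrite dE !lee_fin /a /b inord_val => Hd.
  have : (`|x j - y i ord0 j| <= d i)%R; last by rewrite ler_norml; lra.
  apply: Hd; apply: le_trans (norm_le_enorm _); apply: le_trans (coord_le_norm _ j).
  by rewrite !mxE.
move=> /(_ H1 H2) H.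
rewrite EFinM muleC lee_pdivrMl ?exprn_gt0// -nneseriesZl; last by move=> *; apply: hweight_ge0.
rewrite -[X in X <= _]mule1 -lee_pdivlMl ?hcst_gt0// -nneseriesZl; last first.
  by move=> *; rewrite mule_ge0 ?lee_fin ?hweight_ge0.
apply: le_trans H _; apply: lee_nneseries => [i _ _|i _].
  by rewrite mul1e lee_fin prodr_ge0// => j _; rewrite subr_ge0.
rewrite mul1e (eq_bigr (fun=> 2 * d i)%R); last by move=> j _; rewrite /a /b; ring.
rewrite prodr_const card_ord /hweight dE -EFin_expe -!EFinM lee_fin exprMn.
by rewrite mulrCA mulKf// gt_eqF// hcst_gt0.
Qed.

End Cubes.

(** * Uniqueness of Haar measure *)

Section Haar.
Context (R : realType) (p n : nat).
Local Notation m := p.+1.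
Local Open Scope ereal_scope.

Section Linear.
Variables (f : expanding_map R m n) (K : R).
Hypothesis flin : forall a x y, f (a *: x + y)%R = (a *: f x + f y)%R.
Hypothesis fK : forall x y, (enorm (f x - f y) <= K * enorm (x - y))%R.

Lemma hmeas_affine (A : set 'rV[R]_m) v (r : R) : (0 < r)%R ->
  hmeas p f ((fun x => v + r *: x)%R @` A) = (r ^+ m)%:E * hmeas p f A.
Proof.
move=> r0; rewrite /hmeas /himage.
have E x y : (f (v + r *: x) - f (v + r *: y))%R = (r *: (f x - f y))%R.
  by rewrite ![(v + _)%R]addrC !flin scalerBr opprD addrACA subrr addr0.
have -> : f @` ((fun x => v + r *: x)%R @` A) = (fun x => f (v + r *: x)%R) @` A.
  by rewrite image_comp.
apply/eqP; rewrite eq_le; apply/andP; split.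
  by apply: hausdorff_lipschitz => // x y _ _; rewrite E enormZ gtr0_norm.
rewrite -lee_pdivlMl ?exprn_gt0// -exprVn; apply: hausdorff_lipschitz; first by rewrite invr_gt0.
by move=> x y _ _; rewrite E enormZ gtr0_norm// mulKf// gt_eqF.
Qed.

Lemma hmeas_cube v (r : R) : (0 < r)%R ->
  hmeas p f (cube v r) = (r ^+ m)%:E * hmeas p f (cube 0 1).
Proof. by move=> r0; rewrite cubeE// hmeas_affine. Qed.

End Linear.
End Haar.

Section HaarUnique.
Context (R : realType) (p : nat).
Local Notation m := p.+1.
Local Open Scope ereal_scope.

Lemma lam_affine (A : set 'rV[R]_m) v (r : R) : (0 < r)%R ->
  lam R p ((fun x => v + r *: x)%R @` A) = (r ^+ m)%:E * lam R p A.
Proof. by move=> r0; apply: (@hmeas_affine _ _ _ (idmap_ R m)). Qed.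

Lemma lam_cube v (r : R) : (0 < r)%R -> lam R p (cube v r) = (r ^+ m)%:E * lam R p (cube 0 1).
Proof. by move=> r0; rewrite cubeE// lam_affine. Qed.

(** The dyadic cube of side [2 ^- k] around [x], written with floors: nesting reduces to the fact
    that the floor of 2s determines the floor of s. *)
Definition dcls (k : nat) (x : 'rV[R]_m) : set 'rV[R]_m :=
  [set y | forall i, Num.floor (2 ^+ k * y ord0 i)%R = Num.floor (2 ^+ k * x ord0 i)%R].

Lemma dclsE k x : dcls k x = cube (\row_i ((Num.floor (2 ^+ k * x ord0 i))%:~R / 2 ^+ k)%R) (2 ^- k)%R.
Proof.
have k0 : (0 < 2 ^+ k :> R)%R by rewrite exprn_gt0.
apply/seteqP; split=> y H i; have := H i; rewrite !mxE.
  move=> <-; have /andP[h1 h2] := floor_itv (2 ^+ k * y ord0 i)%R.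
  apply/andP; split; first by rewrite ler_pdivrMr// [X in (_ <= X)%R]mulrC.
  rewrite -[X in (_ < _ + X)%R]mul1r -mulrDl ltr_pdivlMr// [X in (X < _)%R]mulrC.
  by rewrite (lt_le_trans h2)// intrD.
rewrite -[X in (_ < _ + X)%R]mul1r -mulrDl ltr_pdivlMr// ler_pdivrMr// [(y _ _ * _)%R]mulrC => h.
by apply: floor_def; rewrite intrD.
Qed.

Lemma dcls_step k x y : dcls k.+1 x y -> dcls k x y.
Proof.
have H (s t : R) : Num.floor (2 * s)%R = Num.floor (2 * t)%R -> (Num.floor s <= Num.floor t)%R.
  move=> st; rewrite leNgt; apply/negP => h.
  have h1 : (t < (Num.floor s)%:~R)%R by rewrite -floor_lt_int.
  have : (Num.floor (2 * t)%R < 2 * Num.floor s)%R.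
    by rewrite floor_lt_int intrM ltr_pM2l.
  by rewrite -st floor_lt_int intrM ltr_pM2l// ltNge floor_le.
move=> h i; have := h i; rewrite exprS -!mulrA => e.
by apply/eqP; rewrite eq_le !H.
Qed.

Lemma dcls_le k l x y : (k <= l)%N -> dcls l x y -> dcls k x y.
Proof.
move=> /subnK <-; elim: (l - k)%N => // j IH h; apply: IH; exact: dcls_step.
Qed.

Lemma dcls_eq k x y : dcls k x y -> dcls k y = dcls k x.
Proof. by move=> h; apply/seteqP; split=> z hz i; rewrite hz h. Qed.

Definition dyadics : set (set 'rV[R]_m) := [set A | A = set0 \/ exists k x, A = dcls k x].

Lemma dyadics_setI : setI_closed dyadics.
Proof.
move=> A B [->|[k [x ->]]]; first by rewrite set0I; left.
case=> [->|[l [y ->]]]; first by rewrite setI0; left.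
have [/eqP->|/set0P[z [xz yz]]] := boolP (dcls k x `&` dcls l y == set0); first by left.
rewrite -(dcls_eq xz) -(dcls_eq yz); right.
have [kl|lk] := leqP k l.
  by exists l, z; apply/seteqP; split=> [w []//|w h]; split=> //; apply: (dcls_le kl).
by exists k, z; apply/seteqP; split=> [w []//|w h]; split=> //; apply: (dcls_le (ltnW lk)).
Qed.

Lemma dcls_borel k x : measurable (dcls k x : set (borelRV R m)).
Proof. by rewrite dclsE; apply: cube_borel. Qed.

(** The same cubes indexed by a countable type, so that unions can be enumerated through
    [pickle]. *)
Definition dnode (z : nat * 'rV[int]_m) : set 'rV[R]_m :=
  [set y | forall i, Num.floor (2 ^+ z.1 * y ord0 i)%R = z.2 ord0 i].

Lemma dnode_dyadic z : dyadics (dnode z).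
Proof.
have [/eqP->|/set0P[x xz]] := boolP (dnode z == set0); first by left.
right; exists z.1, x; apply/seteqP; split=> y h i; first by rewrite h xz.
by rewrite h xz.
Qed.

Lemma dcls_sub (U : set 'rV[R]_m) x : open U -> U x -> exists k, dcls k x `<=` U.
Proof.
move=> oU Ux; have /nbhs_enball[r r0 H] : nbhs x U by apply: open_nbhs_nbhs.
pose k := Num.truncn (m%:R / r).
exists k => y xy; apply: H.
have xx : dcls k x x by [].
move: xy xx; rewrite dclsE => hy hx; have := cube_dist hx hy; move/le_lt_trans; apply.
rewrite ltr_pdivrMr ?exprn_gt0// mulrC -ltr_pdivrMr//.
apply: (lt_le_trans (truncnS_gt _)).
by rewrite -natrX ler_nat -/k ltn_expl.
Qed.

Lemma open_dyadic (U : set 'rV[R]_m) : open U ->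
  U = \bigcup_(z in [set z | dnode z `<=` U]) dnode z.
Proof.
move=> oU; apply/seteqP; split=> [x Ux|x [z /= zU /zU]//].
have [k kU] := dcls_sub oU Ux.
exists (k, \row_i Num.floor (2 ^+ k * x ord0 i)%R).
  by move=> y hy; apply: kU => i; have := hy i; rewrite mxE.
by move=> i; rewrite mxE.
Qed.

Lemma dyadics_generate : @measurable _ (borelRV R m) = <<s dyadics >>.
Proof.
apply/seteqP; split; apply: smallest_sub.
- exact: smallest_sigma_algebra.
- move=> U oU; rewrite (open_dyadic oU).
  have -> : \bigcup_(z in [set z | dnode z `<=` U]) dnode z =
     \bigcup_k (if unpickle k is Some z then if `[<dnode z `<=` U>] then dnode z else set0 else set0).
    apply/seteqP; split=> [x [z zU xz]|x [k _]].
      exists (pickle z) => //; rewrite pickleK; case: asboolP => // ?.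
    by case: unpickle => [z|//]; case: asboolP => // zU xz; exists z.
  apply: sigma_algebra_bigcup => k; apply: sub_sigma_algebra.
  by case: unpickle => [z|]; [case: asboolP => _; [exact: dnode_dyadic|left]|left].
- exact: (@sigma_algebra_measurable _ (borelRV R m)).
- by move=> A [->|[k [x ->]]]; [exact: measurable0|exact: dcls_borel].
Qed.

(** Dyadic cubes are nested or disjoint, hence form with the empty set a generating family stable
    under intersection; the unit ones exhaust the space. *)
Lemma haar_unique (mu1 mu2 : {measure set (borelRV R m) -> \bar R}) :
  (forall v (r : R), (0 < r)%R -> mu1 (cube v r) = mu2 (cube v r)) ->
  (forall v (r : R), (0 < r)%R -> mu1 (cube v r) < +oo) ->
  forall A, measurable A -> mu1 A = mu2 A.
Proof.
move=> H Hfin.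
pose g k : set 'rV[R]_m := if unpickle k is Some z then dnode (0%N, z) else set0.
have gG k : dyadics (g k) by rewrite /g; case: unpickle => [z|]; [exact: dnode_dyadic|left].
have HG A : dyadics A -> mu1 A = mu2 A /\ mu1 A < +oo.
  move=> [->|[k [x ->]]]; first by rewrite !measure0.
  by rewrite dclsE H ?invr_gt0 ?exprn_gt0// -H ?Hfin// ?invr_gt0 ?exprn_gt0.
apply: (@measure_unique _ R (borelRV R m) dyadics g dyadics_generate dyadics_setI gG).
- apply/seteqP; split=> // x _; exists (pickle (\row_i Num.floor (x ord0 i)%R)) => //.
  by rewrite /g pickleK => i; rewrite !mxE expr0 mul1r.
- by move=> A /HG[].
- by move=> k; have [] := HG _ (gG k).
Qed.

Context (n : nat).

Definition jac (f : expanding_map R m n) : R := fine (hmeas p f (cube 0 1)) / fine (lam R p (cube 0 1)).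

Lemma lam_unit_fin : lam R p (cube 0 1) \is a fin_num.
Proof. by rewrite ge0_fin_numE ?measure_ge0// lam_cube_fin. Qed.

Lemma lam_unit_gt0 : (0 < fine (lam R p (cube 0 1)))%R.
Proof. by rewrite fine_gt0// lam_cube_gt0 -ge0_fin_numE ?lam_unit_fin// measure_ge0. Qed.

Section Jac.
Variables (f : expanding_map R m n) (K : R).
Hypothesis K0 : (0 < K)%R.
Hypothesis flin : forall a x y, f (a *: x + y)%R = (a *: f x + f y)%R.
Hypothesis fK : forall x y, (enorm (f x - f y) <= K * enorm (x - y))%R.

Lemma hmeas_cube_fin : hmeas p f (cube 0 1) \is a fin_num.
Proof.
rewrite ge0_fin_numE ?measure_ge0//.
apply: (@le_lt_trans _ _ ((K ^+ m)%:E * lam R p (cube 0 1))).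
  rewrite lamE -[X in hausdorff m X]image_id; apply: hausdorff_lipschitz => // x y _ _; exact: fK.
by rewrite -(fineK lam_unit_fin) -EFinM ltry.
Qed.

Lemma jac_gt0 : (0 < jac f)%R.
Proof.
rewrite divr_gt0// ?lam_unit_gt0// -lte_fin fineK ?hmeas_cube_fin//.
have [c c0 Hc] := emapP f.
have H : lam R p (cube 0 1) <= ((c^-1 ^+ m)%:E * hmeas p f (cube 0 1)).
  rewrite lamE -[X in hausdorff m X]image_id; apply: hausdorff_lipschitz; first by rewrite invr_gt0.
  by move=> x y _ _; rewrite ler_pdivlMl.
rewrite lt_def measure_ge0 andbT; apply/eqP => H0; move: H; rewrite H0 mule0.
by rewrite leNgt lam_cube_gt0.
Qed.

(** Both sides scale cubes by [r ^+ m] and ignore translations, so equality on the unit cube, which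
    is the definition of [jac], propagates to all cubes. *)
Lemma haar A : measurable A -> hmeas p f A = (jac f)%:E * lam R p A.
Proof.
pose mu2 : {measure set (borelRV R m) -> \bar R} := mscale (NngNum (ltW jac_gt0)) (lam R p).
apply: (@haar_unique (hmeas p f) mu2) => v r r0.
  transitivity ((r ^+ m)%:E * hmeas p f (cube 0 1)); first exact: hmeas_cube.
  rewrite -[RHS]/((jac f)%:E * lam R p (cube v r)) lam_cube// muleCA; congr (_ * _).
  rewrite -(fineK hmeas_cube_fin) -[in RHS](fineK lam_unit_fin) -EFinM; congr (_%:E).
  by rewrite /jac divfK// gt_eqF// lam_unit_gt0.
rewrite [X in X < _](_ : _ = (r ^+ m)%:E * hmeas p f (cube 0 1)); last exact: hmeas_cube.
by rewrite -(fineK hmeas_cube_fin) -EFinM ltry.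
Qed.

End Jac.
End HaarUnique.

(** * Layer cake and local comparison of measures *)

Section MeasureTools.
Context (R : realType).
Local Open Scope ereal_scope.

Lemma to_measure d (T : measurableType d) (phi : set T -> \bar R) :
  phi set0 = 0 -> (forall A, 0 <= phi A) -> semi_sigma_additive phi ->
  exists M : {measure set T -> \bar R}, forall A, M A = phi A.
Proof.
move=> h0 h1 h2.
pose H := isMeasure.Build d T R phi h0 h1 h2.
by exists (HB.pack_for {measure set T -> \bar R} phi H).
Qed.

(** [N] behaves like the preimage under a partial map from [T] to [U], given without the map: each
    point of [N B] has a value [u] that decides membership in every [N B']. It is applied to the map
    sending a boundary point to its unique normal. *)
Lemma integral_measure d d' (T : measurableType d) (U : measurableType d')
    (kappa : {measure set T -> \bar R}) (N : set U -> set T) (f : T -> R) :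
  (forall B, measurable B -> measurable (N B)) ->
  (forall B x, N B x -> exists2 u, B u & forall B', N B' x <-> B' u) ->
  measurable_fun (N setT) f -> (forall x, N setT x -> (0 <= f x)%R) ->
  exists M : {measure set U -> \bar R}, forall B, measurable B ->
    M B = \int[kappa]_(x in N B) (f x)%:E.
Proof.
move=> mN NE mf f0.
pose phi B := \int[kappa]_(x in N B) (f x)%:E.
have NT B x : N B x -> N setT x by move=> /NE[u _ H]; apply/H.
have N0 : N set0 = set0 by apply/seteqP; split=> // x /NE[].
have NU (F : nat -> set U) : N (\bigcup_i F i) = \bigcup_i N (F i).
  apply/seteqP; split=> x.
    by move=> Nx; have [u [i _ Fu] H] := NE _ _ Nx; exists i => //; apply/H.
  by move=> [i _ Nx]; have [u Fu H] := NE _ _ Nx; apply/H; exists i.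
have [M HM] : exists M : {measure set U -> \bar R}, forall B, M B = phi B; last by exists M => B _; rewrite HM.
apply: to_measure; rewrite /phi; first by rewrite N0 integral_set0.
  by move=> B; apply: integral_ge0 => x /NT Nx; rewrite lee_fin f0.
move=> F mF tF mUF; rewrite NU.
rewrite ge0_integral_bigcup//; last 4 first.
- by move=> k; apply: mN.
- apply/measurable_EFinP; apply: measurable_funS mf; first exact: mN.
  by move=> x [i _ /NT].
- by move=> x [i _ /NT Nx]; rewrite lee_fin f0.
- apply/trivIsetP => i j _ _ ij; apply/seteqP; split=> // x [Ni Nj].
  have [u Fi H] := NE _ _ Ni; have /H Fj := Nj.
  by move/trivIsetP : tF => /(_ i j I I ij)/seteqP[/(_ u (conj Fi Fj))].
apply: is_cvg_nneseries => i _ _; apply: integral_ge0 => x /NT Nx; rewrite lee_fin f0//.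
Qed.

Lemma nonincreasing_emeasurable (phi : R -> \bar R) (D : set R) : is_interval D ->
  (forall s t, D s -> D t -> (s <= t)%R -> phi t <= phi s) -> measurable_fun D phi.
Proof.
move=> iD H mD; apply: (measurability _ (ErealGenOInfty.measurableE R)) mD => _ [_ [x ->] <-].
apply: is_interval_measurable => s t [Ds]/= hs [Dt]/= ht u sut.
have Du : D u by apply: (iD s t).
split=> //=; have [us ut] := andP sut.
move: ht; rewrite !in_itv/= !andbT => ht; apply: lt_le_trans ht _; exact: H.
Qed.

Lemma interval_ge0 : is_interval (`[0%R, +oo[%classic : set R).
Proof. exact: interval_is_interval. Qed.

Lemma measurable_hausdorff_sup n s (A : set 'rV[R]_n) (f : 'rV[R]_n -> R) :
  measurable_fun (`[0%R, +oo[%classic : set R) (fun t => hausdorff s.+1 (A `&` [set x | (t < f x)%R])).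
Proof.
apply: nonincreasing_emeasurable; first exact: interval_ge0.
by move=> t u _ _ tu; apply: le_hausdorff => x [Ax /=]; split=> //=; apply: le_lt_trans tu _.
Qed.

(** Tonelli on the region below the graph of [f]. This links [hint], which is defined through level
    sets, with a true integral. *)
Lemma layer_cake d (T : measurableType d) (mu : {measure set T -> \bar R}) (A : set T) (f : T -> R) :
  sigma_finite setT mu -> measurable A -> measurable_fun A f -> (forall x, A x -> (0 <= f x)%R) ->
  \int[@lebesgue_measure R]_(t in `[0%R, +oo[%classic) mu (A `&` [set x | (t < f x)%R])
    = \int[mu]_(x in A) (f x)%:E.
Proof.
move=> sf mA mf f0.
pose H1 := isSFinite.Build _ _ _ _ (sfinite_measure_sigma_finite sf).
pose H2 := isSigmaFinite.Build _ _ _ _ sf.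
pose mu' : {sigma_finite_measure set T -> \bar R} :=
  HB.pack_for {sigma_finite_measure set T -> \bar R} (Measure.sort mu) H1 H2.
pose g := patch (fun=> 0%R) A f.
have mg : measurable_fun setT g by apply/(measurable_restrictT _ mA).
have ml : measurable_fun setT (fun z : T * R => (z.2 < (g \o fst) z)%R).
  apply: measurable_fun_ltr; first exact: measurable_snd.
  by apply: measurableT_comp => //; exact: measurable_fst.
pose E : set (T * R) := [set z | A z.1 /\ ((0 <= z.2)%R /\ (z.2 < g z.1)%R)].
have mE : measurable E.
  rewrite (_ : E = (fst @^-1` A) `&` ((snd @^-1` `[0%R, +oo[%classic) `&`
      ((fun z : T * R => (z.2 < (g \o fst) z)%R) @^-1` [set true]))).
    apply: measurableI; first by rewrite -[X in measurable X]setTI; apply: measurable_fst.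
    apply: measurableI.
      by rewrite -[X in measurable X]setTI; apply: measurable_snd => //; exact: measurable_itv.
    by rewrite -[X in measurable X]setTI; apply: ml.
  by apply/seteqP; split=> -[x t] /=; rewrite in_itv/= andbT.
have HF : \int[mu']_x \int[@lebesgue_measure R]_y (\1_E (x, y))%:E =
    \int[@lebesgue_measure R]_y \int[mu']_x (\1_E (x, y))%:E.
  apply: (@fubini_tonelli _ _ T (measurableTypeR R) R mu' (@lebesgue_measure R) (fun z => (\1_E z)%:E)).
    by apply/measurable_EFinP; apply: measurable_indic.
  by move=> z; rewrite lee_fin indicE.
transitivity (\int[@lebesgue_measure R]_y \int[mu']_x (\1_E (x, y))%:E).
  rewrite integral_mkcond; apply: eq_integral => t _; rewrite patchE; case: ifPn.
    rewrite inE/= in_itv/= andbT => t0.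
    rewrite (_ : (fun x => _) = (fun x => (\1_(A `&` [set x | (t < f x)%R]) x)%:E)).
      rewrite integral_indic// ?setIT//.
      rewrite (_ : _ `&` _ = A `&` (fun x => (t < f x)%R) @^-1` [set true])//.
      by apply: measurable_fun_ltr => //; exact: measurable_cst.
    apply/funext => x; rewrite !indicE; congr (_%:R%:E); congr nat_of_bool.
    apply/idP/idP; rewrite !inE /E/= /g patchE.
      by move=> [Ax [_]]; rewrite mem_set.
    by move=> [Ax]; rewrite mem_set.
  move=> t0; rewrite integral0_eq// => x _; rewrite indicE memNset// => -[_ [t1 _]].
  by move: t0; rewrite notin_setE/= in_itv/= andbT t1.
rewrite -HF.
rewrite [RHS]integral_mkcond; apply: eq_integral => x _; rewrite patchE; case: ifPn.
  rewrite inE => Ax.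
  rewrite (_ : (fun t => _) = (fun t => (\1_(`[0%R, f x[%classic) t)%:E)).
    rewrite integral_indic// ?setIT; transitivity (@lebesgue_measure R `[0%R, f x[%classic) => //.
    rewrite lebesgue_measure_itv/= lte_fin sube0; case: ifP => // /negbT; rewrite -leNgt => h.
    by congr (_%:E); apply/eqP; rewrite eq_le h f0.
  apply/funext => t; rewrite !indicE; congr (_%:R%:E); congr nat_of_bool.
  apply/idP/idP; rewrite !inE /E/= /g patchE mem_set//= in_itv/=.
    by move=> [_ [-> ->]].
  by move=> /andP[].
rewrite notin_setE => nAx; rewrite integral0_eq// => t _; rewrite indicE memNset// => -[/nAx[]].
Qed.

(** For fixed [e], countably many dyadic cubes on which the estimate holds cover [A]; made disjoint,
    they give it on [A] with the same factor [1 + e], and then [e] tends to 0. *)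
Lemma local_le p (a b : {measure set (borelRV R p.+1) -> \bar R}) (Om : set (borelRV R p.+1)) :
  measurable Om ->
  (forall (e : R) u, (0 < e)%R -> Om u -> exists2 U : set 'rV[R]_p.+1, nbhs u U &
     forall A, measurable A -> A `<=` Om `&` U -> a A <= (1 + e)%:E * b A) ->
  forall A, measurable A -> A `<=` Om -> a A <= b A.
Proof.
move=> mOm H A mA AOm.
have key (e : R) : (0 < e)%R -> a A <= (1 + e)%:E * b A.
  move=> e0.
  pose good (z : nat * 'rV[int]_p.+1) := forall B, measurable B -> B `<=` Om `&` @dnode R p z -> a B <= (1 + e)%:E * b B.
  pose F k : set (borelRV R p.+1) := if unpickle k is Some z then if `[<good z>] then @dnode R p z else set0 else set0.
  have mF k : measurable (F k).
    rewrite /F; case: unpickle => [z|//]; case: asboolP => // _.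
    rewrite dyadics_generate; apply: sub_sigma_algebra; exact: dnode_dyadic.
  have FA B k : measurable B -> B `<=` Om `&` F k -> a B <= (1 + e)%:E * b B.
    rewrite /F; case: unpickle => [z|_ BF]; last first.
      by rewrite (_ : B = set0) ?measure0 ?mule0//; apply/seteqP; split=> // x /BF[].
    case: asboolP => [gz mB BF|_ _ BF]; first exact: gz.
    by rewrite (_ : B = set0) ?measure0 ?mule0//; apply/seteqP; split=> // x /BF[].
  have cov : A `<=` \bigcup_k F k.
    move=> x Ax; have [U Ux HU] := H e x e0 (AOm _ Ax).
    have [V [oV Vx] VU] : exists2 V, open_nbhs x V & V `<=` U by move: Ux; rewrite nbhsE.
    have := Vx; rewrite (open_dyadic oV) => -[z zV xz].
    exists (pickle z) => //; rewrite /F pickleK; case: asboolP => // -[] B mB BOm.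
    by apply: HU => // y /BOm[Oy /zV /VU].
  pose G k := A `&` seqDU F k.
  have mG k : measurable (G k).
    by apply: measurableI => //; apply: measurableD => //; apply: bigsetU_measurable.
  have tG : trivIset setT G.
    by apply: trivIset_setIl; exact: trivIset_seqDU.
  have AE : A = \bigcup_k G k.
    by rewrite -setI_bigcupr -seqDU_bigcup_eq; apply/esym/setIidPl.
  rewrite AE !measure_bigcup//; [|by rewrite -AE..].
  rewrite -nneseriesZl//; apply: lee_nneseries => // k _; apply: (FA _ k) => // x [Ax [Fx _]].
  by split=> //; apply: AOm.
have [boo|boo] := eqVneq (b A) +oo; first by rewrite boo leey.
have fb : b A \is a fin_num by rewrite ge0_fin_numE ?measure_ge0// ltey.
have b1 : (0 < fine (b A) + 1)%R by rewrite ltr_wpDl// fine_ge0// measure_ge0.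
apply/lee_addgt0Pr => e e0.
have := key (e / (fine (b A) + 1))%R; rewrite divr_gt0// => /(_ isT)/le_trans; apply.
rewrite -(fineK fb) -EFinM -EFinD lee_fin mulrDl mul1r lerD2l -mulrA ler_piMr ?(ltW e0)//.
by rewrite ler_pdivrMl// mulr1 lerDl.
Qed.

Lemma sigma_finite_lipschitz p n (f : expanding_map R p.+1 n) (K : R) : (0 < K)%R ->
  (forall x y, (enorm (f x - f y) <= K * enorm (x - y))%R) -> sigma_finite setT (hmeas p f).
Proof.
move=> K0 fK.
pose F k : set (borelRV R p.+1) := cube (\row__ (- k.+1%:R)%R) (2 * k.+1%:R)%R.
exists F.
  apply/seteqP; split=> // x _; exists (Num.truncn `|x|) => // i.
  have : (`|x ord0 i| < (Num.truncn `|x|).+1%:R)%R by apply: le_lt_trans (coord_le_norm _ _) (truncnS_gt _).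
  by rewrite !mxE ltr_norml; lra.
move=> k; split; first exact: cube_borel.
apply: (@le_lt_trans _ _ ((K ^+ p.+1)%:E * lam R p (F k))).
  rewrite lamE -[X in hausdorff p.+1 X]image_id; apply: hausdorff_lipschitz => // x y _ _; exact: fK.
by rewrite lam_cube ?mulr_gt0// -(fineK (lam_unit_fin R p)) -!EFinM ltry.
Qed.

Lemma sigma_finite_lam p : sigma_finite setT (lam R p).
Proof. by apply: (@sigma_finite_lipschitz p _ (idmap_ R p.+1) 1%R) => // x y; rewrite mul1r. Qed.

Section IntegralOrder.
Context d (T : measurableType d) (mu : {measure set T -> \bar R}).

Lemma le_int (D : set T) (f g : T -> R) : measurable D -> measurable_fun D f -> measurable_fun D g ->
  (forall x, D x -> (0 <= f x)%R) -> (forall x, D x -> (f x <= g x)%R) ->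
  \int[mu]_(x in D) (f x)%:E <= \int[mu]_(x in D) (g x)%:E.
Proof.
move=> mD mf mg f0 fg.
apply: ge0_le_integral => //; try (by move=> x Dx; rewrite lee_fin ?f0 ?fg ?(le_trans (f0 _ Dx))// fg);
  exact/measurable_EFinP.
Qed.

Lemma sub_int (A B : set T) (f : T -> R) : measurable A -> measurable B -> measurable_fun B f ->
  (forall x, B x -> (0 <= f x)%R) -> A `<=` B ->
  \int[mu]_(x in A) (f x)%:E <= \int[mu]_(x in B) (f x)%:E.
Proof.
move=> mA mB mf f0 AB; apply: ge0_subset_integral => //; first exact/measurable_EFinP.
Qed.

Lemma int_cst (D : set T) (k : R) : measurable D -> \int[mu]_(x in D) k%:E = k%:E * mu D.
Proof. by move=> mD; exact: (integral_cst mu mD k%:E). Qed.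

Lemma int_indic (D N : set T) (f : T -> R) : N `<=` D ->
  \int[mu]_(x in N) (f x)%:E = \int[mu]_(x in D) (\1_N x * f x)%:E.
Proof.
move=> ND; rewrite [in LHS](_ : N = D `&` N); last by apply/esym/setIidPr.
rewrite integral_mkcondr; apply: eq_integral => x _; rewrite patchE indicE.
by case: ifPn => _; rewrite ?mul1r ?mul0r.
Qed.

End IntegralOrder.

Lemma limn_einf_gt (u : nat -> \bar R) (r : \bar R) : r < limn_einf u -> \forall k \near \oo, r < u k.
Proof.
rewrite limn_einf_lim (cvg_lim _ (@cvg_einfs_sup _ u))// => /ereal_sup_gt[_ [N _ <-]] rN.
exists N => // k /= Nk; apply: lt_le_trans rN _; apply: ereal_inf_lbound; exists k => //.
Qed.

Lemma limn_einf_ge0 (u : nat -> \bar R) : (forall k, 0 <= u k) -> 0 <= limn_einf u.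
Proof.
move=> u0; rewrite limn_einf_lim (cvg_lim _ (@cvg_einfs_sup _ u))//.
apply: (@le_trans _ _ (einfs u 0%N)); last by apply: ereal_sup_ubound; exists 0%N.
by apply: le_ereal_inf_tmp => _ [k _ <-]; exact: u0.
Qed.

End MeasureTools.

(** * Pseudo-cones as epigraphs *)

(* The data of the theorem in dimension p.+2, with a direction [we] along which to project onto the hyperplane of
   vectors with first coordinate 0. *)
Record wcone (R : realType) (p : nat) := Wcone {
  wC : set 'rV[R]_p.+2 ;
  wCP : proper_cone wC ;
  we : 'rV[R]_p.+2 ;
  we_int : interior wC we ;
  we0 : we ord0 ord0 != 0 ;
  wq : R ;
  wq0 : 0 <= wq ;
  wq1 : wq < p.+1%:R ;
  wT : 'rV[R]_p.+2 -> R ;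
  wT_pos : forall x, wC x -> x != 0 -> 0 < wT x ;
  wT_cont : {within wC `\ 0, continuous wT} ;
  wT_hom : forall x (l : R), wC x -> x != 0 -> 0 < l -> wT (l *: x) = l `^ (- wq) * wT x }.

Section Frame.
Context (R : realType) (p : nat) (W : wcone R p).
Local Notation m := p.+1.
Local Notation n := p.+2.
Local Notation C := (wC W).
Local Notation e := (we W).
Local Notation q := (wq W).
Local Notation Theta := (wT W).

Definition iota_ (x : 'rV[R]_m) : 'rV[R]_n :=
  \row_(i < n) (if unlift ord0 i is Some j then x ord0 j else 0).

(* The coordinates (x, s) of [iota_ x + s *: e], in which boundaries become graphs over R^m. *)
Definition gam (x : 'rV[R]_m) (s : R) : 'rV[R]_n := iota_ x + s *: e.
Definition ht (X : 'rV[R]_n) : R := X ord0 ord0 / e ord0 ord0.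
Definition prj (X : 'rV[R]_n) : 'rV[R]_m := \row_j (X - ht X *: e) ord0 (lift ord0 j).

Lemma gamE x s : gam x s = iota_ x + s *: e. Proof. by []. Qed.

Lemma iota_lin a x y : iota_ (a *: x + y) = a *: iota_ x + iota_ y.
Proof.
apply/rowP => i; rewrite !mxE; case: unlift => [j|]; first by rewrite !mxE.
by rewrite mulr0 addr0.
Qed.

Lemma iota0 : iota_ 0 = 0.
Proof. by have := iota_lin (-1) 0 0; rewrite scaler0 addr0 scaleN1r addNr. Qed.

Lemma enorm_iota x : enorm (iota_ x) = enorm x.
Proof.
congr Num.sqrt; rewrite /dotv big_ord_recl !mxE unlift_none mul0r add0r.
by apply: eq_bigr => j _; rewrite !mxE liftK.
Qed.

Lemma gam_lin a x y s t : gam (a *: x + y) (a * s + t) = a *: gam x s + gam y t.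
Proof. by rewrite /gam iota_lin scalerDl scalerDr -scalerA addrACA. Qed.

Lemma gamD x y s t : gam (x + y) (s + t) = gam x s + gam y t.
Proof. by have := gam_lin 1 x y s t; rewrite !scale1r mul1r. Qed.

Lemma gam0 : gam 0 0 = 0.
Proof. by rewrite /gam iota0 scale0r addr0. Qed.

Lemma gamZ a x s : gam (a *: x) (a * s) = a *: gam x s.
Proof. by have := gam_lin a x 0 s 0; rewrite gam0 !addr0. Qed.

Lemma gamB x y s t : gam (x - y) (s - t) = gam x s - gam y t.
Proof. by have := gam_lin (-1) y x t s; rewrite !scaleN1r mulN1r ![- _ + _]addrC. Qed.

Lemma gam_e s : gam 0 s = s *: e.
Proof. by rewrite /gam iota0 add0r. Qed.

Lemma ht_lin a X Y : ht (a *: X + Y) = a * ht X + ht Y.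
Proof. by rewrite /ht !mxE mulrDl mulrA. Qed.

Lemma htD X Y : ht (X + Y) = ht X + ht Y.
Proof. by have := ht_lin 1 X Y; rewrite scale1r mul1r. Qed.

Lemma htZ a X : ht (a *: X) = a * ht X.
Proof. by rewrite /ht mxE mulrA. Qed.

Lemma ht_gam x s : ht (gam x s) = s.
Proof. by rewrite /ht !mxE unlift_none add0r mulfK// we0. Qed.

Lemma prj_lin a X Y : prj (a *: X + Y) = a *: prj X + prj Y.
Proof. by apply/rowP => j; rewrite !mxE ht_lin; ring. Qed.

Lemma prjD X Y : prj (X + Y) = prj X + prj Y.
Proof. by have := prj_lin 1 X Y; rewrite !scale1r. Qed.

Lemma prjZ a X : prj (a *: X) = a *: prj X.
Proof. by apply/rowP => j; rewrite !mxE htZ; ring. Qed.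

Lemma prj_gam x s : prj (gam x s) = x.
Proof. by apply/rowP => j; rewrite mxE ht_gam !mxE liftK addrK. Qed.

Lemma iota_prj X : iota_ (prj X) = X - ht X *: e.
Proof.
apply/rowP => i; rewrite !mxE; case: unliftP => [j ->|->]; first by rewrite !mxE.
by rewrite /ht divfK ?subrr// we0.
Qed.

Lemma gamK X : gam (prj X) (ht X) = X.
Proof. by rewrite /gam iota_prj subrK. Qed.

Lemma gam_le x s : enorm (gam x s) <= enorm x + `|s| * enorm e.
Proof. by rewrite (le_trans (enormD _ _))// enorm_iota enormZ. Qed.

Definition Kp : R := 1 + (1 + enorm e) / `|e ord0 ord0|.

Lemma Kp_gt0 : 0 < Kp.
Proof. by rewrite ltr_pwDl// divr_ge0// addr_ge0. Qed.

Lemma ht_le X : `|ht X| <= Kp * enorm X.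
Proof.
have e0 : 0 < `|e ord0 ord0| by rewrite normr_gt0 we0.
rewrite normrM normfV ler_pdivrMr// /Kp mulrAC mulrDl mul1r divfK ?gt_eqF//.
apply: (le_trans (coord_le_norm X ord0)); apply: (le_trans (norm_le_enorm X)).
by rewrite ler_peMl//; have := enorm_ge0 e; have := normr_ge0 (e ord0 ord0); lra.
Qed.

Lemma prj_le X : enorm (prj X) <= Kp * enorm X.
Proof.
have e0 : 0 < `|e ord0 ord0| by rewrite normr_gt0 we0.
rewrite -enorm_iota iota_prj (le_trans (enormD _ _))// enormN enormZ.
rewrite /Kp [X in _ <= X]mulrDl mul1r lerD2l normrM normfV mulrAC [X in _ <= X]mulrAC.
rewrite ler_pM2r ?invr_gt0// mulrC; apply: ler_pM => //; first by rewrite lerDr.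
by rewrite (le_trans (coord_le_norm _ _))// norm_le_enorm.
Qed.

Lemma ht_continuous : continuous ht.
Proof.
apply: (@lip_continuous _ _ _ _ (Kp * n%:R)) => x y.
rewrite -[ht x - ht y](_ : ht (x - y) = _); last by rewrite addrC -scaleN1r ht_lin mulN1r addrC.
by rewrite (le_trans (ht_le _))// -mulrA ler_wpM2l ?(ltW Kp_gt0)// enorm_le_norm.
Qed.

Lemma prj_continuous : continuous prj.
Proof.
apply: (@lip_continuous _ _ _ _ (Kp * n%:R)) => x y.
rewrite -[prj x - prj y](_ : prj (x - y) = _); last by rewrite addrC -scaleN1r prj_lin scaleN1r addrC.
rewrite (le_trans (norm_le_enorm _))// (le_trans (prj_le _))//.
by rewrite -mulrA ler_wpM2l ?(ltW Kp_gt0)// enorm_le_norm.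
Qed.

Lemma cvg_gam (I : Type) (F : set_system I) (FF : Filter F) (x : I -> 'rV[R]_m) (s : I -> R) x0 s0 :
  x i @[i --> F] --> x0 -> s i @[i --> F] --> s0 -> gam (x i) (s i) @[i --> F] --> gam x0 s0.
Proof.
move=> hx hs; apply: cvgD; last by apply: cvgZl.
apply: (@cvg_comp _ _ _ x iota_ _ (nbhs x0)) => //.
apply: (@lip_continuous _ _ _ _ m%:R) => u v.
rewrite -[iota_ u - iota_ v](_ : iota_ (u - v) = _); last by rewrite addrC -scaleN1r iota_lin scaleN1r addrC.
by rewrite (le_trans (norm_le_enorm _))// enorm_iota enorm_le_norm.
Qed.

Lemma wC_closed : closed C. Proof. by case: (wCP W). Qed.

Lemma CZ x l : C x -> 0 <= l -> C (l *: x). Proof. by case: (wCP W) => h *; apply: h. Qed.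

Lemma CD x y : C x -> C y -> C (x + y).
Proof.
case: (wCP W) => h1 h2 _ _ _ Cx Cy.
have -> : x + y = 2 *: ((1 - 2^-1) *: x + 2^-1 *: y).
  rewrite scalerDr !scalerA mulfV// mulrBr mulr1 mulfV// scale1r.
  by rewrite (_ : 2 - 1 = 1 :> R) ?scale1r//; ring.
by apply: h1 => //; apply: h2 => //; lra.
Qed.

Lemma Ce : C e. Proof. exact: interior_subset (we_int W). Qed.

Lemma C0 : C 0. Proof. by have := CZ Ce (lexx 0); rewrite scale0r. Qed.

Lemma C_pointed x : C x -> C (- x) -> x = 0.
Proof.
case: (wCP W) => _ _ _ h _ Cx CNx; suff : (C `&` [set x | C (- x)]) x by rewrite h.
by [].
Qed.

Lemma e_neq0 : e != 0.
Proof. by apply/eqP => h; have := we0 W; rewrite h mxE eqxx. Qed.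

Lemma e_ball : exists2 r : R, 0 < r & forall z, enorm z <= r -> C (e + z).
Proof.
have /nbhs_enball[r r0 H] := we_int W; exists (r / 2); first by rewrite divr_gt0.
move=> z zr; apply: H; rewrite opprD addNKr enormN (le_lt_trans zr)//.
by rewrite ltr_pdivrMr// ltr_pMr// ltr1n.
Qed.

Definition er : R := projT1 (cid2 e_ball).
Lemma er_gt0 : 0 < er. Proof. by rewrite /er; case: cid2. Qed.
Lemma C_ball z : enorm z <= er -> C (e + z). Proof. by rewrite /er; case: cid2 => r r0 /= H; apply: H. Qed.

(** The common Lipschitz constant, for [enorm], of all boundary functions below. *)
Definition kap : R := er^-1.
Lemma kap_gt0 : 0 < kap. Proof. by rewrite invr_gt0 er_gt0. Qed.

(** [C] contains the circular cone spanned by the ball of radius [er] around [e]. *)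
Lemma C_kap z s : kap * enorm z <= s -> C (z + s *: e).
Proof.
move=> h.
have [s0|s0] := ltP 0 s; last first.
  have z0 : z = 0.
    apply/eqP; rewrite -enorm_eq0 eq_le enorm_ge0 andbT -(@ler_pM2l _ kap) ?kap_gt0// mulr0.
    exact: le_trans h s0.
  have -> : s = 0.
    by apply/eqP; rewrite eq_le s0/= (le_trans _ h)// mulr_ge0// ltW// kap_gt0.
  by rewrite z0 scale0r addr0; exact: C0.
have -> : z + s *: e = s *: (e + s^-1 *: z) by rewrite scalerDr scalerA divff ?gt_eqF// scale1r addrC.
apply: CZ (ltW s0); apply: C_ball; rewrite enormZ gtr0_norm ?invr_gt0// ler_pdivrMl//.
by rewrite -ler_pdivrMr ?er_gt0// mulrC.
Qed.

(** Test [u] against the point [e + (er / enorm u) *: u] of [C]. *)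
Lemma polar_e u : polar C u -> dotv e u <= - (er * enorm u).
Proof.
move=> Pu; have [->|u0] := eqVneq u 0; first by rewrite dotv0r enorm0 mulr0 oppr0.
have nu : 0 < enorm u by rewrite enorm_gt0.
have h : C (e + (er / enorm u) *: u).
  by apply: C_ball; rewrite enormZ gtr0_norm ?divr_gt0 ?er_gt0// divfK// gt_eqF.
have := Pu _ h; rewrite dotvDl dotvZl -enormE expr2 mulrA divfK ?gt_eqF//; lra.
Qed.

(** A quantitative form of [Omega C]: for [c > 0] these sets of unit vectors are compact, increase
    as [c] decreases, and exhaust [Omega C]. *)
Definition Om (c : R) : set 'rV[R]_n := [set u | enorm u = 1 /\ forall x, C x -> dotv x u <= - (c * enorm x)].

Lemma Om_Omega c u : 0 < c -> Om c u -> Omega C u.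
Proof.
move=> c0 [u1 H]; split=> //.
apply: filterS (enball_nbhs u c0) => v /= uv x Cx.
have -> : v = u + (v - u) by rewrite addrC subrK.
have h1 := H _ Cx; have h2 := dotv_le x (v - u).
have h3 : enorm x * enorm (v - u) <= c * enorm x.
  by rewrite mulrC ler_wpM2r// ltW// enormC.
rewrite dotvDr; lra.
Qed.

Lemma Omega_Om u : Omega C u -> exists2 c, 0 < c & Om c u.
Proof.
move=> [u1 /nbhs_enball[r r0 H]]; exists (r / 2); first by rewrite divr_gt0.
split=> // x Cx; have [->|x0] := eqVneq x 0; first by rewrite dotv0l enorm0 mulr0 oppr0.
have nx : 0 < enorm x by rewrite enorm_gt0.
have : polar C (u + (r / 2 / enorm x) *: x).
  apply: H; rewrite opprD addNKr enormN enormZ gtr0_norm ?divr_gt0// divfK ?gt_eqF//.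
  by rewrite ltr_pdivrMr// ltr_pMr// ltr1n.
move=> /(_ _ Cx); rewrite dotvDr dotvZr -enormE expr2 mulrA divfK ?gt_eqF//; lra.
Qed.

Lemma Om_anti c d u : c <= d -> Om d u -> Om c u.
Proof.
move=> cd [u1 H]; split=> // x Cx; rewrite (le_trans (H _ Cx))// lerN2.
by rewrite ler_wpM2r.
Qed.

Lemma Om_closed c : closed (Om c).
Proof.
rewrite (_ : Om c = (@usphere R n) `&` \bigcap_(x in C) [set u | dotv x u <= - (c * enorm x)]).
  apply: closedI; first exact: usphere_closed.
  apply: closed_bigI => x Cx; apply: closed_continuous_le; last exact: cst_continuous.
  exact: dotv_continuousr.
by apply/seteqP; split=> u [].
Qed.

Lemma Om_compact c : compact (Om c).
Proof. by apply: (@compact_enorm_le _ _ 1 _ (@Om_closed c)) => x [->]. Qed.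

Lemma Om_nbhs c d u : 0 < c -> d < c -> Om c u -> exists2 U, nbhs u U & U `&` (@usphere R n) `<=` Om d.
Proof.
move=> c0 dc [u1 H]; exists [set v | enorm (u - v) < c - d]; first by apply: enball_nbhs; rewrite subr_gt0.
move=> v [/= uv v1]; split=> // x Cx.
have -> : v = u + (v - u) by rewrite addrC subrK.
have h1 := H _ Cx; have h2 := dotv_le x (v - u).
have h3 : enorm x * enorm (v - u) <= (c - d) * enorm x.
  by rewrite mulrC ler_wpM2r// ltW// enormC.
rewrite dotvDr; lra.
Qed.

Lemma Omega_borel : measurable (Omega C : set (borelRV R n)).
Proof.
rewrite (_ : Omega C = \bigcup_k Om k.+1%:R^-1).
  by apply: bigcupT_measurable => k; apply: closed_borel; exact: Om_closed.
apply/seteqP; split=> [u /Omega_Om[c c0 Hc]|u [k _]]; last by apply: Om_Omega.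
exists (Num.truncn c^-1) => //; apply: Om_anti Hc.
by rewrite invf_ple ?posrE// ltW// truncnS_gt.
Qed.

Lemma Om_neq0 x c u : 0 < c -> Om c u -> C x -> x != 0 -> dotv x u < 0.
Proof.
move=> c0 [_ H] Cx x0; rewrite (le_lt_trans (H _ Cx))// oppr_lt0 mulr_gt0// enorm_gt0//.
Qed.

Definition tC (x : 'rV[R]_m) : R := inf [set s | C (gam x s)].

(** A point of [C] too low over [x], added to a point of [C] over [- x], would give a negative
    multiple of [e] in [C], against pointedness. *)
Lemma tC_inf x : has_inf [set s | C (gam x s)] /\ forall s, C (gam x s) -> - (kap * enorm x) <= s.
Proof.
have H s : C (gam x s) -> - (kap * enorm x) <= s.
  move=> Cs; rewrite leNgt; apply/negP => hs.
  have h1 : C (gam (- x) (kap * enorm x)).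
    by rewrite /gam; apply: C_kap; rewrite enorm_iota enormN.
  have := CD Cs h1; rewrite -gamD subrr gam_e => h2.
  have h3 : 0 < - (s + kap * enorm x) by lra.
  have := @CZ _ (- (s + kap * enorm x))^-1 h2; rewrite invr_ge0 (ltW h3) => /(_ isT).
  rewrite scalerA invrN mulNr mulVf ?lt_eqF//; last by rewrite -oppr_gt0.
  by rewrite scaleN1r => /(C_pointed Ce)/eqP; rewrite (negbTE e_neq0).
split=> //; split.
  by exists (kap * enorm x) => /=; rewrite /gam; apply: C_kap; rewrite enorm_iota.
by exists (- (kap * enorm x)) => s /H.
Qed.

Lemma C_gamD x s t : C (gam x s) -> s <= t -> C (gam x t).
Proof.
move=> Cs st; have -> : gam x t = gam x s + gam 0 (t - s) by rewrite -gamD addr0 addrC subrK.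
by apply: CD => //; rewrite gam_e; apply: CZ; [exact: Ce|rewrite subr_ge0].
Qed.

Lemma C_gamP x s : C (gam x s) <-> tC x <= s.
Proof.
have [[h1 h2] _] := tC_inf x.
split=> [Cs|ts]; first exact: ge_inf.
have cl : closed [set s | C (gam x s)].
  apply: preimage_closed wC_closed => t _.
  by apply: (@cvg_gam _ (nbhs t) _ (fun=> x) id); [exact: cvg_cst|exact: cvg_id].
apply: C_gamD ts; apply: cl => B /nbhs_ballP[r /= r0 HB].
have [s1 Cs1 s1t] := inf_adherent r0 (conj h1 h2).
exists s1; split=> //; apply: HB; rewrite /ball/= distrC ger0_norm ?subr_ge0 ?ltrBlDl//.
exact: ge_inf.
Qed.

(** In terms of the epigraph: it lies in [C], it is stable under adding [C], and it is convex.
    [tC W] itself is admissible; the origin is excluded later by [0 < t 0]. *)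
Definition adm (t : 'rV[R]_m -> R) : Prop :=
  [/\ forall x, tC x <= t x,
      forall x Z, C Z -> t (x + prj Z) <= t x + ht Z &
      forall x y (l : R), 0 <= l -> l <= 1 -> t ((1 - l) *: x + l *: y) <= (1 - l) * t x + l * t y].

Definition epi (t : 'rV[R]_m -> R) : set 'rV[R]_n := [set X | t (prj X) <= ht X].
Definition gr (t : 'rV[R]_m -> R) (x : 'rV[R]_m) : 'rV[R]_n := gam x (t x).

Lemma epi_gam t x s : epi t (gam x s) <-> t x <= s.
Proof. by rewrite /epi /= prj_gam ht_gam. Qed.

Lemma grE t x : gr t x = gam x (t x). Proof. by []. Qed.

Lemma epi_gr t x : epi t (gr t x).
Proof. exact/epi_gam. Qed.

Section Adm.
Variable t : 'rV[R]_m -> R.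
Hypothesis ta : adm t.

Lemma adm_C x s : t x <= s -> C (gam x s).
Proof. by case: ta => h _ _ ts; apply/C_gamP; apply: le_trans ts. Qed.

Lemma gr_C x : C (gr t x). Proof. exact: adm_C. Qed.

Lemma epi_sub : epi t `<=` C.
Proof. by move=> X; rewrite -(gamK X) => /epi_gam; exact: adm_C. Qed.

(** Go from [y] to [x] along a vector of the circular cone around [e], which lies in [C]. *)
Lemma adm_lip1 x y : t x <= t y + kap * enorm (x - y).
Proof.
have [_ h _] := ta.
have := h y (gam (x - y) (kap * enorm (x - y))).
rewrite prj_gam ht_gam [y + _]addrC subrK; apply.
by rewrite /gam; apply: C_kap; rewrite enorm_iota.
Qed.

Lemma adm_lip x y : `|t x - t y| <= kap * enorm (x - y).
Proof.
by rewrite ler_norml; have := adm_lip1 x y; have := adm_lip1 y x; rewrite (enormC y x); lra.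
Qed.

Lemma adm_continuous : continuous t.
Proof.
apply: (@lip_continuous _ _ _ _ (kap * m%:R)) => x y; rewrite (le_trans (adm_lip _ _))//.
by rewrite -mulrA ler_wpM2l ?(ltW kap_gt0)// enorm_le_norm.
Qed.

Lemma epiD X Z : epi t X -> C Z -> epi t (X + Z).
Proof.
have [_ h _] := ta; move=> eX CZ'; rewrite /epi/= prjD htD (le_trans (h _ _ CZ'))//.
by rewrite lerD2r.
Qed.

Lemma epi_closed : closed (epi t).
Proof.
apply: closed_continuous_le; last exact: ht_continuous.
by move=> X; apply: cvg_comp; [exact: prj_continuous|exact: adm_continuous].
Qed.

Lemma epi_convex : Defs.convex_set (epi t).
Proof.
have [_ _ h] := ta; move=> X Y l eX eY l0 l1.
rewrite /epi/= prjD htD !prjZ !htZ (le_trans (h _ _ _ l0 l1))//.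
by apply: lerD; apply: ler_wpM2l => //; rewrite subr_ge0.
Qed.

Lemma gr_expanding : exists2 c : R, 0 < c & forall x y, c * enorm (x - y) <= enorm (gr t x - gr t y).
Proof.
exists Kp^-1; first by rewrite invr_gt0 Kp_gt0.
move=> x y; rewrite ler_pdivrMl ?Kp_gt0//.
by have := prj_le (gr t x - gr t y); rewrite /gr -gamB prj_gam.
Qed.

Definition Kg : R := 1 + kap * enorm e.

Lemma Kg_gt0 : 0 < Kg. Proof. by rewrite ltr_pwDl// mulr_ge0// ltW// kap_gt0. Qed.

Lemma gr_lip x y : enorm (gr t x - gr t y) <= Kg * enorm (x - y).
Proof.
rewrite /gr -gamB (le_trans (gam_le _ _))// /Kg mulrDl mul1r lerD2l mulrAC ler_wpM2r//.
exact: adm_lip.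
Qed.

Lemma gr_continuous : continuous (gr t).
Proof.
by move=> x; apply: (@cvg_gam _ (nbhs x) _ id t); [exact: cvg_id|exact: adm_continuous].
Qed.

End Adm.

Lemma tC_adm : adm tC.
Proof.
split=> //.
  move=> x Z CZ'; apply/C_gamP; rewrite gamD gamK; apply: CD => //; exact/C_gamP.
move=> x y l l0 l1; apply/C_gamP; rewrite gamD !gamZ.
by apply: CD; apply: CZ; rewrite ?subr_ge0//; exact/C_gamP.
Qed.

Lemma tC0 : tC 0 = 0.
Proof.
apply/eqP; rewrite eq_le; apply/andP; split; first by apply/C_gamP; rewrite gam0; exact: C0.
rewrite leNgt; apply/negP => h.
have : C (gam 0 (tC 0)) by apply/C_gamP.
rewrite gam_e => h1; have := @CZ _ (- (tC 0)^-1) h1; rewrite oppr_ge0 invr_le0 (ltW h) => /(_ isT).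
rewrite scalerA mulNr mulVf ?lt_eqF// scaleN1r => /(C_pointed Ce)/eqP.
by rewrite (negbTE e_neq0).
Qed.

(** Add the boundary point of [C] over [x] to the graph point over 0. Hence the gap between the
    boundary of [C] and the graph has height at most [t 0] everywhere, which serves compactness and
    the volume bound. *)
Lemma adm_le_tC t x : adm t -> t x <= tC x + t 0.
Proof.
move=> [_ h _]; have := h 0 (gam x (tC x)); rewrite prj_gam ht_gam add0r addrC; apply.
exact/C_gamP.
Qed.

Lemma adm_ge0 t : adm t -> 0 <= t 0.
Proof. by move=> [h _ _]; rewrite -tC0. Qed.

End Frame.

(** * Null sets and normals *)

Section NullSets.
Context (R : realType) (p : nat).
Local Notation m := p.+1.
Local Notation lam := (lam R p).
Local Open Scope ereal_scope.
Implicit Types N : set (borelRV R m).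

Lemma lam_bigcup0 (A : nat -> set 'rV[R]_m) : (forall k, lam (A k) = 0) -> lam (\bigcup_k A k) = 0.
Proof.
move=> A0; apply/eqP; rewrite eq_le; apply/andP; split; last by rewrite lamE hausdorff_ge0.
rewrite lamE; apply: le_trans (outer_measure_sigma_subadditive _ _) _.
by rewrite eseries0// => k _ _; have := A0 k; rewrite lamE.
Qed.

(** The affine form covers translates and dilates at once; since [r k >= 1], no copy is smaller than
    [N], and infinitely many disjoint ones fit into [B]. *)
Lemma null_disjoint_copies N (B : set (borelRV R m)) (v : nat -> 'rV[R]_m) (r : nat -> R) :
  measurable N -> measurable B -> lam B < +oo -> (forall k, (1 <= r k)%R) ->
  (forall k x, N x -> B (v k + r k *: x)%R) ->
  (forall k l x y, N x -> N y -> (v k + r k *: x = v l + r l *: y)%R -> k = l) -> lam N = 0.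
Proof.
move=> mN mB Bfin r1 NB inj.
have r0 k : (0 < r k)%R by apply: lt_le_trans (r1 k).
pose F k : set (borelRV R m) := (fun x => v k + r k *: x)%R @` N.
have FE k : F k = (fun x => (r k)^-1 *: (x - v k))%R @^-1` N.
  apply/seteqP; split=> [_ [x Nx <-]|x Nx] /=.
    by rewrite [(v k + _)%R]addrC addrK scalerA mulVf ?scale1r// gt_eqF.
  by exists ((r k)^-1 *: (x - v k))%R => //; rewrite scalerA divff ?gt_eqF// scale1r addrC subrK.
have mF k : measurable (F k).
  rewrite FE; apply: continuous_preimage_borel => //.
  apply: (@lip_continuous _ _ _ _ `|(r k)^-1|%R) => x y.
  by rewrite -scalerBr normrZ opprB addrA subrK.
have Fge k : lam N <= lam (F k).
  by rewrite lam_affine// -[X in X <= _]mul1e lee_wpmul2r ?measure_ge0// lee_fin exprn_ege1.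
have tF : trivIset setT F.
  apply/trivIsetP => i j _ _ ij; apply/seteqP; split=> // x [[y Ny <-] [z Nz zE]].
  by have ji := inj _ _ _ _ Nz Ny zE; move: ij; rewrite ji eqxx.
have UB : \bigcup_k F k `<=` B by move=> _ [k _ [x Nx <-]]; apply: NB.
have mU : measurable (\bigcup_k F k) by apply: bigcupT_measurable.
have HK K : \sum_(0 <= k < K) lam N <= lam B.
  apply: (@le_trans _ _ (\sum_(0 <= k < K) lam (F k))); first by apply: lee_sum => k _.
  apply: (@le_trans _ _ (\sum_(0 <= k <oo) lam (F k))); first exact: nneseries_lim_ge.
  apply: (@le_trans _ _ (lam (\bigcup_k F k))); last by apply: le_measure; rewrite ?inE.
  rewrite measure_bigcup// le_eqVlt; apply/orP; left; apply/eqP; apply: eq_eseriesl => i.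
  exact/esym/mem_set.
have fB : lam B \is a fin_num by rewrite ge0_fin_numE// measure_ge0.
have fN : lam N \is a fin_num.
  rewrite ge0_fin_numE ?measure_ge0//; apply: le_lt_trans Bfin.
  by have := HK 1%N; rewrite big_nat1.
apply/eqP; rewrite eq_le measure_ge0 andbT; apply/negPn/negP; rewrite -ltNge => N0.
move: HK; rewrite -(fineK fN) -(fineK fB) => HK.
have c0 : (0 < fine (lam N))%R by rewrite -lte_fin fineK.
have := HK (Num.truncn (fine (lam B) / fine (lam N))).+1.
rewrite sumEFin lee_fin sumr_const_nat subn0 leNgt -mulr_natl -ltr_pdivrMr//.
by rewrite truncnS_gt.
Qed.

Lemma null_lines N (j : 'I_m) : measurable N ->
  (forall x h, N x -> N (x + h *: delta_mx ord0 j)%R -> h = 0%R) -> lam N = 0.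
Proof.
move=> mN HN.
pose Q K := cube (\row__ (- K.+1%:R)%R : 'rV[R]_m) (2 * K.+1%:R)%R.
have -> : N = \bigcup_K (N `&` Q K).
  apply/seteqP; split=> [x Nx|x [K _ []]//]; exists (Num.truncn `|x|) => //; split=> // i.
  have : (`|x ord0 i| < (Num.truncn `|x|).+1%:R)%R by apply: le_lt_trans (coord_le_norm _ _) (truncnS_gt _).
  by rewrite !mxE ltr_norml; lra.
apply: lam_bigcup0 => K.
(* The offsets [1/(k+2)] are distinct and below 1, so the translates stay in the cube enlarged by
   1. *)
apply: (@null_disjoint_copies _ (cube (\row__ (- K.+1%:R)%R) (2 * K.+1%:R + 1)%R)
    (fun k => (k.+2%:R^-1 *: delta_mx ord0 j)%R) (fun=> 1%R)) => //.
- by apply: measurableI => //; apply: cube_borel.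
- exact: cube_borel.
- have h : (0 < 2 * K.+1%:R + 1 :> R)%R by rewrite addr_gt0// mulr_gt0.
  by rewrite lam_cube// -(fineK (lam_unit_fin R p)) -EFinM ltry.
- move=> k x [_ Qx] i; have := Qx i; rewrite !mxE mul1r => /andP[h1 h2].
  have d0 : (0 <= k.+2%:R^-1 * (i == j)%:R :> R)%R by rewrite mulr_ge0.
  have d1 : (k.+2%:R^-1 * (i == j)%:R < 1 :> R)%R.
    by case: eqP => _; rewrite ?mulr0 ?mulr1// invf_lt1// ltr1n.
  rewrite eqxx andTb; move: (k.+2%:R^-1 * (i == j)%:R)%R d0 d1 (x ord0 i) h1 h2 => a d0 d1 y h1 h2.
  apply/andP; split; lra.
move=> k l x y [Nx _] [Ny _]; rewrite !scale1r => E.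
have : (k.+2%:R^-1 - l.+2%:R^-1 = 0 :> R)%R.
  apply: (HN x) => //; rewrite scalerBl addrA [(x + _)%R]addrC E.
  by rewrite [(_ + y)%R]addrC addrK.
by move/subr0_eq/invr_inj/eqP; rewrite eqr_nat => /eqP[].
Qed.

Lemma null_rays N : measurable N -> ~ N 0%R ->
  (forall x (c : R), N x -> (0 < c)%R -> N (c *: x)%R -> c = 1%R) -> lam N = 0.
Proof.
move=> mN N0 HN.
pose Q K := cube (\row__ (- K.+1%:R)%R : 'rV[R]_m) (2 * K.+1%:R)%R.
have -> : N = \bigcup_K (N `&` Q K).
  apply/seteqP; split=> [x Nx|x [K _ []]//]; exists (Num.truncn `|x|) => //; split=> // i.
  have : (`|x ord0 i| < (Num.truncn `|x|).+1%:R)%R by apply: le_lt_trans (coord_le_norm _ _) (truncnS_gt _).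
  by rewrite !mxE ltr_norml; lra.
apply: lam_bigcup0 => K.
(* The factors [1 + 1/(k+2)] are distinct and at most 3/2, so the dilates stay in the cube of twice
   the size. *)
apply: (@null_disjoint_copies _ (cube (\row__ (- (2 * K.+1%:R))%R) (4 * K.+1%:R)%R)
    (fun k => 0%R) (fun k => (1 + k.+2%:R^-1)%R)) => //.
- by apply: measurableI => //; apply: cube_borel.
- exact: cube_borel.
- have h : (0 < 4 * K.+1%:R :> R)%R by rewrite mulr_gt0.
  by rewrite lam_cube// -(fineK (lam_unit_fin R p)) -EFinM ltry.
- by move=> k; rewrite lerDl invr_ge0.
- move=> k x [_ Qx] i; have := Qx i; rewrite !mxE add0r => /andP[h1 h2].
  have h : (`|x ord0 i| <= K.+1%:R)%R by rewrite ler_norml; apply/andP; split; lra.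
  have d1 : (k.+2%:R^-1 <= 2^-1 :> R)%R by rewrite lef_pV2 ?posrE// ler_nat.
  have d0 : (0 < k.+2%:R^-1 :> R)%R by rewrite invr_gt0.
  have : (`|(1 + k.+2%:R^-1) * x ord0 i| <= (3 / 2) * K.+1%:R)%R.
    move: (k.+2%:R^-1)%R d0 d1 => a d0 d1.
    by rewrite normrM; apply: ler_pM => //; rewrite ger0_norm; lra.
  have K1 : (0 < K.+1%:R :> R)%R by [].
  move: ((1 + k.+2%:R^-1) * x ord0 i)%R => y; rewrite ler_norml => /andP[h3 h4].
  apply/andP; split; lra.
move=> k l x y [Nx _] [Ny _]; rewrite !add0r => E.
have k0 : (0 < 1 + k.+2%:R^-1 :> R)%R by rewrite ltr_wpDr.
have l0 : (0 < 1 + l.+2%:R^-1 :> R)%R by rewrite ltr_wpDr.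
have : ((1 + k.+2%:R^-1) / (1 + l.+2%:R^-1) = 1 :> R)%R.
  apply: (HN x _ Nx); first by rewrite divr_gt0.
  by rewrite mulrC -scalerA E scalerA mulVf ?scale1r// gt_eqF.
move/(congr1 (fun z => z * (1 + l.+2%:R^-1))%R); rewrite mul1r divfK ?gt_eqF//.
by move/addrI/invr_inj/eqP; rewrite eqr_nat => /eqP[].
Qed.

End NullSets.

(** * Normals of graphs: closedness, uniqueness almost everywhere, measurability *)

Section Normals.
Context (R : realType) (p : nat) (W : wcone R p).
Local Notation m := p.+1.
Local Notation n := p.+2.
Local Notation C := (wC W).
Local Notation e := (we W).
Local Notation adm := (adm W).
Local Notation epi := (epi W).
Local Notation gr := (gr W).
Local Notation gam := (gam W).

Definition nrm (t : 'rV[R]_m -> R) x u := outer_normal (epi t) (gr t x) u.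

Definition pol1 : set 'rV[R]_n := (@usphere R n) `&` polar C.

Lemma pol1_e u : pol1 u -> dotv e u <= - er W.
Proof. by move=> [u1 /polar_e]; rewrite u1 mulr1. Qed.

Lemma pol1_e0 u : pol1 u -> dotv e u < 0.
Proof. by move=> /pol1_e/le_lt_trans; apply; rewrite oppr_lt0 er_gt0. Qed.

Lemma polar_closed : closed (polar C).
Proof.
rewrite (_ : polar C = \bigcap_(x in C) [set u | dotv x u <= 0]); last by apply/seteqP; split.
apply: closed_bigI => x Cx; apply: closed_continuous_le; last exact: cst_continuous.
exact: dotv_continuousr.
Qed.

Lemma pol1_closed : closed pol1.
Proof. apply: closedI; [exact: usphere_closed|exact: polar_closed]. Qed.

Lemma Omega_pol1 u : Omega C u -> pol1 u.
Proof. by move=> [u1 /interior_subset]. Qed.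

Section One.
Variable t : 'rV[R]_m -> R.
Hypothesis ta : adm t.

Lemma nrm_pol1 x u : nrm t x u -> pol1 u.
Proof.
move=> [u1 H]; split=> // Z CZ.
by have := H _ (epiD ta (epi_gr W t x) CZ); rewrite addrC addKr.
Qed.

(** Points of the epigraph off the graph differ from graph points by positive multiples of [e], and
    [dotv e u < 0]. *)
Lemma nrmP x u : pol1 u -> (forall y, dotv (gr t y - gr t x) u <= 0) -> nrm t x u.
Proof.
move=> Pu H; have := pol1_e0 Pu; case: Pu => u1 _ eu; split=> // Y.
rewrite -(gamK W Y) => /epi_gam ty.
have -> : gam (prj W Y) (ht W Y) - gr t x = (gr t (prj W Y) - gr t x) + (ht W Y - t (prj W Y)) *: e.
  suff -> : gam (prj W Y) (ht W Y) = gr t (prj W Y) + (ht W Y - t (prj W Y)) *: e by rewrite addrAC.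
  by rewrite !grE !gamE -addrA -scalerDl [t _ + _]addrC subrK.
rewrite dotvDl dotvZl; have := H (prj W Y).
have : (ht W Y - t (prj W Y)) * dotv e u <= 0 by rewrite nmulr_lle0// subr_ge0.
by move=> *; lra.
Qed.

Lemma nrm_gr x y u : nrm t x u -> dotv (gr t y - gr t x) u <= 0.
Proof. by move=> [_ H]; apply: H; exact: epi_gr. Qed.

End One.

(** If [u] is not normal at the limit point, some graph point [y] violates the inequality strictly,
    and this persists for directions near [u] and far along the filter; compactness of [F] makes it
    uniform. The filter is arbitrary so as to cover both a moving point on a fixed graph and a fixed
    point on moving graphs. *)
Lemma normal_limit (I : Type) (Phi : set_system I) (FF : Filter Phi)
    (tau : I -> 'rV[R]_m -> R) (z : I -> 'rV[R]_m) t x (F : set 'rV[R]_n) :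
  adm t -> compact F -> F `<=` pol1 -> (forall y, tau i y @[i --> Phi] --> t y) ->
  z i @[i --> Phi] --> x -> tau i (z i) @[i --> Phi] --> t x ->
  (forall u, F u -> ~ nrm t x u) -> \forall i \near Phi, forall u, F u -> ~ nrm (tau i) (z i) u.
Proof.
move=> ta cF FP ct cz ctz H.
have /compact_near_coveringP/(_ _ Phi (fun i u => ~ nrm (tau i) (z i) u) FF) := cF; apply => u Fu.
have [y Hy] : exists y, 0 < dotv (gr t y - gr t x) u.
  apply: contrapT => Hn; apply: (H _ Fu); apply: nrmP; first exact: FP.
  by move=> y; rewrite leNgt; apply/negP => hy; apply: Hn; exists y.
set A := gr t y - gr t x in Hy; set d := dotv A u in Hy.
have cA : (gr (tau i) y - gr (tau i) (z i)) @[i --> Phi] --> A.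
  by apply: cvgB; apply: cvg_gam => //; exact: cvg_cst.
(* Nearby directions have norm at most [enorm u + 1], so this error in the chord changes the product
   by at most [d / 2]. *)
have d2 : 0 < d / 2 / (enorm u + 1) by rewrite !divr_gt0// ltr_wpDl.
exists ([set v | d / 2 < dotv A v] `&` [set v | enorm (u - v) < 1],
        [set i | enorm (A - (gr (tau i) y - gr (tau i) (z i))) < d / 2 / (enorm u + 1)]).
  split; last by have := cA _ (enball_nbhs A d2).
  apply: filterI; last exact: enball_nbhs.
  apply: open_nbhs_nbhs; split; last by rewrite /= -/d ltr_pdivrMr// ltr_pMr// ltr1n.
  by apply: open_continuous_lt; [exact: cst_continuous|exact: dotv_continuousr].
move=> [v i] [/= [Av uv] Ai] /nrm_gr => /(_ y); set B := gr _ y - gr _ _ in Ai *.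
have -> : B = A - (A - B) by rewrite opprB addrC subrK.
rewrite dotvBl subr_le0 => h.
have h1 : dotv (A - B) v <= d / 2 / (enorm u + 1) * (enorm u + 1).
  apply: (le_trans (dotv_le _ _)); apply: ler_pM => //; first exact: ltW.
  have -> : v = u - (u - v) by rewrite opprB addrC subrK.
  by rewrite (le_trans (enormD _ _))// enormN lerD2l ltW.
by move: h1; rewrite divfK ?gt_eqF ?ltr_wpDl// => h1; have := le_trans h h1; rewrite leNgt Av.
Qed.

Section Regular.
Variable t : 'rV[R]_m -> R.
Hypothesis ta : adm t.

Definition has_nrm (F : set 'rV[R]_n) : set 'rV[R]_m := [set x | exists2 u, F u & nrm t x u].

Lemma has_nrm_closed F : closed F -> closed (has_nrm F).
Proof.
move=> cF; rewrite (_ : has_nrm F = has_nrm (F `&` pol1)); last first.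
  apply/seteqP; split=> x [u Fu xu]; last by exists u => //; case: Fu.
  by exists u => //; split=> //; exact: nrm_pol1 xu.
have cK : compact (F `&` pol1).
  apply: (@compact_enorm_le _ _ 1); first by apply: closedI => //; exact: pol1_closed.
  by move=> u [_ [->]].
rewrite -openC openE => x nx.
have ct : t i @[i --> nbhs x] --> t x by exact: adm_continuous ta x.
have H := @normal_limit _ (nbhs x) (nbhs_filter x) (fun=> t) id t x (F `&` pol1) ta cK
  (fun u h => proj2 h) (fun y => cvg_cst _) cvg_id ct.
have := H (nbhs_filter x) (fun u Fu xu => nx (ex_intro2 _ _ u Fu xu)).
by apply: filterS => z Hz [u Fu zu]; apply: (Hz u).
Qed.

(** The j-th partial derivative of the affine function whose graph is orthogonal to [u]; for a
    normal [u] it is the coordinate of a subgradient. *)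
Definition slope (j : 'I_m) (u : 'rV[R]_n) : R := u ord0 (lift ord0 j) / - dotv e u.

Lemma slope_inj u v : pol1 u -> pol1 v -> (forall j, slope j u = slope j v) -> u = v.
Proof.
move=> Pu Pv H.
have a0 : 0 < - dotv e u by rewrite oppr_gt0 pol1_e0.
have b0 : 0 < - dotv e v by rewrite oppr_gt0 pol1_e0.
pose c := - dotv e u / - dotv e v.
have c0 : 0 < c by rewrite divr_gt0.
have uj j : u ord0 (lift ord0 j) = c * v ord0 (lift ord0 j).
  have := H j; rewrite /slope => /(congr1 (fun z => z * - dotv e u)).
  by rewrite divfK ?gt_eqF// => ->; rewrite /c; ring.
have u0 : u ord0 ord0 = c * v ord0 ord0.
  have : dotv e u = c * dotv e v by rewrite /c invrN mulrNN divfK// lt_eqF// pol1_e0.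
  rewrite /dotv [X in X = _]big_ord_recl [X in _ = _ * X]big_ord_recl mulrDr mulr_sumr.
  rewrite (eq_bigr (fun i => c * (e ord0 (lift ord0 i) * v ord0 (lift ord0 i)))); last first.
    by move=> i _; rewrite uj; ring.
  by move/addIr; rewrite mulrCA => /mulfI; apply; exact: we0.
have uv : u = c *: v.
  by apply/rowP => i; rewrite mxE; case: (unliftP ord0 i) => [j ->|->].
have := Pu.1; rewrite /usphere/= uv enormZ Pv.1 mulr1 gtr0_norm// => ->.
by rewrite scale1r.
Qed.

Lemma nrm_slope x h j u : nrm t x u -> t x + h * slope j u <= t (x + h *: delta_mx ord0 j).
Proof.
move=> xu; have Pu := nrm_pol1 ta xu.
have a0 : 0 < - dotv e u by rewrite oppr_gt0 pol1_e0.
have := nrm_gr (x + h *: delta_mx ord0 j) xu.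
rewrite /gr -gamB [x + _ - x](_ : _ = h *: delta_mx ord0 j) ?[x + _]addrC ?addrK// /gam dotvDl dotvZl.
have -> : dotv (iota_ (h *: delta_mx ord0 j)) u = h * u ord0 (lift ord0 j).
  rewrite /dotv big_ord_recl !mxE unlift_none mul0r add0r (bigD1 j)//= big1 => [|i ij].
    by rewrite !mxE liftK !mxE !eqxx/= addr0 mulr1.
  by rewrite !mxE liftK !mxE (negbTE ij) andbF mulr0 mul0r.
rewrite [_ + x]addrC => H.
by rewrite -lerBrDl -(@ler_pM2r _ (- dotv e u))// /slope mulrA divfK ?gt_eqF//; lra.
Qed.

Definition Lo j (r : R) : set 'rV[R]_n := pol1 `&` [set u : 'rV[R]_n | u ord0 (lift ord0 j) <= r * - dotv e u].
Definition Hi j (r : R) : set 'rV[R]_n := pol1 `&` [set u : 'rV[R]_n | r * - dotv e u <= u ord0 (lift ord0 j)].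

Lemma rNdot_continuous (r : R) : continuous (fun u => r * - dotv e u).
Proof.
apply: (@lip_continuous _ _ _ _ (`|r| * (enorm e * n%:R))) => u v.
rewrite -mulrBr normrM -!mulrA ler_wpM2l// -opprB opprK addrC -dotvBr.
by rewrite normrN (le_trans (norm_dotv_le _ _))// ler_wpM2l// enorm_le_norm.
Qed.

Lemma Lo_closed j r : closed (Lo j r).
Proof.
apply: closedI; first exact: pol1_closed.
by apply: closed_continuous_le; [exact: coord_continuous|exact: rNdot_continuous].
Qed.

Lemma Hi_closed j r : closed (Hi j r).
Proof.
apply: closedI; first exact: pol1_closed.
by apply: closed_continuous_le; [exact: rNdot_continuous|exact: coord_continuous].
Qed.

Lemma LoE j r u : Lo j r u <-> pol1 u /\ slope j u <= r.
Proof.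
by split=> -[Pu h]; split=> //; move: h; rewrite /slope /= ler_pdivrMr// oppr_gt0 pol1_e0.
Qed.

Lemma HiE j r u : Hi j r u <-> pol1 u /\ r <= slope j u.
Proof.
by split=> -[Pu h]; split=> //; move: h; rewrite /slope /= ler_pdivlMr// oppr_gt0 pol1_e0.
Qed.

Definition Mult : set 'rV[R]_m := [set x | exists u v, [/\ nrm t x u, nrm t x v & u <> v]].

(** Two distinct normals differ in some slope, and two rationals fit between the values; this splits
    [Mult] into countably many Borel pieces. *)
Definition mult_piece (z : 'I_m * (rat * rat)) : set 'rV[R]_m :=
  if z.2.1 < z.2.2 then has_nrm (Lo z.1 (ratr z.2.1)) `&` has_nrm (Hi z.1 (ratr z.2.2)) else set0.

Lemma MultE : Mult = \bigcup_z mult_piece z.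
Proof.
apply/seteqP; split=> x; last first.
  move=> [[j [r s]] _]; rewrite /mult_piece /=; case: ifP => // rs [[u /LoE[_ ur] xu] [v /HiE[_ sv] xv]].
  exists u, v; split=> // uv; move: sv; rewrite -uv => su.
  by have := le_trans su ur; rewrite leNgt ltr_rat rs.
have key u v j : nrm t x u -> nrm t x v -> slope j u < slope j v -> (\bigcup_z mult_piece z) x.
  move=> xu xv uv.
  have [r] := rat_in_itvoo uv; rewrite in_itv/= => /andP[ur rv].
  have [s] := rat_in_itvoo rv; rewrite in_itv/= => /andP[rs sv].
  exists (j, (r, s)) => //; rewrite /mult_piece /= -(ltr_rat R) rs; split.
    by exists u => //; apply/LoE; split; [exact: nrm_pol1 xu|exact: ltW].
  by exists v => //; apply/HiE; split; [exact: nrm_pol1 xv|exact: ltW].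
move=> [u [v [xu xv uv]]].
have [j Hj] : exists j, slope j u != slope j v.
  apply: contrapT => H; apply: uv; apply: slope_inj; [exact: nrm_pol1 xu|exact: nrm_pol1 xv|].
  by move=> j; apply/eqP; apply: contrapT => /negP Hj; apply: H; exists j.
have [h|h] := ltP (slope j u) (slope j v); first exact: (key u v j).
by apply: (key v u j) => //; rewrite lt_neqAle h andbT eq_sym.
Qed.

Lemma mult_piece_borel z : measurable (mult_piece z : set (borelRV R m)).
Proof.
rewrite /mult_piece; case: ifP => // _; apply: measurableI; apply: closed_borel; apply: has_nrm_closed.
  exact: Lo_closed.
exact: Hi_closed.
Qed.

(** Subgradients are monotone along a line in direction [j]: of two points of the piece, the left
    one has a normal of slope at least [s] and the right one a normal of slope at most [r < s],
    which is impossible. *)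
Lemma mult_piece_null z : lam R p (mult_piece z) = 0%E.
Proof.
case: z => j [r s]; have := mult_piece_borel (j, (r, s)); rewrite /mult_piece /=.
case: ifP => [rs mN|_ _]; last by rewrite measure0.
apply: (null_lines (j := j)) => // x h [[u /LoE[_ ur] xu] [v /HiE[_ sv] xv]].
move=> [[u' /LoE[_ ur'] xu'] [v' /HiE[_ sv'] xv']].
have rsR : ratr r < ratr s :> R by rewrite ltr_rat.
have E : x + h *: delta_mx ord0 j + - h *: delta_mx ord0 j = x by rewrite scaleNr addrK.
have [h0|h0|//] := ltgtP h 0.
  have h1 := nrm_slope h j xu.
  have := nrm_slope (- h) j xv'; rewrite E => h2.
  have h3 : h * ratr r <= h * slope j u by rewrite ler_nM2l.
  have h4 : - h * ratr s <= - h * slope j v' by rewrite ler_pM2l// oppr_gt0.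
  have : 0 < - h * (ratr s - ratr r) by rewrite mulr_gt0 ?oppr_gt0 ?subr_gt0.
  move=> h5; suff : - h * (ratr s - ratr r) <= 0 by rewrite leNgt h5.
  lra.
have h1 := nrm_slope h j xv.
have := nrm_slope (- h) j xu'; rewrite E => h2.
have h3 : h * ratr s <= h * slope j v by rewrite ler_pM2l.
have h4 : h * slope j u' <= h * ratr r by rewrite ler_pM2l.
have : 0 < h * (ratr s - ratr r) by rewrite mulr_gt0 ?subr_gt0.
move=> h5; suff : h * (ratr s - ratr r) <= 0 by rewrite leNgt h5.
lra.
Qed.

Lemma Mult_borel : measurable (Mult : set (borelRV R m)).
Proof.
rewrite MultE; apply: (@countable_bigcupT_measurable _ (borelRV R m)) => [|z]; first exact: countableP.
exact: mult_piece_borel.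
Qed.

Lemma Mult_null : lam R p Mult = 0%E.
Proof.
rewrite MultE (_ : \bigcup_z _ = \bigcup_k (if unpickle k is Some z then mult_piece z else set0)).
  by apply: lam_bigcup0 => k; case: unpickle => [z|]; [exact: mult_piece_null|rewrite measure0].
apply/seteqP; split=> [x [z _ xz]|x [k _]]; first by exists (pickle z) => //; rewrite pickleK.
by case: unpickle => // z xz; exists z.
Qed.

Definition reg (eta : set 'rV[R]_n) : set 'rV[R]_m :=
  [set x | exists u, [/\ eta u, nrm t x u & forall v, nrm t x v -> v = u]].

Lemma reg_sub eta eta' : eta `<=` eta' -> reg eta `<=` reg eta'.
Proof. by move=> H x [u [/H *]]; exists u. Qed.

Lemma regE eta : reg eta = has_nrm eta `\` Mult.
Proof.
apply/seteqP; split=> x.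
  move=> [u [eu xu uniq]]; split; first by exists u.
  by move=> [v [w [/uniq -> /uniq ->]]].
move=> [[u eu xu] nM]; exists u; split=> // v xv.
by apply: contrapT => vu; apply: nM; exists v, u.
Qed.

(** Closed sets are handled by [has_nrm_closed] and [Mult_borel]. Uniqueness of the normal makes
    [reg] commute with countable unions and, within [reg setT], with complements, so the good sets
    form a sigma-algebra. *)
Lemma reg_borel (eta : set (borelRV R n)) : measurable eta -> measurable (reg eta : set (borelRV R m)).
Proof.
have key F : closed F -> measurable (reg F : set (borelRV R m)).
  move=> cF; rewrite regE; apply: measurableD; last exact: Mult_borel.
  by apply: closed_borel; apply: has_nrm_closed.
move: eta; apply: (@smallest_sub _ (sigma_algebra setT) (@open 'rV[R]_n) [set F : set (borelRV R n) | measurable (reg F : set (borelRV R m))]).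
  split=> /=.
  - by apply: key; exact: closed0.
  - move=> A mA; rewrite setTD (_ : reg (~` A) = reg setT `\` reg A).
      by apply: measurableD => //; apply: key; exact: closedT.
    apply/seteqP; split=> x.
      move=> [u [nA xu uniq]]; split; first by exists u.
      by move=> [v [Av xv _]]; apply: nA; rewrite -(uniq _ xv).
    move=> [[u [_ xu uniq]] nx]; exists u; split=> // Au; apply: nx; exists u; by split.
  - move=> F mF; rewrite (_ : reg (\bigcup_k F k) = \bigcup_k reg (F k)).
      by apply: bigcupT_measurable.
    apply/seteqP; split=> x.
      by move=> [u [[k _ Fu] xu uniq]]; exists k => //; exists u.
    by move=> [k _ [u [Fu xu uniq]]]; exists u; split=> //; exists k.
move=> A oA; rewrite /= -(setCK A) (_ : reg (~` ~` A) = reg setT `\` reg (~` A)).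
  by apply: measurableD; apply: key; [exact: closedT|rewrite closedC].
apply/seteqP; split=> x.
  move=> [u [nA xu uniq]]; split; first by exists u.
  by move=> [v [Av xv _]]; apply: nA; rewrite -(uniq _ xv).
move=> [[u [_ xu uniq]] nx]; exists u; split=> // Au; apply: nx; exists u; by split.
Qed.

End Regular.
End Normals.

(** * Projected area *)

Section Functionals.
Context (R : realType) (p : nat) (W : wcone R p).
Local Notation m := p.+1.
Local Notation n := p.+2.
Local Notation C := (wC W).
Local Notation e := (we W).
Local Notation q := (wq W).
Local Notation Theta := (wT W).
Local Notation lam := (lam R p).

(** Extreme values on the compact set of unit vectors of [C], transported by homogeneity. *)
Lemma Theta_bounds : exists c d : R, [/\ 0 < c, 0 < d & forall x, C x -> x != 0 ->
  c * enorm x `^ (- q) <= Theta x /\ Theta x <= d * enorm x `^ (- q)].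
Proof.
pose K : set 'rV[R]_n := C `&` @usphere R n.
have KC : K `<=` C `\ 0.
  by move=> x [Cx x1]; split=> //= x0; move: x1; rewrite /usphere/= x0 enorm0 => /eqP; rewrite eq_sym oner_eq0.
have cK : compact K.
  apply: (@compact_enorm_le _ _ 1); last by move=> x [_ ->].
  by apply: closedI; [exact: wC_closed|exact: usphere_closed].
have en0 : 0 < enorm e by rewrite enorm_gt0 e_neq0.
have K0 : K !=set0.
  exists ((enorm e)^-1 *: e); split; first by apply: CZ; [exact: Ce|rewrite invr_ge0].
  by rewrite /usphere/= enormZ gtr0_norm ?invr_gt0// mulVf// gt_eqF.
have KT : {within K, continuous Theta} by apply: continuous_subspaceW KC _; exact: wT_cont.
have [x1 Kx1 H1] := EVT_min_rV K0 cK KT.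
have [x2 Kx2 H2] := EVT_max_rV K0 cK KT.
have T0 x : x \in K -> 0 < Theta x.
  by rewrite inE => Kx; apply: wT_pos; [case: Kx|apply/eqP; have [] := KC _ Kx].
exists (Theta x1), (Theta x2); split; [exact: T0|exact: T0|] => x Cx x0.
have nx : 0 < enorm x by rewrite enorm_gt0.
have Kx : (enorm x)^-1 *: x \in K.
  rewrite inE; split; first by apply: CZ => //; rewrite invr_ge0.
  by rewrite /usphere/= enormZ gtr0_norm ?invr_gt0// mulVf// gt_eqF.
have xE : Theta x = enorm x `^ (- q) * Theta ((enorm x)^-1 *: x).
  rewrite -wT_hom//; first by rewrite scalerA divff ?gt_eqF// scale1r.
  - by apply: CZ => //; rewrite invr_ge0.
  - by rewrite scaler_eq0 invr_eq0 gt_eqF.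
rewrite xE; split; [rewrite mulrC|rewrite [X in _ <= X]mulrC]; apply: ler_wpM2l; rewrite ?powR_ge0//.
  exact: H1.
exact: H2.
Qed.

Lemma Theta_cvg (I : Type) (F : set_system I) (FF : Filter F) (X : I -> 'rV[R]_n) X0 :
  X i @[i --> F] --> X0 -> (forall i, C (X i)) -> (\forall i \near F, X i != 0) -> C X0 -> X0 != 0 ->
  Theta (X i) @[i --> F] --> Theta X0.
Proof.
move=> XX CX X1 CX0 X00.
have /subspace_continuousP/(_ X0) := @wT_cont _ _ W.
have AX0 : (C `\ 0) X0 by split=> //; exact/eqP.
move=> /(_ AX0); apply: cvg_comp => A HA.
have h1 := XX _ HA; move: h1 X1; rewrite !near_simpl => h1 X1.
apply: filterS2 h1 X1 => i h Xi; apply: h; split=> //; exact/eqP.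
Qed.

Definition good t := adm W t /\ 0 < t 0.

Definition K1 : R := Kp W * (1 + kap W).
Lemma K1_gt0 : 0 < K1.
Proof. by rewrite mulr_gt0 ?Kp_gt0// addr_gt0// kap_gt0. Qed.

(** This keeps the graph at distance at least [t 0 / K1] from the origin, where [Theta] may blow
    up. *)
Lemma epi_far t X : adm W t -> epi W t X -> t 0 <= K1 * enorm X.
Proof.
move=> ta eX; have h1 := adm_lip1 ta 0 (prj W X); rewrite sub0r enormN in h1.
have h2 : t (prj W X) <= ht W X := eX.
have h3 := le_trans (ler_norm _) (ht_le W X).
have h4 := prj_le W X.
have h5 : kap W * enorm (prj W X) <= kap W * (Kp W * enorm X) by rewrite ler_wpM2l// ltW// kap_gt0.
by rewrite /K1; lra.
Qed.

Lemma epi_neq0 t X : good t -> epi W t X -> X != 0.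
Proof.
move=> [ta t0] eX; rewrite -enorm_gt0 -(@pmulr_rgt0 _ K1) ?K1_gt0//.
exact: lt_le_trans t0 (epi_far ta eX).
Qed.

Definition Th (t : 'rV[R]_m -> R) x : R := Theta (gr W t x).

Lemma gr_neq0 t x : good t -> gr W t x != 0.
Proof. by move=> gt; apply: epi_neq0 gt (epi_gr W t x). Qed.

Lemma Th_gt0 t x : good t -> 0 < Th t x.
Proof. by move=> gt; apply: wT_pos; [exact: gr_C gt.1 x|exact: gr_neq0]. Qed.

Lemma Th_continuous t : good t -> continuous (Th t).
Proof.
move=> gt x; apply: (@Theta_cvg _ (nbhs x) _ (gr W t)).
- exact: gr_continuous gt.1 x.
- by move=> y; exact: gr_C gt.1 y.
- by apply: nearW => y; exact: gr_neq0.
- exact: gr_C gt.1 x.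
- exact: gr_neq0.
Qed.

Lemma Th_measurable t D : good t -> measurable_fun D (Th t : borelRV R m -> R).
Proof. by move=> gt; apply: measurable_funTS; apply: continuous_measurable; exact: Th_continuous. Qed.

Lemma ETh_measurable t D : good t -> measurable_fun D (fun x : borelRV R m => (Th t x)%:E).
Proof. by move=> gt; apply/measurable_EFinP; exact: Th_measurable. Qed.

(* The Theta-weighted area of the boundary points of epi t with a unique normal, in eta, measured in the projection along e. *)
Definition T t (eta : set 'rV[R]_n) : \bar R := (\int[lam]_(x in reg W t eta) (Th t x)%:E)%E.
Definition above (t : 'rV[R]_m -> R) : set 'rV[R]_m := [set x | tC W x < t x].
Definition Itot t : \bar R := (\int[lam]_(x in above t) (Th t x)%:E)%E.

Lemma above_borel t : adm W t -> measurable (above t : set (borelRV R m)).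
Proof.
move=> ta; apply: open_borel; apply: open_continuous_lt; last exact: adm_continuous ta.
by apply: adm_continuous; exact: tC_adm.
Qed.

Lemma T_measure t : good t ->
  exists M : {measure set (borelRV R n) -> \bar R}, forall B, measurable B -> M B = T t B.
Proof.
move=> gt; apply: (@integral_measure _ _ _ (borelRV R m) (borelRV R n) lam (reg W t) (Th t)).
- exact: (reg_borel gt.1).
- move=> B x [u [Bu xu uniq]]; exists u => // B'; split; last by move=> B'u; exists u.
  by move=> [v [B'v xv _]]; rewrite -(uniq _ xv).
- exact: Th_measurable.
- by move=> x _; rewrite ltW// Th_gt0.
Qed.

Lemma T_ge0 t eta : good t -> (0 <= T t eta)%E.
Proof. by move=> gt; apply: integral_ge0 => x _; rewrite lee_fin ltW// Th_gt0. Qed.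

Lemma le_T t (A B : set (borelRV R n)) : good t -> measurable A -> measurable B -> A `<=` B -> (T t A <= T t B)%E.
Proof.
move=> gt mA mB AB; apply: ge0_subset_integral.
- exact: reg_borel gt.1 _ mA.
- exact: reg_borel gt.1 _ mB.
- exact: ETh_measurable.
- by move=> x _; rewrite lee_fin ltW// Th_gt0.
- exact: reg_sub.
Qed.

Lemma T_has_nrm t (F : set 'rV[R]_n) : good t -> closed F ->
  T t F = (\int[lam]_(x in has_nrm W t F) (Th t x)%:E)%E.
Proof.
move=> gt cF; rewrite /T regE -ge0_negligible_integral//.
- exact: Mult_borel gt.1.
- by apply: closed_borel; apply: has_nrm_closed gt.1 _ cF.
- exact: ETh_measurable.
- by move=> x _; rewrite lee_fin ltW// Th_gt0.
- exact: Mult_null gt.1.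
Qed.

Lemma tCZ x (s : R) : 0 < s -> tC W (s *: x) = s * tC W x.
Proof.
have H y (r : R) : 0 < r -> tC W (r *: y) <= r * tC W y.
  by move=> r0; apply/C_gamP; rewrite gamZ; apply: CZ (ltW r0); exact/C_gamP.
move=> s0; apply/eqP; rewrite eq_le H//=.
have si : 0 < s^-1 by rewrite invr_gt0.
by have := H (s *: x) _ si; rewrite scalerA mulVf ?gt_eqF// scale1r ler_pdivlMl.
Qed.

Definition touching t : set 'rV[R]_m := has_nrm W t (Omega C) `\` above t.

Lemma touchingE t : touching t = \bigcup_k (has_nrm W t (Om W k.+1%:R^-1) `\` above t).
Proof.
apply/seteqP; split=> x.
  move=> [[u /Omega_Om[c c0 Hc] xu] nx]; exists (Num.truncn c^-1) => //; split=> //.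
  exists u => //; apply: Om_anti Hc.
  by rewrite invf_ple ?posrE// ltW// truncnS_gt.
by move=> [k _ [[u Hu xu] nx]]; split=> //; exists u => //; apply: Om_Omega Hu.
Qed.

Lemma touching_piece_borel t k : adm W t ->
  measurable (has_nrm W t (Om W k.+1%:R^-1) `\` above t : set (borelRV R m)).
Proof.
move=> ta; apply: measurableD; last exact: above_borel.
by apply: closed_borel; apply: has_nrm_closed ta _ _; exact: Om_closed.
Qed.

(* Two points of one ray with normals in Omega coincide: the outer one is strictly below both. *)
Lemma touching_null t : good t -> lam (touching t) = 0%E.
Proof.
move=> gt; have ta := gt.1; rewrite touchingE; apply: lam_bigcup0 => k.
have E x : ~ above t x -> t x = tC W x.
  move=> /negP; rewrite -leNgt => h; apply/eqP; rewrite eq_le h.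
  by case: ta => ->.
apply: null_rays; first exact: touching_piece_borel.
  by move=> [_]; apply; rewrite /above/= tC0 gt.2.
move=> x s [[u Hu xu] nx] s0 [[v Hv xv] nsx].
have X0 := gr_neq0 x gt; have CX := gr_C ta x.
have k0 : (0 : R) < k.+1%:R^-1 by rewrite invr_gt0.
have sX : gr W t (s *: x) = s *: gr W t x by rewrite /gr !E// tCZ// gamZ.
have := nrm_gr (s *: x) xu; have := nrm_gr x xv.
rewrite sX -[X in dotv (X - _) v](scale1r (gr W t x)) -[X in dotv (_ - X) u](scale1r (gr W t x)).
rewrite -!scalerBl !dotvZl nmulr_lle0 ?(Om_neq0 k0 Hv)// nmulr_lle0 ?(Om_neq0 k0 Hu)//.
by rewrite !subr_ge0 => h1 h2; apply/eqP; rewrite eq_le h1.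
Qed.

Lemma touching_borel t : adm W t -> measurable (touching t : set (borelRV R m)).
Proof. by move=> ta; rewrite touchingE; apply: bigcupT_measurable => k; exact: touching_piece_borel. Qed.

Lemma T_le_I t (eta : set (borelRV R n)) : good t -> measurable eta -> eta `<=` Omega C -> (T t eta <= Itot t)%E.
Proof.
move=> gt me eO; have ta := gt.1; have mr := reg_borel ta me.
have f0 x : (0 <= (Th t x)%:E)%E by rewrite lee_fin ltW// Th_gt0.
rewrite /T (@ge0_negligible_integral _ _ _ _ _ (touching t : set (borelRV R m)))//.
- apply: ge0_subset_integral => //.
  + by apply: measurableD => //; exact: touching_borel.
  + exact: above_borel.
  + exact: ETh_measurable.
  + move=> x [[u [eu xu _]] nt]; apply: contrapT => na; apply: nt; split=> //.
    by exists u => //; apply: eO.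
- exact: touching_borel.
- exact: ETh_measurable.
- exact: touching_null.
Qed.

Lemma powR_anti (a b : R) : 0 < a -> a <= b -> b `^ (- q) <= a `^ (- q).
Proof.
move=> a0 ab; have b0 := lt_le_trans a0 ab.
rewrite !powRN lef_pV2 ?posrE ?powR_gt0//.
by rewrite ge0_ler_powR ?nnegrE ?(ltW a0) ?(ltW b0)//; exact: wq0.
Qed.

Lemma powR_split (s : R) : 0 < s -> s ^+ m * s `^ (- q) = s `^ (m%:R - q).
Proof. by move=> s0; rewrite -powR_mulrn ?ltW// -powRD// (gt_eqF s0) implybT. Qed.

(** The normal inequality at the graph point [t 0 *: e] gives
    [- t 0 * enorm e <= dotv (gr W t x) u], while [Om W c] makes the right side at most
    [- c * enorm (gr W t x)]. *)
Lemma reg_Om_bound t c x : good t -> 0 < c -> has_nrm W t (Om W c) x ->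
  enorm (gr W t x) <= t 0 * enorm e / c.
Proof.
move=> [ta t0] c0 [u [u1 Hu] xu].
have := nrm_gr 0 xu; rewrite {1}/gr gam_e dotvBl dotvZl => h1.
have h2 := Hu _ (gr_C ta x).
rewrite ler_pdivlMr// mulrC.
have h3 : - (enorm e) <= dotv e u.
  by have := norm_dotv_le e u; rewrite u1 mulr1 ler_norml => /andP[].
have h4 : t 0 * - enorm e <= t 0 * dotv e u by rewrite ler_pM2l.
by move: h4; rewrite mulrN => h4; lra.
Qed.

Lemma ball_sub_cube (r : R) (x : 'rV[R]_m) : enorm x < r -> cube (\row__ - r) (2 * r) x.
Proof.
move=> xr i; have := le_lt_trans (le_trans (coord_le_norm x i) (norm_le_enorm x)) xr.
by rewrite !mxE ltr_norml; lra.
Qed.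

(** Normals in [Om W c] occur only over a cube of side proportional to [t 0], and on the graph
    [Theta] is at most a multiple of [t 0] to the power [- q]. *)
Lemma T_upper c : 0 < c -> exists2 A : R, 0 < A & forall t, good t ->
  (T t (Om W c) <= (A * t 0%R `^ (m%:R - q))%:E)%E.
Proof.
move=> c0; have [cT [dT [cT0 dT0 HT]]] := Theta_bounds.
have en0 : 0 < enorm e by rewrite enorm_gt0 e_neq0.
pose rho := 2 * (Kp W * (enorm e / c)).
have rho0 : 0 < rho by rewrite mulr_gt0// mulr_gt0 ?Kp_gt0// divr_gt0.
pose A := (2 * rho) ^+ m * fine (lam (cube 0 1)) * (dT * K1^-1 `^ (- q)).
have A0 : 0 < A.
  by rewrite !mulr_gt0 ?exprn_gt0 ?lam_unit_gt0 ?powR_gt0 ?invr_gt0 ?K1_gt0// mulr_gt0.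
exists A => // t gt; have [ta t0] := gt.
rewrite T_has_nrm//; last exact: Om_closed.
pose Q := cube (\row__ - (t 0 * rho)) (2 * (t 0 * rho)) : set 'rV[R]_m.
have sub : has_nrm W t (Om W c) `<=` Q.
  move=> x /(reg_Om_bound gt c0) h; apply: ball_sub_cube.
  have h1 : enorm x <= Kp W * enorm (gr W t x).
    by have := prj_le W (gr W t x); rewrite /gr prj_gam.
  apply: (le_lt_trans h1); apply: (@le_lt_trans _ _ (t 0 * (rho / 2))).
    rewrite /rho [2 * _]mulrC mulfK// mulrCA ler_pM2l ?Kp_gt0// mulrA; exact: h.
  by rewrite ltr_pM2l// ltr_pdivrMr// ltr_pMr// ltr1n.
apply: (@le_trans _ _ (\int[lam]_(x in Q) (dT * (t 0 / K1) `^ (- q))%:E)%E).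
  apply: (@le_trans _ _ (\int[lam]_(x in has_nrm W t (Om W c)) (dT * (t 0 / K1) `^ (- q))%:E)%E).
    apply: le_int.
    - by apply: closed_borel; apply: has_nrm_closed ta _ _; exact: Om_closed.
    - exact: Th_measurable.
    - exact: measurable_cst.
    - by move=> x _; rewrite ltW// Th_gt0.
    move=> x _; have [_ h] := HT _ (gr_C ta x) (gr_neq0 x gt).
    apply: (le_trans h); rewrite ler_wpM2l ?(ltW dT0)// powR_anti ?divr_gt0 ?K1_gt0//.
    by rewrite ler_pdivrMr ?K1_gt0// mulrC; exact: epi_far ta (epi_gr W t x).
  apply: sub_int; last exact: sub.
  - by apply: closed_borel; apply: has_nrm_closed ta _ _; exact: Om_closed.
  - exact: cube_borel.
  - exact: measurable_cst.
  - by move=> x _; rewrite mulr_ge0 ?(ltW dT0)// powR_ge0.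
rewrite int_cst; last exact: cube_borel.
have tr0 : 0 < 2 * (t 0 * rho) by rewrite mulr_gt0// mulr_gt0.
rewrite /Q lam_cube// -(fineK (lam_unit_fin R p)) -!EFinM lee_fin.
rewrite -powR_split// powRM ?invr_ge0 ?(ltW K1_gt0) ?(ltW t0)//.
rewrite le_eqVlt; apply/orP; left; apply/eqP.
rewrite /A (_ : 2 * (t 0 * rho) = t 0 * (2 * rho)); last by rewrite mulrCA.
by rewrite [(t 0 * (2 * rho)) ^+ _]exprMn; ring.
Qed.

Lemma I_lower : exists2 B : R, 0 < B & forall t, good t -> ((B * t 0%R `^ (m%:R - q))%:E <= Itot t)%E.
Proof.
have [cT [dT [cT0 dT0 HT]]] := Theta_bounds.
have k0 := kap_gt0 W.
(* On the cube of side [s * t 0] one has [kap W * enorm x <= t 0 / 4], so [t] is at least 3/4 of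
   [t 0] and [tC W] at most 1/4; [K2 * t 0] bounds the distance of these graph points from the
   origin. *)
pose s := (4 * kap W * m%:R)^-1.
have s0 : 0 < s by rewrite invr_gt0 !mulr_gt0.
pose K2 := (4 * kap W)^-1 + 2 * enorm e.
have K20 : 0 < K2 by rewrite ltr_wpDr ?mulr_ge0// invr_gt0 mulr_gt0.
pose B := s ^+ m * fine (lam (cube 0 1)) * (cT * K2 `^ (- q)).
have B0 : 0 < B by rewrite !mulr_gt0 ?exprn_gt0 ?lam_unit_gt0 ?powR_gt0.
exists B => // t gt; have [ta t0] := gt.
have st0 : 0 < s * t 0 by rewrite mulr_gt0.
pose Q := cube 0 (s * t 0) : set 'rV[R]_m.
have Qx x : Q x -> enorm x <= t 0 / (4 * kap W).
  move=> hx; have h0 : Q 0 by move=> i; rewrite !mxE add0r lexx.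
  have := cube_dist hx h0; rewrite subr0 => /le_trans; apply.
  by rewrite mulrA [_ * s](_ : _ = (4 * kap W)^-1) ?[_ * t 0]mulrC// /s invfM mulrCA divff ?mulr1// .
have Qk x : Q x -> kap W * enorm x <= t 0 / 4.
  move=> /Qx h; apply: (@le_trans _ _ (kap W * (t 0 / (4 * kap W)))); first by rewrite ler_pM2l.
  by rewrite le_eqVlt; apply/orP; left; apply/eqP; field; rewrite gt_eqF.
have sub : Q `<=` above t.
  move=> x /Qk h; have h1 := adm_lip1 ta 0 x; have h2 := adm_lip1 (tC_adm W) x 0.
  by move: h1 h2; rewrite /above/= tC0 sub0r enormN subr0; lra.
apply: (@le_trans _ _ (\int[lam]_(x in Q) (cT * (K2 * t 0) `^ (- q))%:E)%E); last first.
  apply: (@le_trans _ _ (\int[lam]_(x in Q) (Th t x)%:E)%E); last first.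
    apply: sub_int; [exact: cube_borel|exact: above_borel|exact: Th_measurable| |exact: sub].
    by move=> x _; rewrite ltW// Th_gt0.
  apply: le_int; [exact: cube_borel|exact: measurable_cst|exact: Th_measurable| |].
    by move=> x _; rewrite mulr_ge0 ?(ltW cT0)// powR_ge0.
  move=> x hx; have [h _] := HT _ (gr_C ta x) (gr_neq0 x gt).
    apply: le_trans h; rewrite ler_wpM2l ?(ltW cT0)// powR_anti ?enorm_gt0 ?gr_neq0//.
    rewrite /gr (le_trans (gam_le _ _ _))// /K2 mulrDl; apply: lerD.
      by rewrite mulrC; exact: Qx.
    rewrite mulrAC ler_wpM2r//.
    have h1 := adm_lip1 ta x 0; have h2 := Qk _ hx; have h3 := adm_lip1 ta 0 x.
    by move: h1 h3; rewrite sub0r enormN subr0 ler_norml; lra.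
rewrite int_cst; last exact: cube_borel.
rewrite /Q lam_cube// -(fineK (lam_unit_fin R p)) -!EFinM lee_fin.
rewrite -powR_split// [(K2 * t 0) `^ _]powRM ?(ltW K20) ?(ltW t0)//.
rewrite le_eqVlt; apply/orP; left; apply/eqP.
by rewrite /B exprMn; ring.
Qed.

End Functionals.

(** * Limits of projected areas *)

Section Limits.
Context (R : realType) (p : nat) (W : wcone R p).
Local Notation m := p.+1.
Local Notation n := p.+2.
Local Notation C := (wC W).
Local Notation e := (we W).
Local Notation q := (wq W).
Local Notation lam := (lam R p).
Variables (tk : nat -> 'rV[R]_m -> R) (t : 'rV[R]_m -> R).
Hypothesis gk : forall k, good W (tk k).
Hypothesis gt : good W t.
Hypothesis tkt : forall x, tk k x @[k --> \oo] --> t x.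

Lemma Th_cvg x : Th W (tk k) x @[k --> \oo] --> Th W t x.
Proof.
apply: Theta_cvg.
- by apply: cvg_gam; [exact: cvg_cst|exact: tkt].
- by move=> k; exact: gr_C (gk k).1 x.
- by apply: nearW => k; exact: gr_neq0.
- exact: gr_C gt.1 x.
- exact: gr_neq0.
Qed.

(** Fatou: if [tC W x < t x], then [tC W x < tk k x] eventually, so the integrands converge on
    [above W t]; elsewhere the limit integrand is 0. *)
Lemma I_lsc (r : \bar R) : (r < Itot W t)%E -> \forall k \near \oo, (r < Itot W (tk k))%E.
Proof.
move=> rI; apply: limn_einf_gt; apply: lt_le_trans rI _.
pose f k x := (\1_(above W (tk k)) x * Th W (tk k) x)%:E : \bar R.
have mf k : measurable_fun setT (f k : borelRV R m -> \bar R).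
  apply/measurable_EFinP; apply: measurable_funM; last exact: Th_measurable.
  by apply: measurable_indic; exact: above_borel (gk k).1.
have f0 k x : (0 <= f k x)%E by rewrite lee_fin mulr_ge0 ?indicE// ltW// Th_gt0.
have -> : (fun k => Itot W (tk k)) = (fun k => (\int[lam]_x f k x)%E).
  by apply/funext => k; rewrite /Itot (int_indic _ _ (@subsetT _ _)).
apply: le_trans (fatou lam measurableT mf (fun k x _ => f0 k x)).
rewrite /Itot (int_indic _ _ (@subsetT _ _)).
apply: ge0_le_integral => //.
- by move=> x _; rewrite lee_fin mulr_ge0 ?indicE// ltW// Th_gt0.
- apply/measurable_EFinP; apply: measurable_funM; last exact: Th_measurable.
  by apply: measurable_indic; exact: above_borel gt.1.
- rewrite (_ : (fun x => limn_einf (f^~ x)) = (fun x => -1 * limn_esup (fun k => -1 * f k x))%E); last first.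
    apply/funext => x; rewrite mulN1e /limn_einf; congr (- limn_esup _)%E.
    by apply/funext => k; rewrite mulN1e.
  apply: measurable_funeM; apply: (@measurable_fun_limn_esup _ (borelRV R m) R setT (fun k x => -1 * f k x)%E) => k.
  by apply: measurable_funeM; exact: mf.
- move=> x _; rewrite indicE; case: (boolP (x \in above W t)) => /=; last first.
    by move=> _; rewrite mul0r; apply: limn_einf_ge0 => k.
  rewrite inE mul1r => xt; suff : f k x @[k --> \oo] --> (Th W t x)%:E.
    by move/cvg_limn_einf_sup => [-> _].
  apply: cvg_EFin; first by apply: nearW.
  apply/cvgrPdist_lt => eps eps0; have /cvgrPdist_lt/(_ _ eps0) H1 := @Th_cvg x.
  have : \forall k \near \oo, tC W x < tk k x by exact: cvgr_gt (@tkt x) _ xt.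
  by apply: filterS2 H1 => k h1 h2; rewrite /f /= indicE mem_set// mul1r.
Qed.

Section USC.
Variables (a A c : R) (F : set 'rV[R]_n).
Hypothesis a0 : 0 < a.
Hypothesis c0 : 0 < c.
Hypothesis tka : forall k, a <= tk k 0 <= A.
Hypothesis cF : closed F.
Hypothesis FO : F `<=` Om W c.

(** The bounds on [tk k 0] confine all the sets to one cube [Q] and bound [Theta] there, so
    dominated convergence applies; by [normal_limit] a point without a limit normal in [F]
    eventually has none. *)
Lemma T_usc (r : \bar R) : (T W t F < r)%E -> \forall k \near \oo, (T W (tk k) F < r)%E.
Proof.
move=> Tr.
have [cT [dT [cT0 dT0 HT]]] := Theta_bounds W.
have at0 : a <= t 0 by apply: (cvgr_to_ge (@tkt 0)); apply: nearW => k; have /andP[] := tka k.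
have tA : t 0 <= A by apply: (cvgr_to_le (@tkt 0)); apply: nearW => k; have /andP[] := tka k.
pose M := dT * (a / K1 W) `^ (- q).
have ThM s x : good W s -> a <= s 0 -> Th W s x <= M.
  move=> gs as0; have [_ h] := HT _ (gr_C gs.1 x) (gr_neq0 x gs).
  apply: (le_trans h); rewrite ler_wpM2l ?(ltW dT0)// powR_anti ?divr_gt0 ?K1_gt0//.
  by rewrite ler_pdivrMr ?K1_gt0// mulrC (le_trans as0)//; exact: epi_far gs.1 (epi_gr W s x).
pose rho := Kp W * (A * enorm e / c) + 1.
pose Q := cube (\row__ - rho) (2 * rho) : set 'rV[R]_m.
have sub s : good W s -> s 0 <= A -> has_nrm W s F `<=` Q.
  move=> gs sA x [u Fu xu]; apply: ball_sub_cube.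
  have h : enorm (gr W s x) <= s 0 * enorm e / c.
    by apply: (reg_Om_bound gs c0); exists u => //; exact: FO.
  have h1 : enorm x <= Kp W * enorm (gr W s x).
    by have := prj_le W (gr W s x); rewrite /gr prj_gam.
  rewrite /rho; apply: (@le_lt_trans _ _ (Kp W * (A * enorm e / c))); last by rewrite ltrDl.
  apply: (le_trans h1); rewrite ler_wpM2l ?(ltW (Kp_gt0 W))// (le_trans h)//.
  by rewrite -!mulrA ler_wpM2r// divr_ge0// ltW.
have mQ : measurable (Q : set (borelRV R m)) by exact: cube_borel.
have rho0 : 0 < rho.
  rewrite ltr_wpDl// mulr_ge0 ?(ltW (Kp_gt0 W))// divr_ge0 ?(ltW c0)// mulr_ge0//.
  by rewrite (le_trans (ltW a0))// (le_trans at0).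
have Qfin : (lam Q < +oo)%E.
  by rewrite /Q lam_cube ?mulr_gt0// -(fineK (lam_unit_fin R p)) -EFinM ltry.
pose N s := has_nrm W s F.
have mN s : good W s -> measurable (N s : set (borelRV R m)).
  by move=> gs; apply: closed_borel; exact: has_nrm_closed gs.1 _ cF.
pose f s x := \1_(N s) x * Th W s x.
have mf s D : good W s -> measurable_fun D (f s : borelRV R m -> R).
  move=> gs; apply: measurable_funM; last exact: Th_measurable.
  by apply: measurable_indic; exact: mN.
have f0 s x : good W s -> 0 <= f s x by move=> gs; rewrite mulr_ge0 ?indicE// ltW// Th_gt0.
have fTh s x : good W s -> f s x <= Th W s x.
  by move=> gs; rewrite ler_piMl ?(ltW (Th_gt0 _ gs))// indicE; case: (_ \in _).
have TE s : good W s -> s 0 <= A -> T W s F = (\int[lam]_(x in Q) (f s x)%:E)%E.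
  by move=> gs sA; rewrite T_has_nrm// (int_indic lam (Th W s) (sub _ gs sA)).
(* The integrands [f (tk k)] need not converge, but their maxima with the limit integrand do: only
   the upper bound matters. *)
pose g k x := Num.max (f (tk k) x) (f t x).
have gf x : g k x @[k --> \oo] --> f t x.
  have [xN|xN] := pselect (N t x).
    have ft : f t x = Th W t x by rewrite /f indicE mem_set// mul1r.
    apply: (@squeeze_cvgr _ _ _ _ (fun=> f t x) (fun k => f t x + `|Th W (tk k) x - Th W t x|)).
    - apply: nearW => k; rewrite /g le_max lexx orbT/= ge_max lerDl normr_ge0 andbT ft.
      apply: (le_trans (fTh _ _ (gk k))); rewrite -lerBlDl; exact: ler_norm.
    - exact: cvg_cst.
    - rewrite -[X in _ --> X]addr0; apply: cvgD; first exact: cvg_cst.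
      have := cvg_norm (cvgB (@Th_cvg x) (cvg_cst (Th W t x))); rewrite subrr normr0; exact.
  have ft : f t x = 0 by rewrite /f indicE memNset// mul0r.
  rewrite ft; apply: cvg_near_cst.
  have cK : compact F by apply: (@compact_enorm_le _ _ 1) => // u /FO[->].
  have FP : F `<=` pol1 W by move=> u /FO h; apply: Omega_pol1; exact: Om_Omega h.
  have H := @normal_limit R p W nat \oo _ tk (fun=> x) t x F gt.1 cK FP (@tkt) (cvg_cst _) (@tkt x).
  have : \forall k \near \oo, forall u, F u -> ~ nrm W (tk k) x u by apply: H => u Fu xu; apply: xN; exists u.
  apply: filterS => k Hk; rewrite /g ft /f indicE memNset ?mul0r ?maxxx//.
  by move=> [u Fu xu]; exact: (Hk u Fu xu).
have mg k : measurable_fun (Q : set (borelRV R m)) (g k : borelRV R m -> R).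
  by apply: measurable_maxr; apply: mf.
have gM k x : 0 <= g k x <= M.
  rewrite /g le_max f0//= ge_max (le_trans (fTh _ _ (gk k)))/= ?(le_trans (fTh _ _ gt)) ?ThM//.
  by have /andP[] := tka k.
have := @dominated_convergence _ _ R lam Q mQ (fun k x => (g k x)%:E) (fun x => (f t x)%:E) (EFin \o cst M).
case.
- by move=> k; apply/measurable_EFinP.
- by apply/measurable_EFinP; exact: mf.
- by apply: aeW => x _; apply: cvg_EFin; [by apply: nearW|exact: gf].
- apply/integrableP; split; first by apply/measurable_EFinP; exact: measurable_cst.
  rewrite [X in (X < _)%E](_ : _ = (`|M|%:E * lam Q)%E); last by rewrite -int_cst.
  by apply: lte_mul_pinfty.
- by apply: aeW => x k _ /=; rewrite lee_fin ger0_norm; have /andP[] := gM k x.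
move=> _ _; rewrite -TE// => cvgI0.
have {cvgI0}cvgI : (\int[lam]_(x in Q) (g k x)%:E)%E @[k --> \oo] --> T W t F := cvgI0.
have : \forall k \near \oo, (\int[lam]_(x in Q) (g k x)%:E < r)%E by apply: (cvgI [set y | (y < r)%E]); apply: open_nbhs_nbhs; split; [exact: open_ereal_lt_ereal|].
apply: filterS => k; apply: le_lt_trans; have /andP[_ kA] := tka k.
rewrite TE//; apply: le_int => //; first exact: mf.
  by move=> x _; exact: f0.
by move=> x _; rewrite /g le_max lexx.
Qed.

End USC.
End Limits.

(** * Surface area and projected area *)

Section LocalDensity.
Context (R : realType) (p : nat).
Local Notation n := p.+1.
Local Open Scope ereal_scope.
Variables (Om : set (borelRV R n)) (J : 'rV[R]_n -> R).
Hypothesis mOm : measurable Om.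
Hypothesis J0 : forall u, Om u -> (0 < J u)%R.

(* [B] has density [J] with respect to [A], expressed without integrals. *)
Definition dens (A B : {measure set (borelRV R n) -> \bar R}) :=
  forall (e : R) u, (0 < e)%R -> Om u -> exists2 U : set 'rV[R]_n, nbhs u U &
    forall eta, measurable eta -> eta `<=` Om `&` U ->
      B eta <= (1 + e)%:E * ((J u)%:E * A eta) /\ (J u)%:E * A eta <= (1 + e)%:E * B eta.

Lemma sqr_eps (e : R) : (0 < e)%R -> exists2 d : R, (0 < d)%R & ((1 + d) * (1 + d) <= 1 + e)%R.
Proof.
(* With [d <= 1] the square of [1 + d] is at most [1 + 3 d]. *)
move=> e0; exists (Num.min 1 (e / 3))%R; first by rewrite lt_min ltr01 divr_gt0.
set d := Num.min _ _.
have d1 : (d <= 1)%R by rewrite /d ge_min lexx.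
have d3 : (d <= e / 3)%R by rewrite /d ge_min lexx orbT.
have d0 : (0 < d)%R by rewrite /d lt_min ltr01 divr_gt0.
have : (d * d <= d)%R by rewrite ler_piMr// ltW.
lra.
Qed.

(** Near [u] both [A] and [A'] agree with the common measure divided by [J u] up to a factor
    [1 + d]; two such factors are absorbed by [local_le]. The other direction, [dens_eql], is
    symmetric. *)
Lemma dens_eqr A B A' B' : dens A B -> dens A' B' ->
  (forall eta, measurable eta -> eta `<=` Om -> B eta = B' eta) ->
  forall eta, measurable eta -> eta `<=` Om -> A eta = A' eta.
Proof.
have key A1 B1 A2 B2 : dens A1 B1 -> dens A2 B2 ->
    (forall eta, measurable eta -> eta `<=` Om -> B1 eta = B2 eta) ->
    forall eta, measurable eta -> eta `<=` Om -> A1 eta <= A2 eta.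
  move=> H1 H2 E; apply: local_le => // e u e0 Ou.
  have [d d0 de] := sqr_eps e0.
  have [U1 nU1 K1] := H1 d u d0 Ou; have [U2 nU2 K2] := H2 d u d0 Ou.
  exists (U1 `&` U2); first exact: filterI.
  move=> eta me eU.
  have [_ h1] := K1 eta me (fun x h => conj (eU x h).1 (eU x h).2.1).
  have [h2 _] := K2 eta me (fun x h => conj (eU x h).1 (eU x h).2.2).
  have d1 : (0 <= (1 + d)%:E :> \bar R) by rewrite lee_fin addr_ge0// ltW.
  have Ju := J0 Ou.
  rewrite -(@lee_pmul2l _ (J u)%:E)// muleCA; set X := (J u)%:E * A2 eta in h2 *.
  apply: (le_trans h1); rewrite E//; last by move=> x /eU[].
  apply: (le_trans (lee_wpmul2l d1 h2)); rewrite muleA -EFinM.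
  by apply: lee_wpmul2r; rewrite ?lee_fin// mule_ge0// lee_fin ltW.
move=> H1 H2 E eta me eO; apply/eqP; rewrite eq_le (key _ _ _ _ H1 H2)//=.
by apply: (key _ _ _ _ H2 H1) => // x mx xO; rewrite E.
Qed.

Lemma dens_eql A B A' B' : dens A B -> dens A' B' ->
  (forall eta, measurable eta -> eta `<=` Om -> A eta = A' eta) ->
  forall eta, measurable eta -> eta `<=` Om -> B eta = B' eta.
Proof.
have key A1 B1 A2 B2 : dens A1 B1 -> dens A2 B2 ->
    (forall eta, measurable eta -> eta `<=` Om -> A1 eta = A2 eta) ->
    forall eta, measurable eta -> eta `<=` Om -> B1 eta <= B2 eta.
  move=> H1 H2 E; apply: local_le => // e u e0 Ou.
  have [d d0 de] := sqr_eps e0.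
  have [U1 nU1 K1] := H1 d u d0 Ou; have [U2 nU2 K2] := H2 d u d0 Ou.
  exists (U1 `&` U2); first exact: filterI.
  move=> eta me eU.
  have [h1 _] := K1 eta me (fun x h => conj (eU x h).1 (eU x h).2.1).
  have [_ h2] := K2 eta me (fun x h => conj (eU x h).1 (eU x h).2.2).
  have d1 : (0 <= (1 + d)%:E :> \bar R) by rewrite lee_fin addr_ge0// ltW.
  apply: (le_trans h1); rewrite E//; last by move=> x /eU[].
  apply: (le_trans (lee_wpmul2l d1 h2)); rewrite muleA -EFinM.
  by apply: lee_wpmul2r; rewrite ?lee_fin.
move=> H1 H2 E eta me eO; apply/eqP; rewrite eq_le (key _ _ _ _ H1 H2)//=.
by apply: (key _ _ _ _ H2 H1) => // x mx xO; rewrite E.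
Qed.

Lemma dens_integral (mu : {measure set (borelRV R n) -> \bar R}) :
  (forall (e : R) u, (0 < e)%R -> Om u -> exists2 d : R, (0 < d)%R &
     forall v, Om v -> (enorm (u - v) < d)%R -> (J v <= (1 + e) * J u /\ J u <= (1 + e) * J v)%R) ->
  exists2 nu : {measure set (borelRV R n) -> \bar R}, dens nu mu &
    measurable_fun Om (fun u : borelRV R n => (J u)^-1)%R /\
    forall eta, measurable eta -> eta `<=` Om -> nu eta = \int[mu]_(u in eta) (J u)^-1%:E.
Proof.
move=> HJ.
(* [J] is continuous only along [Om]; a superlevel set of its inverse is the trace on [Om] of the
   open union of the neighbourhoods [B u]. *)
have mJ : measurable_fun Om (fun u : borelRV R n => (J u)^-1)%R.
  move=> _; apply: (measurability _ (RGenOInfty.measurableE R)) => //.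
  move=> _ [_ [r ->] <-].
  pose B u : set 'rV[R]_n := [set v | exists2 d, (0 < d)%R & (enorm (u - v) < d)%R /\
     forall w, Om w -> (enorm (u - w) < d)%R -> (r < (J w)^-1)%R].
  rewrite (_ : Om `&` _ = Om `&` \bigcup_(u in [set u | Om u /\ (r < (J u)^-1)%R]) B u).
    apply: measurableI => //; apply: open_borel; apply: bigcup_open => u _.
    rewrite openE => v [d d0 [uv Hd]].
    have h : (0 < d - enorm (u - v))%R by rewrite subr_gt0.
    apply: filterS (enball_nbhs v h) => w /= vw; exists d => //; split=> //.
    by apply: (le_lt_trans (enormB_le u v w)); rewrite addrC -ltrBrDr.
  apply/seteqP; split=> [u [Ou]|v [Ov [u [Ou ru] [d d0 [uv Hd]]]]].
    rewrite /= in_itv/= andbT => ru; split=> //; exists u => //.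
    have [r0|r0] := leP r 0%R.
      exists 1%R => //; rewrite subrr enorm0; split=> // w Ow _.
      by rewrite (le_lt_trans r0)// invr_gt0 J0.
    have ru' : (r * J u < 1)%R by rewrite -ltr_pdivlMr ?J0// div1r.
    have Ju := J0 Ou.
    (* Chosen so that [r * ((1 + e) * J u)] is the midpoint of [r * J u] and 1, still below 1. *)
    have e0 : (0 < (1 - r * J u) / (2 * (r * J u)))%R by rewrite divr_gt0 ?subr_gt0// !mulr_gt0.
    have [d d0 Hd] := HJ _ _ e0 Ou.
    exists d => //; rewrite subrr enorm0; split=> // w Ow uw.
    have [h _] := Hd w Ow uw.
    rewrite -[X in (_ < X)%R]mul1r ltr_pdivlMr ?J0//.
    apply: (@le_lt_trans _ _ (r * ((1 + (1 - r * J u) / (2 * (r * J u))) * J u))%R).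
      by rewrite ler_pM2l.
    have rJ : (0 < r * J u)%R by rewrite mulr_gt0.
    have -> : (r * ((1 + (1 - r * J u) / (2 * (r * J u))) * J u) = (1 + r * J u) / 2)%R.
      by field; rewrite !gt_eqF.
    by rewrite ltr_pdivrMr//; lra.
  split=> //=; rewrite in_itv/= andbT; exact: Hd.
have J1 u : Om u -> (0 <= (J u)^-1)%R by move=> Ou; rewrite invr_ge0 ltW// J0.
have [nu Hnu] : exists nu : {measure set (borelRV R n) -> \bar R}, forall B, measurable B ->
    nu B = \int[mu]_(u in B `&` Om) (J u)^-1%:E.
  apply: (@integral_measure _ _ _ (borelRV R n) (borelRV R n) mu (fun B => B `&` Om)).
  - by move=> B mB; exact: measurableI.
  - by move=> B x [Bx Ox]; exists x => // B'; split=> [[]//|].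
  - by apply: measurable_funS mJ => // x [].
  - by move=> x [_ Ox]; exact: J1.
have nuE eta : measurable eta -> eta `<=` Om -> nu eta = \int[mu]_(u in eta) (J u)^-1%:E.
  by move=> me eO; rewrite Hnu// (_ : eta `&` Om = eta)//; apply/setIidPl.
exists nu => //; move=> e u e0 Ou.
have [d d0 Hd] := HJ e u e0 Ou.
exists [set v | enorm (u - v) < d]%R; first exact: enball_nbhs.
move=> eta me eU.
have eO : eta `<=` Om by move=> x /eU[].
have Ju := J0 Ou; have e1 : (0 < 1 + e)%R by rewrite addr_gt0.
have mJe : measurable_fun eta (fun u => (J u)^-1)%R by apply: measurable_funS mJ.
rewrite nuE//; split.
  rewrite muleA -EFinM -lee_pdivrMl ?mulr_gt0// -int_cst//.
  apply: le_int => //; first by move=> v _; rewrite invr_ge0 mulr_ge0 ?ltW.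
  move=> v ev; have Ov := eO _ ev; have [h _] := Hd v Ov (eU _ ev).2.
  by rewrite lef_pV2 ?posrE ?mulr_gt0 ?J0.
rewrite -lee_pdivlMl// muleA -EFinM -int_cst//.
apply: le_int => //; first by move=> v ev; apply: J1; exact: eO.
move=> v ev; have Ov := eO _ ev; have [_ h] := Hd v Ov (eU _ ev).2.
have Jv := J0 Ov; rewrite mulrC ler_pdivlMr// mulrC ler_pdivrMr//.
Qed.

End LocalDensity.

(** * Area of a graph against its projected area *)

Section AreaDensity.
Context (R : realType) (p : nat) (W : wcone R p).
Local Notation m := p.+1.
Local Notation n := p.+2.
Local Notation C := (wC W).
Local Notation e := (we W).
Local Notation q := (wq W).
Local Notation Theta := (wT W).
Local Notation lam := (lam R p).
Local Notation gam := (gam W).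

(** A normal in the polar cone forces the point onto the graph. Conversely a normal [u] in [Omega C]
    has [dotv X u < 0] at its graph point [X], so [(1 - d) *: X] lies in [C] outside the epigraph,
    and [X] is in the effective boundary. *)
Lemma nu_preimageE t (eta : set 'rV[R]_n) : good W t -> eta `<=` Omega C ->
  nu_preimage C (epi W t) eta = gr W t @` reg W t eta.
Proof.
move=> gt eO; have ta := gt.1; apply/seteqP; split=> [X [[eX _] [u [eu Xu uniq]]]|_ [x [u [eu xu uniq]] <-]].
  have Pu := Omega_pol1 (eO _ eu).
  have XE : X = gr W t (prj W X).
    rewrite -{1}(gamK W X) /gr; congr (gam _ _); apply/eqP; rewrite eq_le andbC.
    have h : t (prj W X) <= ht W X := eX; rewrite h/=.
    have := Xu.2 _ (epi_gr W t (prj W X)); rewrite -{2}(gamK W X) /gr -gamB subrr gam_e dotvZl.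
    by rewrite nmulr_lle0 ?pol1_e0// subr_ge0.
  exists (prj W X); last by rewrite -XE.
  by exists u; rewrite /nrm -XE; split.
split; last by exists u.
split; first exact: epi_gr.
have [c c0 Hc] := Omega_Om (eO _ eu).
have CX := gr_C ta x; have X0 := gr_neq0 x gt.
have Xu := Om_neq0 c0 Hc CX X0.
have nX : 0 < enorm (gr W t x) by rewrite enorm_gt0.
move=> B /nbhs_enball[r r0 HB].
pose d := Num.min 1 (r / (2 * enorm (gr W t x))).
have d0 : 0 < d by rewrite /d lt_min ltr01 divr_gt0// mulr_gt0.
have d1 : d <= 1 by rewrite /d ge_min lexx.
have dr : d * enorm (gr W t x) < r.
  apply: (@le_lt_trans _ _ (r / 2)); last by rewrite ltr_pdivrMr// ltr_pMr// ltr1n.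
  have : d <= r / (2 * enorm (gr W t x)) by rewrite /d ge_min lexx orbT.
  by rewrite ler_pdivlMr ?mulr_gt0// => h; rewrite ler_pdivlMr//; lra.
exists ((1 - d) *: gr W t x); split; last first.
  by apply: HB; rewrite scalerBl scale1r opprB addrC subrK enormZ gtr0_norm.
split; first by apply: CZ => //; rewrite subr_ge0.
move=> eX; have := xu.2 _ eX; rewrite scalerBl scale1r addrC addKr dotvNl dotvZl oppr_le0.
by rewrite pmulr_rge0// leNgt Xu.
Qed.

(** The linear function whose graph, in the coordinates [gam], is the hyperplane orthogonal to
    [u]. *)
Definition slf (u : 'rV[R]_n) (x : 'rV[R]_m) : R := dotv (iota_ x) u / - dotv e u.

Lemma slfE u x : slf u x = dotv (iota_ x) u / - dotv e u. Proof. by []. Qed.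

Lemma slf_lin u a x y : slf u (a *: x + y) = a * slf u x + slf u y.
Proof. by rewrite /slf iota_lin dotvDl dotvZl mulrDl mulrA. Qed.

Lemma slfB u x y : slf u (x - y) = slf u x - slf u y.
Proof. by have := slf_lin u (-1) y x; rewrite scaleN1r mulN1r ![- _ + _]addrC. Qed.

Definition plane u x := gam x (slf u x).

Lemma plane_lin u a x y : plane u (a *: x + y) = a *: plane u x + plane u y.
Proof. by rewrite /plane slf_lin gam_lin. Qed.

Lemma planeB u x y : plane u (x - y) = plane u x - plane u y.
Proof. by have := plane_lin u (-1) y x; rewrite !scaleN1r ![- _ + _]addrC. Qed.

Lemma plane_expanding u : exists2 c : R, 0 < c & forall x y, c * enorm (x - y) <= enorm (plane u x - plane u y).
Proof.
exists (Kp W)^-1; first by rewrite invr_gt0 Kp_gt0.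
move=> x y; rewrite ler_pdivrMl ?Kp_gt0// -planeB.
by have := prj_le W (plane u (x - y)); rewrite /plane prj_gam.
Qed.

Definition planem u : expanding_map R m n := ExpandingMap (plane_expanding u).

Lemma plane_lip u : exists2 K, 0 < K & forall x y, enorm (plane u x - plane u y) <= K * enorm (x - y).
Proof.
exists (1 + enorm u / `|dotv e u| * enorm e); first by rewrite ltr_pwDl// mulr_ge0// divr_ge0.
move=> x y; rewrite -planeB /plane (le_trans (gam_le _ _ _))// mulrDl mul1r lerD2l.
rewrite mulrAC ler_wpM2r// /slf normrM normfV normrN mulrAC ler_wpM2r ?invr_ge0//.
by rewrite (le_trans (norm_dotv_le _ _))// enorm_iota mulrC.
Qed.

Definition Jac u : R := jac (planem u).

Lemma Jac_gt0 u : 0 < Jac u.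
Proof. by have [K K0 HK] := plane_lip u; apply: (@jac_gt0 R p n (planem u) K). Qed.

Lemma hmeas_plane u (A : set (borelRV R m)) : measurable A -> hmeas p (planem u) A = ((Jac u)%:E * lam A)%E.
Proof.
by have [K K0 HK] := plane_lip u; apply: (@haar R p n (planem u) K) => //; exact: plane_lin.
Qed.

(** Shifting a chord [D] along [e] into the hyperplane orthogonal to [u0] changes it by
    [dotv D u0 / dotv e u0] times [e], hence by at most [b * enorm D]. So the correspondence between
    graph and plane is Lipschitz both ways, with constants near 1. *)
Lemma tilt (f : 'rV[R]_m -> R) (A : set 'rV[R]_m) u0 (d : R) : pol1 W u0 -> 0 <= d ->
  d * enorm e / er W < 1 ->
  (forall x y, A x -> A y -> `|dotv (gam (x - y) (f x - f y)) u0| <= d * enorm (gam (x - y) (f x - f y))) ->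
  (hausdorff m ((fun x => gam x (f x)) @` A) <=
     ((1 - d * enorm e / er W)^-1 ^+ m)%:E * hausdorff m (plane u0 @` A))%E /\
  (hausdorff m (plane u0 @` A) <=
     ((1 + d * enorm e / er W) ^+ m)%:E * hausdorff m ((fun x => gam x (f x)) @` A))%E.
Proof.
move=> Pu d0; set b := d * enorm e / er W => b1 H.
have r0 := er_gt0 W.
have b0 : 0 <= b by rewrite divr_ge0 ?(ltW r0)// mulr_ge0.
have eu : er W <= - dotv e u0 by have := pol1_e Pu; lra.
have eu0 : 0 < - dotv e u0 := lt_le_trans r0 eu.
have key x y : A x -> A y ->
    enorm (gam (x - y) (f x - f y) - plane u0 (x - y)) <= b * enorm (gam (x - y) (f x - f y)).
  move=> Ax Ay; have := H x y Ax Ay; set D := gam _ _ => hD.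
  have E : D - plane u0 (x - y) = (dotv D u0 / dotv e u0) *: e.
    rewrite /plane /D -gamB subrr gam_e; congr (_ *: _).
    rewrite /slf gamE dotvDl dotvZl invrN mulrN opprK mulrDl mulfK; first by rewrite addrC.
    by rewrite lt_eqF// pol1_e0.
  have h : `|dotv D u0| * `|dotv e u0|^-1 <= d * enorm D * (er W)^-1.
    by apply: ler_pM; rewrite ?invr_ge0// ltr0_norm ?pol1_e0// lef_pV2 ?posrE.
  rewrite E enormZ normrM normfV [X in _ <= X](_ : _ = d * enorm D * (er W)^-1 * enorm e).
    by rewrite ler_wpM2r.
  by rewrite /b; ring.
have b1' : 0 < 1 - b by rewrite subr_gt0.
split.
  apply: hausdorff_lipschitz; first by rewrite invr_gt0.
  move=> x y Ax Ay; have h := key x y Ax Ay; rewrite ler_pdivlMl// -gamB -planeB.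
  set D := gam _ _ in h *; have := enormB_le D (plane u0 (x - y)) 0.
  by rewrite !subr0; lra.
apply: hausdorff_lipschitz; first by rewrite ltr_pwDl.
move=> x y Ax Ay; have h := key x y Ax Ay; rewrite -gamB -planeB.
set D := gam _ _ in h *; have := enormB_le (plane u0 (x - y)) D 0.
by rewrite !subr0 enormC; lra.
Qed.

Lemma pow_eps (ep : R) : 0 < ep -> exists b : R, [/\ 0 < b, b < 1, (1 - b)^-1 ^+ m <= 1 + ep & (1 + b) ^+ m <= 1 + ep].
Proof.
move=> e0; have e1 : 0 < 1 + ep by rewrite addr_gt0.
(* Bernoulli gives [(1 - b) ^+ m >= 1 - m * b], which for this [b] equals [1 / (1 + ep)]. *)
pose b := ep / (m%:R * (1 + ep)).
have b0 : 0 < b by rewrite divr_gt0// mulr_gt0.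
have b1 : b < 1.
  rewrite ltr_pdivrMr ?mulr_gt0// mul1r (@lt_le_trans _ _ (1 + ep))// ?ltrDr//.
  by rewrite ler_peMl ?(ltW e1)// ler1n.
have b1' : 0 < 1 - b by rewrite subr_gt0.
have bern k : 1 - k%:R * b <= (1 - b) ^+ k.
  elim: k => [|k IH]; first by rewrite mul0r subr0 expr0.
  rewrite exprS; apply: (@le_trans _ _ ((1 - b) * (1 - k%:R * b))); last by rewrite ler_pM2l.
  have : 0 <= k%:R * b * b by apply: mulr_ge0; [apply: mulr_ge0 => //; exact: ltW|exact: ltW].
  by rewrite -natr1; lra.
have H : (1 - b)^-1 ^+ m <= 1 + ep.
  rewrite exprVn -(invrK (1 + ep)) lef_pV2 ?posrE ?invr_gt0 ?exprn_gt0//.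
  apply: le_trans (bern m); rewrite /b le_eqVlt; apply/orP; left; apply/eqP; field.
  by rewrite gt_eqF//= pnatr_eq0.
exists b; split=> //; apply: le_trans H; apply: lerXn2r; rewrite ?nnegrE ?invr_ge0.
- by rewrite addr_ge0// (ltW b0).
- exact: ltW.
have bb : 0 <= b * b by apply: mulr_ge0; exact: ltW.
by rewrite -[X in _ <= X]div1r ler_pdivlMr//; lra.
Qed.

Lemma plane_orth u x : pol1 W u -> dotv (plane u x) u = 0.
Proof.
move=> Pu; rewrite /plane gamE dotvDl dotvZl /slf invrN mulrN mulNr divfK ?subrr//.
by rewrite lt_eqF// pol1_e0.
Qed.

Lemma eps_angle (ep : R) : 0 < ep -> exists2 d : R, 0 < d &
  forall f A u0, pol1 W u0 ->
  (forall x y, A x -> A y -> `|dotv (gam (x - y) (f x - f y)) u0| <= d * enorm (gam (x - y) (f x - f y))) ->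
  (hausdorff m ((fun x => gam x (f x)) @` A) <= (1 + ep)%:E * hausdorff m (plane u0 @` A))%E /\
  (hausdorff m (plane u0 @` A) <= (1 + ep)%:E * hausdorff m ((fun x => gam x (f x)) @` A))%E.
Proof.
move=> /pow_eps[b [b0 b1 h1 h2]].
have en0 : 0 < enorm e by rewrite enorm_gt0 e_neq0.
have r0 := er_gt0 W.
exists (b * er W / enorm e); first by rewrite divr_gt0// mulr_gt0.
move=> f A u0 Pu H.
have E : b * er W / enorm e * enorm e / er W = b by rewrite divfK ?gt_eqF// mulfK// gt_eqF.
have [] := tilt Pu _ _ H; rewrite ?E//; first by rewrite divr_ge0// mulr_ge0// ltW.
move=> k1 k2; split.
  by apply: (le_trans k1); apply: lee_wpmul2r; rewrite ?hausdorff_ge0// lee_fin.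
by apply: (le_trans k2); apply: lee_wpmul2r; rewrite ?hausdorff_ge0// lee_fin.
Qed.

Lemma JacE u : ((Jac u)%:E * lam (cube 0 1) = hausdorff m (plane u @` cube 0 1))%E.
Proof. by rewrite -hmeas_plane//; exact: cube_borel. Qed.

(** The plane of [v] is a graph with chords almost orthogonal to [u]: the product of such a chord
    with [u] equals its product with [u - v]. *)
Lemma Jac_continuous (ep : R) u : 0 < ep -> Omega C u -> exists2 d : R, 0 < d &
  forall v, Omega C v -> enorm (u - v) < d -> Jac v <= (1 + ep) * Jac u /\ Jac u <= (1 + ep) * Jac v.
Proof.
move=> e0 Ou; have [d d0 H] := eps_angle e0; exists d => // v Ov uv.
have Pu := Omega_pol1 Ou; have Pv := Omega_pol1 Ov.
have hyp x y : cube 0 1 x -> cube 0 1 y ->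
    `|dotv (gam (x - y) (slf v x - slf v y)) u| <= d * enorm (gam (x - y) (slf v x - slf v y)).
  move=> _ _; rewrite -slfB -/(plane v (x - y)).
  rewrite (_ : dotv _ u = dotv (plane v (x - y)) (u - v)); last by rewrite dotvBr plane_orth// subr0.
  by rewrite (le_trans (norm_dotv_le _ _))// mulrC ler_wpM2r// ltW.
have l0 : (0 < lam (cube 0 1))%E by exact: lam_cube_gt0.
have [] := H (slf v) (cube 0 1) u Pu hyp; rewrite -/(plane v) -!JacE !muleA -!EFinM.
by rewrite !lee_pmul2r ?lam_unit_fin// !lee_fin.
Qed.

(** The bounds are uniform up to the boundary of [Omega C], so dividing by [Jac] preserves
    finiteness and non-vanishing of the total mass. *)
Lemma Jac_bounds : exists a b : R, [/\ 0 < a, 0 < b & forall u, pol1 W u -> a <= Jac u <= b].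
Proof.
have r0 := er_gt0 W.
pose K := 1 + (er W)^-1 * enorm e.
have K0 : 0 < K by rewrite ltr_pwDl// mulr_ge0// invr_ge0 ltW.
have Kp0 := Kp_gt0 W.
exists ((Kp W ^+ m)^-1), (K ^+ m); split; rewrite ?invr_gt0 ?exprn_gt0//.
move=> u Pu; have l0 : (0 < lam (cube 0 1))%E by exact: lam_cube_gt0.
have key x y : (x%:E * lam (cube 0 1) <= y%:E * lam (cube 0 1))%E -> x <= y.
  by rewrite lee_pmul2r ?lam_unit_fin// lee_fin.
apply/andP; split; apply: key; rewrite JacE.
  rewrite lee_pdivrMl ?exprn_gt0// lamE -[X in (hausdorff m X <= _)%E]image_id.
  apply: hausdorff_lipschitz => // x y _ _; rewrite -planeB.
  by have := prj_le W (plane u (x - y)); rewrite /plane prj_gam.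
rewrite lamE -[X in (_ <= _ * hausdorff m X)%E]image_id.
apply: hausdorff_lipschitz => // x y _ _; rewrite -planeB /plane (le_trans (gam_le _ _ _))//.
rewrite mulrDl mul1r lerD2l mulrAC ler_wpM2r// /slf normrM normfV normrN mulrC ler_pM ?invr_ge0//.
  by rewrite ltr0_norm ?pol1_e0// lef_pV2 ?posrE ?oppr_gt0 ?pol1_e0//; have := pol1_e Pu; lra.
by rewrite (le_trans (norm_dotv_le _ _))// enorm_iota Pu.1 mulr1.
Qed.

Section Surface.
Variable t : 'rV[R]_m -> R.
Hypothesis gt : good W t.

Definition grm : expanding_map R m n := ExpandingMap (gr_expanding W t).

Lemma grm_sigma_finite : sigma_finite setT (hmeas p grm).
Proof. by apply: (@sigma_finite_lipschitz R p n grm (Kg W)); [exact: Kg_gt0|exact: gr_lip gt.1]. Qed.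

Lemma SthetaE (eta : set (borelRV R n)) : measurable eta -> eta `<=` Omega C ->
  Stheta C Theta (epi W t) eta = (\int[hmeas p grm]_(x in reg W t eta) (Th W t x)%:E)%E.
Proof.
move=> me eO; rewrite -layer_cake; last 4 first.
- exact: grm_sigma_finite.
- exact: reg_borel gt.1 _ me.
- exact: Th_measurable.
- by move=> x _; rewrite ltW// Th_gt0.
rewrite /Stheta /hint nu_preimageE//; apply: eq_integral => s _.
rewrite /hmeas /himage; congr (hausdorff m _).
apply/seteqP; split=> [_ [[x rx <-] sx]|_ [x [rx sx] <-]]; first by exists x.
by split=> //; exists x.
Qed.

Lemma S_measure : exists S : {measure set (borelRV R n) -> \bar R},
  forall eta, measurable eta -> S eta = (\int[hmeas p grm]_(x in reg W t eta) (Th W t x)%:E)%E.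
Proof.
apply: (@integral_measure _ _ _ (borelRV R m) (borelRV R n) (hmeas p grm) (reg W t) (Th W t)).
- exact: (reg_borel gt.1).
- move=> B x [u [Bu xu uniq]]; exists u => // B'; split; last by move=> B'u; exists u.
  by move=> [v [B'v xv _]]; rewrite -(uniq _ xv).
- exact: Th_measurable.
- by move=> x _; rewrite ltW// Th_gt0.
Qed.

(** A chord between two points with normals close to [u] is almost orthogonal to [u]: each
    endpoint's normal supplies one of the two inequalities. *)
Lemma area_local (ep : R) u : 0 < ep -> Omega C u -> exists2 U : set 'rV[R]_n, nbhs u U &
  forall (eta : set (borelRV R n)) (A : set (borelRV R m)), eta `<=` U -> measurable A -> A `<=` reg W t eta ->
   (hmeas p grm A <= (1 + ep)%:E * ((Jac u)%:E * lam A) /\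
    (Jac u)%:E * lam A <= (1 + ep)%:E * hmeas p grm A)%E.
Proof.
move=> e0 Ou; have [d d0 H] := eps_angle e0; have Pu := Omega_pol1 Ou.
exists [set v | enorm (u - v) < d]; first exact: enball_nbhs.
move=> eta A eU mA Ar; rewrite -hmeas_plane//; apply: H => // x y Ax Ay.
rewrite gamB -/(gr W t x) -/(gr W t y).
have hh x1 y1 : A x1 -> A y1 -> dotv (gr W t y1 - gr W t x1) u <= d * enorm (gr W t x1 - gr W t y1).
  move=> /Ar[v [/eU/= uv xv _]] _; have h1 := nrm_gr y1 xv.
  have h2 := dotv_le (gr W t y1 - gr W t x1) (u - v).
  have h3 : enorm (gr W t y1 - gr W t x1) * enorm (u - v) <= d * enorm (gr W t x1 - gr W t y1).
    by rewrite mulrC (enormC (gr W t y1)) ler_wpM2r// ltW.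
  by rewrite dotvBr in h2; lra.
have h1 := hh x y Ax Ay; have h2 := hh y x Ay Ax.
rewrite (enormC (gr W t y)) in h2.
by rewrite ler_norml h2 andbT lerNl -dotvNl opprB.
Qed.

Lemma layer_measurable (mu : {measure set (borelRV R m) -> \bar R}) (A : set (borelRV R m)) : measurable A ->
  measurable_fun (`[0%R, +oo[%classic : set R) (fun s => mu (A `&` [set x | (s < Th W t x)%R])).
Proof.
move=> mA; apply: nonincreasing_emeasurable; first exact: interval_ge0.
move=> s1 s2 _ _ s12; have mT s : measurable (A `&` [set x | (s < Th W t x)%R]).
  rewrite (_ : _ `&` _ = A `&` (fun x => (s < Th W t x)%R) @^-1` [set true])//.
  by apply: measurable_fun_ltr => //; exact: Th_measurable.
by apply: le_measure; rewrite ?inE// => x [Ax /=]; split=> //=; apply: le_lt_trans s12 _.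
Qed.

(** [area_local] applied to each level set of [Theta] and integrated over the level. *)
Lemma S_dens (S T_ : {measure set (borelRV R n) -> \bar R}) :
  (forall eta, measurable eta -> S eta = (\int[hmeas p grm]_(x in reg W t eta) (Th W t x)%:E)%E) ->
  (forall eta, measurable eta -> T_ eta = T W t eta) ->
  dens (Omega C) Jac T_ S.
Proof.
move=> SE TE ep u e0 Ou; have [U nU HU] := area_local e0 Ou.
exists U => // eta me eU.
have mr := reg_borel gt.1 me.
have f0 x : reg W t eta x -> 0 <= Th W t x by move=> _; rewrite ltW// Th_gt0.
have mf : measurable_fun (reg W t eta : set (borelRV R m)) (Th W t) by exact: Th_measurable.
have mT s : measurable (reg W t eta `&` [set x | (s < Th W t x)%R] : set (borelRV R m)).
  rewrite (_ : _ `&` _ = reg W t eta `&` (fun x => (s < Th W t x)%R) @^-1` [set true])//.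
  by apply: measurable_fun_ltr.
rewrite SE// TE// /T -(layer_cake grm_sigma_finite mr mf f0) -(layer_cake (sigma_finite_lam R p) mr mf f0).
have J0 := ltW (Jac_gt0 u); have e1 : 0 <= 1 + ep by rewrite addr_ge0// ltW.
have key s := HU eta _ (fun v h => (eU v h).2) (mT s) (fun x h => h.1).
have mI : measurable (`[0%R, +oo[%classic : set (measurableTypeR R)) by exact: measurable_itv.
have mA := layer_measurable (hmeas p grm) mr.
have mB := layer_measurable lam mr.
split.
  rewrite -ge0_integralZl_EFin//; try by move=> *; exact: measure_ge0.
  rewrite -ge0_integralZl_EFin//; last 2 first.
  - by move=> s _; rewrite mule_ge0 ?lee_fin ?measure_ge0.
  - exact: measurable_funeM.
  apply: ge0_le_integral => //.
  - by apply: measurable_funeM; exact: measurable_funeM.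
  - by move=> s _; have [] := key s.
rewrite -ge0_integralZl_EFin//; try by move=> *; exact: measure_ge0.
rewrite -ge0_integralZl_EFin//; try by move=> *; exact: measure_ge0.
apply: ge0_le_integral => //.
- by move=> s _; rewrite mule_ge0 ?lee_fin ?measure_ge0.
- exact: measurable_funeM.
- exact: measurable_funeM.
- by move=> s _; have [] := key s.
Qed.

End Surface.

(* [nu] is [mu] divided by the ratio [Jac] of surface area to projected area. *)
Lemma projected_measure (mu : {measure set (borelRV R n) -> \bar R}) :
  (mu (Omega C) < +oo)%E -> mu (Omega C) != 0%E ->
  exists nu : {measure set (borelRV R n) -> \bar R}, [/\ (nu (Omega C) < +oo)%E, nu (Omega C) != 0%E &
    forall t, good W t ->
      (forall eta : set (borelRV R n), measurable eta -> eta `<=` Omega C ->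
         Stheta C Theta (epi W t) eta = mu eta) <->
      (forall eta : set (borelRV R n), measurable eta -> eta `<=` Omega C -> T W t eta = nu eta)].
Proof.
move=> mufin mu0.
have mO : measurable (Omega C : set (borelRV R n)) by exact: Omega_borel.
have J0 u (_ : Omega C u) := Jac_gt0 u.
have [nu dnu [mJ nuE]] := dens_integral mO J0 mu Jac_continuous.
have [a [b [a0 b0 Hab]]] := Jac_bounds.
exists nu; split.
- rewrite nuE//; apply: (@le_lt_trans _ _ (\int[mu]_(u in (Omega C : set (borelRV R n))) (a^-1)%:E)%E).
    apply: le_int => //; first by move=> u _; rewrite invr_ge0 ltW// Jac_gt0.
    by move=> u /Omega_pol1/Hab/andP[h _]; rewrite lef_pV2 ?posrE// Jac_gt0.
  by rewrite int_cst// lte_mul_pinfty// lee_fin invr_ge0 ltW.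
- rewrite gt_eqF// nuE//; apply: (@lt_le_trans _ _ (\int[mu]_(u in (Omega C : set (borelRV R n))) (b^-1)%:E)%E).
    by rewrite int_cst// mule_gt0 ?lte_fin ?invr_gt0// lt_neqAle eq_sym mu0 measure_ge0.
  apply: le_int => //; first by move=> u _; rewrite invr_ge0 ltW.
  by move=> u /Omega_pol1/Hab/andP[_ h]; rewrite lef_pV2 ?posrE// Jac_gt0.
move=> t gt.
have [S SE] := S_measure gt; have [T_ TE] := T_measure gt.
have dS := S_dens gt SE TE.
split=> H eta me eO.
  rewrite -TE//; apply: (dens_eqr mO J0 dS dnu) => // B mB BO.
  by rewrite SE// -SthetaE// H.
rewrite SthetaE// -SE//; apply: (dens_eql mO dS dnu) => // B mB BO.
by rewrite TE// H.
Qed.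

End AreaDensity.

(** * Pseudo-cones and dilation *)

Section CompactScale.
Context (R : realType) (k : nat).

(** A tube lemma at scale 0: thresholds for [d] that are locally uniform become uniform on [K]. *)
Lemma compact_scale (K : set 'rV[R]_k.+1) (P : R -> 'rV[R]_k.+1 -> Prop) : compact K ->
  (forall x, K x -> exists2 r, 0 < r & forall y d, K y -> enorm (x - y) < r -> 0 < d -> d < r -> P d y) ->
  exists2 r, 0 < r & forall y d, K y -> 0 < d -> d < r -> P d y.
Proof.
move=> cK H; have /near_covering_withinP/(_ _ (nbhs (0 : R)) (fun d y => 0 < d -> P d y)) :=
  (compact_near_coveringP K).1 cK.
case=> [x Kx|r /= r0 Hr].
  have [r r0 Hr] := H x Kx.
  exists ([set y | enorm (x - y) < r], [set d : R | `|0 - d| < r]).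
    split; first exact: enball_nbhs.
    by apply/nbhs_ballP; exists r.
  move=> [y d] [/= xy dr] Ky d0; apply: Hr => //.
  by move: dr; rewrite sub0r normrN gtr0_norm.
exists r => // y d Ky d0 dr; apply: Hr => //.
by rewrite /ball/= sub0r normrN gtr0_norm.
Qed.

Lemma closed_enorm (A : set 'rV[R]_k.+1) y : closed A ->
  (forall r, 0 < r -> exists2 z, A z & enorm (y - z) < r) -> A y.
Proof.
move=> cA H; apply: cA => B /nbhs_enball[r r0 HB].
by have [z Az yz] := H r r0; exists z; split=> //; apply: HB.
Qed.

End CompactScale.

Section PseudoCones.
Context (R : realType) (p : nat) (W : wcone R p).
Local Notation m := p.+1.
Local Notation n := p.+2.
Local Notation C := (wC W).
Local Notation e := (we W).
Local Notation q := (wq W).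
Local Notation Theta := (wT W).
Local Notation lam := (lam R p).
Local Notation gam := (gam W).

Lemma compact_Omega F : compact F -> F `<=` Omega C -> exists2 c, 0 < c & F `<=` Om W c.
Proof.
move=> cF FO; have [|r r0 Hr] := @compact_scale _ _ F (Om W) cF.
  move=> x Fx; have [c c0 Hc] := Omega_Om (FO _ Fx).
  have c2 : 0 < c / 2 by rewrite divr_gt0.
  have cc : c / 2 < c by rewrite ltr_pdivrMr// ltr_pMr// ltr1n.
  have [U nU HU] := Om_nbhs c0 cc Hc; have [s s0 Hs] := nbhs_enball nU.
  exists (Num.min (c / 2) s); first by rewrite lt_min c2.
  move=> y d Fy; rewrite !lt_min => /andP[_ xy] d0 /andP[dc _].
  by apply: Om_anti (ltW dc) _; apply: HU; split; [exact: Hs|exact: (FO _ Fy).1].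
exists (r / 2); first by rewrite divr_gt0.
by move=> y Fy; apply: Hr; rewrite ?divr_gt0// ltr_pdivrMr// ltr_pMr// ltr1n.
Qed.

Lemma good_pseudo_cone t : good W t -> pseudo_cone C (epi W t).
Proof.
move=> gt; have ta := gt.1; split; first split.
- by exists (gr W t 0); exact: epi_gr.
- exact: epi_closed.
- exact: epi_convex.
- by move=> /(epi_neq0 gt); rewrite eqxx.
- move=> X l eX l1; rewrite -[l](subrK 1) scalerDl scale1r addrC.
  by apply: epiD => //; apply: CZ; [exact: epi_sub ta _ eX|rewrite subr_ge0].
apply/seteqP; split=> [y ry|y Cy x l ex l0]; last by apply: epiD => //; exact: CZ.
apply: closed_enorm; first exact: wC_closed.
move=> r r0; set x := gr W t 0.
(* For [y] in the recession cone, [x + s *: y] lies in [C] for every [s >= 0]; divided by this [s]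
   it is within [r] of [y]. *)
have s0 : 0 < enorm x / r + 1 by rewrite ltr_wpDl// divr_ge0// ltW.
have h := epi_sub ta (ry x (enorm x / r + 1) (epi_gr W t 0) (ltW s0)).
exists ((enorm x / r + 1)^-1 *: (x + (enorm x / r + 1) *: y)).
  by apply: CZ => //; rewrite invr_ge0 ltW.
rewrite scalerDr scalerA mulVf ?gt_eqF// scale1r opprD [- _ - y]addrC addNKr enormN enormZ.
by rewrite gtr0_norm ?invr_gt0// ltr_pdivrMl// mulrDl divfK ?gt_eqF// mul1r ltrDl.
Qed.

Lemma pseudo_cone_epi K : pseudo_cone C K -> exists2 t, good W t & K = epi W t.
Proof.
move=> [[[X0 KX0] cK vK K0 HK] rK].
have KD X Z : K X -> C Z -> K (X + Z).
  by move=> KX; rewrite -rK => /(_ X 1 KX ler01); rewrite scale1r.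
have KC : K `<=` C.
  move=> X KX; rewrite -rK => x l Kx l0.
  apply: closed_enorm cK _ => r r0.
  (* The convex combination of [x] and [s *: X] with weight [l / s] lies in [K] and tends to
     [x + l *: X] as [s] grows; this [s] brings it within [r]. So [X] is in the recession cone,
     which is [C]. *)
  pose s := l + 1 + enorm x * (l + 1) / r.
  have sp : 0 <= enorm x * (l + 1) / r by rewrite divr_ge0 ?(ltW r0)// mulr_ge0// addr_ge0.
  have s1 : 1 <= s by rewrite /s; lra.
  have s0 : 0 < s by lra.
  have ls : l / s <= 1 by rewrite ler_pdivrMr// mul1r /s; lra.
  exists ((1 - l / s) *: x + (l / s) *: (s *: X)).
    by apply: vK => //; [exact: HK|rewrite divr_ge0// ltW].
  rewrite scalerA divfK ?gt_eqF// scalerBl scale1r opprD addrACA subrr addr0 opprB addrCA subrr addr0.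
  rewrite enormZ ger0_norm ?divr_ge0 ?(ltW s0)// mulrAC ltr_pdivrMr//.
  rewrite /s mulrDr mulrCA divff ?gt_eqF// mulr1.
  have := enorm_ge0 x; have := mulr_gt0 r0 (ltr_wpDl l0 ltr01).
  by rewrite mulrDr mulr1; lra.
pose S x := [set s | K (gam x s)].
have SU x s t : S x s -> s <= t -> S x t.
  move=> Ss st; rewrite /S/=; have -> : gam x t = gam x s + gam 0 (t - s) by rewrite -gamD addr0 addrC subrK.
  by apply: KD => //; rewrite gam_e; apply: CZ; [exact: Ce|rewrite subr_ge0].
have SC x s : S x s -> tC W x <= s by move=> /KC/C_gamP.
have S0 x : S x !=set0.
  exists (ht W X0 + kap W * enorm (x - prj W X0)); rewrite /S/=.
  have -> : gam x (ht W X0 + kap W * enorm (x - prj W X0)) = X0 + gam (x - prj W X0) (kap W * enorm (x - prj W X0)).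
    by rewrite -{3}(gamK W X0) -gamD [prj _ _ + _]addrC subrK.
  by apply: KD => //; rewrite gamE; apply: C_kap; rewrite enorm_iota.
have Sl x : has_lbound (S x) by exists (tC W x) => s /SC.
pose t x := inf (S x).
have KP x s : K (gam x s) <-> t x <= s.
  split=> [Ks|ts]; first by apply: ge_inf.
  apply: closed_enorm cK _ => r r0.
  have en0 : 0 < enorm e by rewrite enorm_gt0 e_neq0.
  have d0 : 0 < r / enorm e by rewrite divr_gt0.
  have [s1 Ks1 s1t] := inf_adherent d0 (conj (S0 x) (Sl x)).
  exists (gam x (Num.max s1 s)); first by apply: (SU x s1) => //; rewrite le_max lexx.
  rewrite -gamB subrr gam_e enormZ -ltr_pdivlMr//.
  rewrite distrC ger0_norm ?subr_ge0 ?le_max ?lexx ?orbT// ltrBlDl gt_max.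
  by rewrite ltrDl d0 andbT (lt_le_trans s1t)// lerD2r.
have Kgr x : K (gam x (t x)) by apply/KP.
have ta : adm W t.
  split.
  - by move=> x; exact: SC (Kgr x).
  - by move=> x Z CZ'; apply/KP; rewrite gamD gamK; exact: KD.
  - by move=> x y l l0 l1; apply/KP; rewrite gamD !gamZ; apply: vK.
exists t; last first.
  by apply/seteqP; split=> X; rewrite -{1}(gamK W X); [move/KP|move/epi_gam => h; rewrite -(gamK W X); apply/KP].
split=> //; rewrite lt_neqAle (adm_ge0 ta) andbT; apply/eqP => t0; apply: K0.
by have := Kgr 0; rewrite -t0 gam0.
Qed.

Definition tscale (l : R) (t : 'rV[R]_m -> R) x : R := l * t (l^-1 *: x).

Lemma epi_tscale l t X : 0 < l -> epi W (tscale l t) X <-> epi W t (l^-1 *: X).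
Proof.
by move=> l0; rewrite /epi/= /tscale prjZ htZ -ler_pdivlMl.
Qed.

Lemma gr_tscale l t x : 0 < l -> gr W (tscale l t) (l *: x) = l *: gr W t x.
Proof. by move=> l0; rewrite /gr /tscale scalerA mulVf ?gt_eqF// scale1r gamZ. Qed.

Lemma tscale_good l t : 0 < l -> good W t -> good W (tscale l t).
Proof.
move=> l0 [[h1 h2 h3] t0]; have li : 0 < l^-1 by rewrite invr_gt0.
split; last by rewrite /tscale scaler0 mulr_gt0.
split.
- move=> x; rewrite /tscale -ler_pdivrMl// -tCZ//; exact: h1.
- move=> x Z CZ'; rewrite /tscale -ler_pdivlMl// scalerDr -prjZ (le_trans (h2 _ _ _))//.
    by apply: CZ => //; exact: ltW.
  by rewrite htZ mulrDr mulKf// gt_eqF.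
- move=> x y a a0 a1; rewrite /tscale -ler_pdivlMl// scalerDr !scalerA ![l^-1 * _]mulrC -!scalerA.
  rewrite (le_trans (h3 _ _ _ a0 a1))// le_eqVlt; apply/orP; left; apply/eqP.
  by field; rewrite gt_eqF.
Qed.

(** A point [X] of the larger dilate satisfies [X / l = X / l' + (1 / l - 1 / l') X], and the last
    term is in [C]. *)
Lemma tscale_le l l' t x : good W t -> 0 < l -> l <= l' -> tscale l t x <= tscale l' t x.
Proof.
move=> gt l0 ll; have l'0 := lt_le_trans l0 ll.
have : epi W (tscale l' t) (gr W (tscale l' t) x) by exact: epi_gr.
move=> /(epi_tscale _ _ l'0) h; apply/(epi_gam W); apply/(epi_tscale _ _ l0); rewrite -/(gr W (tscale l' t) x).
have -> : l^-1 *: gr W (tscale l' t) x =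
    l'^-1 *: gr W (tscale l' t) x + (l^-1 - l'^-1) *: gr W (tscale l' t) x.
  by rewrite -scalerDl addrC subrK.
apply: epiD h _; first exact: gt.1.
apply: CZ; first exact: gr_C (tscale_good l'0 gt).1 _.
by rewrite subr_ge0 lef_pV2.
Qed.

Lemma tscale_lip l l' t x : good W t -> 1 <= l -> l <= l' ->
  tscale l' t x - tscale l t x <= (l' - l) * (t 0 + 2 * kap W * enorm x).
Proof.
move=> gt l1 ll; have l0 : 0 < l := lt_le_trans ltr01 l1; have l'0 := lt_le_trans l0 ll.
have k0 := kap_gt0 W; have ex := enorm_ge0 x.
have h1 : t (l'^-1 *: x) <= t 0 + kap W * enorm x.
  have := adm_lip1 gt.1 (l'^-1 *: x) 0; rewrite subr0 enormZ gtr0_norm ?invr_gt0//.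
  have : kap W * (l'^-1 * enorm x) <= kap W * enorm x.
    by rewrite ler_wpM2l ?(ltW k0)// ler_piMl// invf_le1// (le_trans l1 ll).
  lra.
have h2 : l * (t (l'^-1 *: x) - t (l^-1 *: x)) <= (l' - l) * (kap W * enorm x).
  have := adm_lip1 gt.1 (l'^-1 *: x) (l^-1 *: x); rewrite -scalerBl enormZ.
  have -> : `|l'^-1 - l^-1| = (l' - l) / (l * l').
    rewrite distrC ger0_norm ?subr_ge0 ?lef_pV2//; field; rewrite !gt_eqF//.
  move=> h; apply: (@le_trans _ _ (l * (kap W * ((l' - l) / (l * l') * enorm x)))).
    by rewrite ler_pM2l//; lra.
  rewrite [X in X <= _](_ : _ = (l' - l) * (kap W * enorm x) * l'^-1); last first.
    by field; rewrite !gt_eqF.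
  rewrite ler_piMr ?mulr_ge0 ?subr_ge0// ?(ltW k0)// invf_le1//; exact: le_trans l1 ll.
have h3 : (l' - l) * t (l'^-1 *: x) <= (l' - l) * (t 0 + kap W * enorm x).
  by rewrite ler_wpM2l ?subr_ge0.
rewrite /tscale; move: h2 h3; set a := t _; set b := t _; lra.
Qed.

Lemma nrm_tscale l t x u : 0 < l -> nrm W (tscale l t) (l *: x) u <-> nrm W t x u.
Proof.
move=> l0; rewrite /nrm gr_tscale//; split=> -[u1 H]; split=> // Y eY.
  have := H (l *: Y); rewrite -scalerBr dotvZl pmulr_rle0//; apply.
  by apply/(epi_tscale _ _ l0); rewrite scalerA mulVf ?gt_eqF// scale1r.
have := H (l^-1 *: Y) ((epi_tscale _ _ l0).1 eY).
rewrite -(@pmulr_rle0 _ l)// -dotvZl scalerBr scalerA divff ?gt_eqF// scale1r.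
by [].
Qed.

Lemma reg_tscale l t eta : 0 < l -> reg W (tscale l t) eta = (fun x => 0 + l *: x) @` reg W t eta.
Proof.
move=> l0; apply/seteqP; split=> [x [u [eu xu uniq]]|_ [x [u [eu xu uniq]] <-]].
  have xE : x = l *: (l^-1 *: x) by rewrite scalerA divff ?gt_eqF// scale1r.
  rewrite xE in xu uniq.
  exists (l^-1 *: x); last by rewrite add0r -xE.
  exists u; split=> //; first exact/(nrm_tscale _ _ _ l0).
  by move=> v /(nrm_tscale _ _ _ l0)/uniq.
rewrite add0r; exists u; split=> //; first exact/nrm_tscale.
by move=> v /(nrm_tscale _ _ _ l0)/uniq.
Qed.

(** Dilating the base contributes the power [m], and homogeneity of [Theta] the power [- q]; the
    normals are unchanged. *)
Lemma T_tscale l t (eta : set (borelRV R n)) : good W t -> 0 < l -> measurable eta ->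
  T W (tscale l t) eta = ((l `^ (m%:R - q))%:E * T W t eta)%E.
Proof.
move=> gt l0 me; have gl := tscale_good l0 gt.
have mr := reg_borel gt.1 me; have mrl := reg_borel gl.1 me.
have sf := sigma_finite_lam R p.
have lq : 0 < l `^ (- q) by rewrite powR_gt0.
have thE x : Th W (tscale l t) (l *: x) = l `^ (- q) * Th W t x.
  by rewrite /Th gr_tscale// wT_hom//; [exact: gr_C gt.1 x|exact: gr_neq0].
have f0 x : reg W t eta x -> 0 <= l `^ (- q) * Th W t x.
  by move=> _; rewrite mulr_ge0 ?(ltW lq)// ltW// Th_gt0.
have mf : measurable_fun (reg W t eta : set (borelRV R m)) (fun x => l `^ (- q) * Th W t x).
  by apply: measurable_funM; [exact: measurable_cst|exact: Th_measurable].
rewrite /T -(layer_cake sf mrl); last 2 first.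
- exact: Th_measurable.
- by move=> x _; rewrite ltW// Th_gt0.
transitivity ((l ^+ m)%:E * \int[lam]_(x in reg W t eta) (l `^ (- q) * Th W t x)%:E)%E.
  rewrite -(layer_cake sf mr mf f0) -ge0_integralZl_EFin//; last 2 first.
  - apply: nonincreasing_emeasurable; first exact: interval_ge0.
    move=> s1 s2 _ _ s12; have mT s : measurable (reg W t eta `&` [set x | (s < l `^ (- q) * Th W t x)%R] : set (borelRV R m)).
      rewrite (_ : _ `&` _ = reg W t eta `&` (fun x => (s < l `^ (- q) * Th W t x)%R) @^-1` [set true])//.
      by apply: measurable_fun_ltr.
    by apply: le_measure; rewrite ?inE// => x [Ax /=]; split=> //=; apply: le_lt_trans s12 _.
  - by rewrite exprn_ge0// ltW.
  apply: eq_integral => s _; rewrite -(@lam_affine _ _ _ 0)// reg_tscale//; congr (lam _).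
  apply/seteqP; split=> [_ [[x rx <-]] /=|_ [x [rx /=] sx <-]].
    by rewrite add0r thE => sx; exists x => //; rewrite add0r.
  by split; [exists x|rewrite /= add0r thE].
rewrite (_ : (\int[lam]_(x in _) _)%E = ((l `^ (- q))%:E * \int[lam]_(x in reg W t eta) (Th W t x)%:E)%E).
  by rewrite muleA -EFinM powR_split.
rewrite -ge0_integralZl_EFin ?(ltW lq)//; first by move=> x _; rewrite lee_fin ltW// Th_gt0.
exact: ETh_measurable.
Qed.

Lemma Theta_unif (r0 r1 ep : R) : 0 < r0 -> 0 < ep -> exists2 d, 0 < d &
  forall X Y, C X -> C Y -> X != 0 -> r0 <= enorm Y -> enorm Y <= r1 -> enorm (X - Y) < d -> Theta X <= (1 + ep) * Theta Y.
Proof.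
move=> r00 e0.
pose K : set 'rV[R]_n := C `&` [set Y | r0 <= enorm Y] `&` [set Y | enorm Y <= r1].
have cK : compact K.
  apply: (@compact_enorm_le _ _ r1); last by move=> x [].
  apply: closedI; last by apply: closed_continuous_le; [exact: enorm_continuous|exact: cst_continuous].
  apply: closedI; first exact: wC_closed.
  by apply: closed_continuous_le; [exact: cst_continuous|exact: enorm_continuous].
pose P d Y := forall X, C X -> X != 0 -> enorm (X - Y) < d -> Theta X <= (1 + ep) * Theta Y.
have [|d d0 Hd] := @compact_scale _ _ K P cK.
  move=> Y0 [[CY0 rY0] _].
  have Y00 : Y0 != 0 by rewrite -enorm_gt0 (lt_le_trans r00).
  have T0 := wT_pos CY0 Y00.
  (* Solves [(1 + ep) * (1 - ep') = 1 + ep']: both values of [Theta] are within a relative error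
     [ep'] of the one at [Y0]. *)
  pose ep' := ep / (2 + ep).
  have e'0 : 0 < ep' by rewrite divr_gt0// addr_gt0.
  have [s s0 Hs] : exists2 s, 0 < s & forall X, C X -> X != 0 -> enorm (Y0 - X) < s -> `|Theta Y0 - Theta X| < ep' * Theta Y0.
    have /subspace_continuousP/(_ Y0) := @wT_cont _ _ W.
    have AY0 : (C `\ 0) Y0 by split=> //; exact/eqP.
    move=> /(_ AY0)/cvgrPdist_lt/(_ _ (mulr_gt0 e'0 T0))/nbhs_enball[s s0 Hs].
    by exists s => // X CX X0 XY; apply: Hs => //; split=> //; exact/eqP.
  exists (s / 2); first by rewrite divr_gt0.
  have ss : s / 2 + s / 2 = s by rewrite -splitr.
  move=> Y d [[CY rY] _] YY d0 ds X CX X0 XY.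
  have Yn : Y != 0 by rewrite -enorm_gt0 (lt_le_trans r00).
  have h1 : `|Theta Y0 - Theta Y| < ep' * Theta Y0 by apply: Hs => //; lra.
  have h2 : `|Theta Y0 - Theta X| < ep' * Theta Y0.
    apply: Hs => //; rewrite (le_lt_trans (enormB_le Y0 Y X))// (enormC Y X); lra.
  move: h1 h2; rewrite !ltr_norml => /andP[_ h1] /andP[h2 _].
  have h3 : (1 + ep) * (1 - ep') = 1 + ep' by rewrite /ep'; field; rewrite gt_eqF// addr_gt0.
  have h4 : (1 + ep) * ((1 - ep') * Theta Y0) <= (1 + ep) * Theta Y.
    by rewrite ler_pM2l ?addr_gt0//; lra.
  by move: h4; rewrite mulrA h3; lra.
exists (d / 2); first by rewrite divr_gt0.
move=> X Y CX CY X0 Y0 Y1 XY; apply: (Hd Y (d / 2)) => //; first by rewrite divr_gt0.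
by rewrite ltr_pdivrMr// ltr_pMr// ltr1n.
Qed.

End PseudoCones.

(** * Uniqueness *)

Section Uniqueness.
Context (R : realType) (p : nat) (W : wcone R p).
Local Notation m := p.+1.
Local Notation n := p.+2.
Local Notation C := (wC W).
Local Notation e := (we W).
Local Notation q := (wq W).
Local Notation Theta := (wT W).
Local Notation lam := (lam R p).
Local Notation gam := (gam W).

Variables (t s : 'rV[R]_m -> R) (F : set 'rV[R]_n).
Hypothesis gt : good W t.
Hypothesis gs : good W s.
Hypothesis cF : compact F.
Hypothesis FO : F `<=` Omega C.
(** The form in which being [C]-determined by [F] is used: a point of [C] below the graph is cut off
    by a half-space with normal in [F]. *)
Hypothesis determined : forall x r, tC W x <= r -> r < t x ->
  exists2 u, F u & forall Y, epi W t Y -> dotv Y u < dotv (gam x r) u.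

(** The cutting direction [u] lies in some fixed [Om W c]; comparing the point with the graph point
    [t 0 *: e] bounds its norm. *)
Lemma gap_bounded : exists2 r1, 0 < r1 & forall x r, tC W x <= r -> r < t x -> enorm (gam x r) <= r1.
Proof.
have [c c0 Hc] := compact_Omega cF FO.
exists (t 0 * enorm e / c); first by rewrite divr_gt0// mulr_gt0 ?gt.2// enorm_gt0 e_neq0.
move=> x r Cx rt; have [u Fu Hu] := determined Cx rt.
have [u1 Ku] := Hc _ Fu.
have := Hu _ (epi_gr W t 0); rewrite /gr gam_e dotvZl => h1.
have h2 := Ku _ ((C_gamP W x r).2 Cx).
have h3 : - enorm e <= dotv e u by have := norm_dotv_le e u; rewrite u1 mulr1 ler_norml => /andP[].
have h4 : t 0 * - enorm e <= t 0 * dotv e u by rewrite ler_pM2l ?gt.2.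
by rewrite ler_pdivlMr// mulrC; lra.
Qed.

(** Otherwise every [u] in [F] would fail at the graph point by a positive margin; by compactness
    all of them would still fail at a point slightly below, which [determined] cuts off. *)
Lemma gap_normal x : tC W x < t x -> exists2 u, F u & nrm W t x u.
Proof.
move=> Ct; apply: contrapT => nF.
pose P (d : R) u := exists2 Y, epi W t Y & dotv (gam x (t x - d)) u < dotv Y u.
have [|r r0 Hr] := @compact_scale _ _ F P cF.
  move=> u Fu; have Pu := Omega_pol1 (FO Fu).
  have [y Hy] : exists y, 0 < dotv (gr W t y - gr W t x) u.
    apply: contrapT => Hn; apply: nF; exists u => //; apply: nrmP => //.
    by move=> y; rewrite leNgt; apply/negP => hy; apply: Hn; exists y.
  set A := gr W t y - gr W t x in Hy; set a := dotv A u in Hy.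
  (* The margin [a] has to absorb both the change of direction, weighted by [enorm A], and the drop,
     weighted by [enorm e]; the [+ 1] keeps the inequality strict. *)
  have D0 : 0 < enorm A + enorm e + 1 by rewrite ltr_wpDl// addr_ge0.
  have a0 : 0 < a / (enorm A + enorm e + 1) by rewrite divr_gt0.
  exists (a / (enorm A + enorm e + 1)) => //.
  move=> v d Fv uv d0 da; exists (gr W t y); first exact: epi_gr.
  have -> : gam x (t x - d) = gr W t x - d *: e by rewrite /gr -gam_e -gamB subr0.
  have v1 : enorm v = 1 := (FO Fv).1.
  rewrite -subr_gt0 -dotvBl opprB addrA -/A addrAC.
  rewrite [A + _]addrC dotvDl dotvZl.
  have h1 : - enorm e <= dotv e v by have := norm_dotv_le e v; rewrite v1 mulr1 ler_norml => /andP[].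
  have h2 : d * - enorm e <= d * dotv e v by rewrite ler_pM2l.
  have h3 := dotv_le A (u - v); rewrite dotvBr -/a in h3.
  have h4 : enorm A * enorm (u - v) <= enorm A * (a / (enorm A + enorm e + 1)) by rewrite ler_wpM2l// ltW.
  have h5 : enorm e * d <= enorm e * (a / (enorm A + enorm e + 1)) by rewrite ler_wpM2l// ltW.
  have h6 : (enorm A + enorm e + 1) * (a / (enorm A + enorm e + 1)) = a by rewrite mulrC divfK// gt_eqF.
  move: h4 h5 h6 a0; set b := a / _; rewrite !mulrDl mul1r; lra.
pose d := Num.min (r / 2) (t x - tC W x).
have d0 : 0 < d by rewrite lt_min divr_gt0// subr_gt0.
have dr : d < r by rewrite gt_min ltr_pdivrMr// ltr_pMr// ltr1n.
have dC : d <= t x - tC W x by rewrite ge_min lexx orbT.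
have [||u Fu Hu] := @determined x (t x - d); [lra|lra|].
by have [Y eY] := Hr u d Fu d0 dr; rewrite ltNge (ltW (Hu _ eY)).
Qed.

(* The u with h(t, u) < h(M, u), where h(f, .) is the support function of epi f. *)
Definition support_lt (M : 'rV[R]_m -> R) : set 'rV[R]_n :=
  Omega C `&` \bigcup_(r in [set: rat])
    ([set u | exists2 Y, epi W M Y & ratr r < dotv Y u] `&` [set u | forall Y, epi W t Y -> dotv Y u <= ratr r]).

Lemma support_lt_borel M : measurable (support_lt M : set (borelRV R n)).
Proof.
apply: measurableI; first exact: Omega_borel.
apply: (@countable_bigcupT_measurable _ (borelRV R n)) => [|r]; first exact: countableP.
apply: measurableI.
  apply: open_borel; rewrite (_ : [set u | _] = \bigcup_(Y in epi W M) [set u | ratr r < dotv Y u]).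
    by apply: bigcup_open => Y _; apply: open_continuous_lt; [exact: cst_continuous|exact: dotv_continuousr].
  by apply/seteqP; split=> u [Y]; exists Y.
apply: closed_borel; rewrite (_ : [set u | _] = \bigcap_(Y in epi W t) [set u | dotv Y u <= ratr r]).
  apply: closed_bigI => Y _; apply: closed_continuous_le; [exact: dotv_continuousr|exact: cst_continuous].
by apply/seteqP; split.
Qed.

(** A normal attains the support value at its point; were that point in [epi W t], the support value
    of [M] could not exceed that of [t]. *)
Lemma reg_support_lt M : good W M -> reg W M (support_lt M) `<=` [set x | M x < t x].
Proof.
move=> gM x [u [[_ [r _ [[Y eY rY] Hr]]] xu _]]; rewrite /= ltNge; apply/negP => tM.
have h1 := xu.2 _ eY; rewrite dotvBl in h1.
have h2 : dotv (gr W M x) u <= ratr r by apply: Hr; exact/epi_gam.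
lra.
Qed.

(** Such a point is above the boundary of [C], so [gap_normal] gives it a normal; the graph of [M]
    passes below it, which in a direction with [dotv e u < 0] raises the support value. *)
Lemma support_lt_reg M : good W M -> [set x | M x < t x] `\` Mult W t `<=` reg W t (support_lt M).
Proof.
move=> gM x [/= Mt nM].
have [u Fu xu] := gap_normal (le_lt_trans (let: And3 h _ _ := gM.1 in h x) Mt).
exists u; split=> //; last first.
  by move=> v xv; apply: contrapT => vu; apply: nM; exists v, u.
have Pu := Omega_pol1 (FO Fu).
split; first exact: FO.
have h : dotv (gr W t x) u < dotv (gr W M x) u.
  rewrite -subr_gt0 -dotvBl /gr -gamB subrr gam_e dotvZl nmulr_lgt0 ?pol1_e0// subr_lt0.
  exact: Mt.
have [r] := rat_in_itvoo h; rewrite in_itv/= => /andP[r1 r2].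
exists r => //; split; first by exists (gr W M x) => //; exact: epi_gr.
by move=> Y eY; have := xu.2 _ eY; rewrite dotvBl; lra.
Qed.

Hypothesis TE : forall eta : set (borelRV R n), measurable eta -> eta `<=` Omega C -> T W t eta = T W s eta.
Hypothesis Tfin : (T W s (Omega C) < +oo)%E.

(* Shrink the dilates l * L until they barely fail to lie in K: comparing areas over the small exceptional set contradicts
   the homogeneity of T of positive degree m - q. *)
Lemma epi_unique_le x : t x <= s x.
Proof.
rewrite leNgt; apply/negP; move: x => x0 sx0.
have [r1 r10 Hr1] := gap_bounded.
have Kp0 := Kp_gt0 W; have k0 := kap_gt0 W; have K10 := K1_gt0 W.
have t0 := gt.2; have s0 := gs.2; have en0 := enorm_ge0 e.
pose b := Kp W * r1; have b0 : 0 < b by rewrite mulr_gt0.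
have key l x : 0 < l -> tscale l s x < t x ->
    enorm (gr W (tscale l s) x) <= r1 /\ enorm x <= b.
  move=> l0 lt; have ta := (tscale_good l0 gs).1.
  have h := Hr1 _ _ (let: And3 h _ _ := ta in h x) lt; split=> //.
  have := prj_le W (gr W (tscale l s) x); rewrite /gr prj_gam => /le_trans; apply.
  by rewrite /b ler_pM2l.
have ts1 : tscale 1 s = s by apply/funext => x; rewrite /tscale invr1 scale1r mul1r.
pose S := [set l : R | 1 <= l /\ forall x, t x <= tscale l s x].
have S0 : S !=set0.
  have r20 : 0 <= K1 W * r1 / s 0 by rewrite divr_ge0 ?(ltW s0)// mulr_ge0// ltW.
  exists (1 + K1 W * r1 / s 0); split; first by rewrite lerDl.
  move=> x; rewrite leNgt; apply/negP => h.
  have l0 : 0 < 1 + K1 W * r1 / s 0 by rewrite ltr_pwDl.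
  have [h1 _] := key _ _ l0 h.
  have := epi_far (tscale_good l0 gs).1 (epi_gr W _ x).
  rewrite {1}/tscale scaler0 mulrDl mul1r divfK ?gt_eqF//.
  have h2 : K1 W * enorm (gr W (tscale (1 + K1 W * r1 / s 0) s) x) <= K1 W * r1 by rewrite ler_pM2l.
  lra.
pose D (x : 'rV[R]_m) := s 0 + 2 * kap W * enorm x.
have D0 x : 0 < D x by rewrite ltr_pwDl// !mulr_ge0// ltW.
(* Fixed once, with the dilate by [l2] still below [t] at [x0]. Every dilation factor used later is
   at least [l2], so the growth of area stays above [1 + ep] with [ep] chosen before any closeness
   is required. *)
pose l2 := 1 + (t x0 - s x0) / (2 * D x0).
have l21 : 1 < l2 by rewrite ltrDl divr_gt0 ?subr_gt0// mulr_gt0.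
have l2s : tscale l2 s x0 < t x0.
  have := tscale_lip x0 gs (lexx 1) (ltW l21); rewrite ts1 -/(D x0).
  have -> : (l2 - 1) * D x0 = (t x0 - s x0) / 2 by rewrite /l2; field; rewrite gt_eqF.
  lra.
have mq : 0 < m%:R - q by rewrite subr_gt0 wq1.
have l20 : 0 < l2 := lt_trans ltr01 l21.
have L2 : 1 < l2 `^ (m%:R - q).
  by have := @gt0_ltr_powR _ _ mq 1 l2; rewrite powR1 !nnegrE ler01 (ltW l20); apply.
pose ep := (l2 `^ (m%:R - q) - 1) / 2.
have ep0 : 0 < ep by rewrite divr_gt0// subr_gt0.
have epL : 1 + ep < l2 `^ (m%:R - q) by rewrite /ep; lra.
pose r2 := b + (t 0 + kap W * b) * enorm e.
have grb x : enorm x <= b -> enorm (gr W t x) <= r2.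
  move=> xb; rewrite (le_trans (gam_le _ _ _))// lerD// ler_wpM2r//.
  have := adm_lip gt.1 x 0; rewrite subr0 ler_norml.
  have : kap W * enorm x <= kap W * b by rewrite ler_pM2l.
  by rewrite ler_norml; lra.
have far Y : epi W t Y -> t 0 / K1 W <= enorm Y.
  by move=> /(epi_far gt.1) h; rewrite ler_pdivrMr// mulrC.
have [d d0 Hd] := Theta_unif W r2 (divr_gt0 t0 K10) ep0.
pose Db := s 0 + 2 * kap W * b.
have Db0 : 0 < Db by rewrite ltr_pwDl// !mulr_ge0// ltW.
(* Factors closer than [dl] move the graph over the bounded set in question by less than [d], the
   distance required for the comparison of [Theta]. *)
pose dl := d / (Db * (enorm e + 1)).
have dl0 : 0 < dl by rewrite divr_gt0// mulr_gt0// ltr_wpDl.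
have Sl : has_lbound S by exists 1 => l [].
have l2S l : S l -> l2 <= l.
  move=> [l1 Hl]; rewrite leNgt; apply/negP => ll.
  have := tscale_le x0 gs (lt_le_trans ltr01 l1) (ltW ll); have := Hl x0; lra.
have l2i : l2 <= inf S by apply: lb_le_inf.
have dl2 : 0 < dl / 2 by rewrite divr_gt0.
have [l1 Sl1 l1i] := inf_adherent dl2 (conj S0 Sl).
have il1 : inf S <= l1 by exact: ge_inf.
(* Just below the infimum of admissible factors, but not below [l2]. If [l0] were in [S], it would
   equal [inf S] and hence [l2], which fails at [x0]. *)
pose l0 := Num.max l2 (inf S - dl / 2).
have l0i : l0 <= inf S by rewrite ge_max l2i lerBlDr lerDl ltW.
have l0l : inf S - dl / 2 <= l0 by rewrite le_max lexx orbT.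
have l20' : l2 <= l0 by rewrite le_max lexx.
have l01 : 1 < l0 := lt_le_trans l21 l20'.
have l00 : 0 < l0 := lt_trans ltr01 l01.
have [x1 Hx1] : exists x1, tscale l0 s x1 < t x1.
  apply: contrapT => Hn.
  have Sl0 : S l0.
    by split; [exact: ltW|move=> x; rewrite leNgt; apply/negP => h; apply: Hn; exists x].
  have := ge_inf Sl Sl0; rewrite le_max => /orP[h|]; last by lra.
  have l2E : l0 = l2 by apply/le_anti; rewrite l20' (le_trans l0i h).
  by have := Sl0.2 x0; rewrite l2E leNgt l2s.
pose M := tscale l0 s; have gM : good W M := tscale_good l00 gs.
pose V : set (borelRV R m) := [set x | M x < t x].
have oV : open (V : set 'rV[R]_m).
  by apply: open_continuous_lt; [exact: adm_continuous gM.1|exact: adm_continuous gt.1].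
have mV : measurable V by exact: open_borel.
have Th0 g x : good W g -> 0 <= Th W g x by move=> gg; rewrite ltW// Th_gt0.
have me := support_lt_borel M.
have eO : support_lt M `<=` Omega C by move=> u [].
have close x : V x -> Th W M x <= (1 + ep) * Th W t x.
  move=> Vx; have [_ xb] := key _ _ l00 Vx.
  apply: Hd; [exact: gr_C gM.1 x|exact: gr_C gt.1 x|exact: gr_neq0|exact: far (epi_gr W t x)|exact: grb|].
  rewrite enormC /gr -gamB subrr gam_e enormZ gtr0_norm ?subr_gt0//.
  have h1 := tscale_lip x gs (ltW l01) (le_trans l0i il1).
  have h2 : t x <= tscale l1 s x by case: Sl1 => _; apply.
  have h3 : (l1 - l0) * (s 0 + 2 * kap W * enorm x) <= dl * Db.
    apply: ler_pM; [lra|by rewrite ltW ?D0|lra|rewrite lerD2l ler_wpM2l// mulr_ge0// ltW//].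
  have h4 : t x - M x <= dl * Db by rewrite /M; lra.
  apply: (@le_lt_trans _ _ (dl * Db * enorm e)); first by rewrite ler_wpM2r.
  have -> : dl * Db * enorm e = d * (enorm e / (enorm e + 1)).
    rewrite /dl; field; rewrite !gt_eqF//; exact: ltr_wpDl.
  by rewrite gtr_pMr// ltr_pdivrMr ?ltr_wpDl// mul1r ltrDl.
pose a := (\int[lam]_(x in V) (Th W t x)%:E)%E.
have a1 : (T W M (support_lt M) <= (1 + ep)%:E * a)%E.
  apply: (@le_trans _ _ (\int[lam]_(x in V) (Th W M x)%:E)%E).
    apply: sub_int => //; [exact: reg_borel gM.1 _ me|exact: Th_measurable|by move=> x _; exact: Th0|].
    exact: reg_support_lt.
  apply: (@le_trans _ _ (\int[lam]_(x in V) ((1 + ep) * Th W t x)%:E)%E).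
    apply: le_int => //; [exact: Th_measurable| |by move=> x _; exact: Th0].
    by apply: measurable_funM; [exact: measurable_cst|exact: Th_measurable].
  rewrite -ge0_integralZl_EFin//.
  - by move=> x _; rewrite lee_fin Th0.
  - exact: ETh_measurable.
  - by rewrite addr_ge0// ltW.
have a2 : (a <= T W t (support_lt M))%E.
  rewrite /a (@ge0_negligible_integral _ _ _ _ _ (Mult W t : set (borelRV R m)))//.
  - apply: sub_int => //.
    + by apply: measurableD => //; exact: Mult_borel gt.1.
    + exact: reg_borel gt.1 _ me.
    + exact: Th_measurable.
    + by move=> x _; exact: Th0.
    + exact: support_lt_reg.
  - exact: Mult_borel gt.1.
  - exact: ETh_measurable.
  - by move=> x _; rewrite lee_fin Th0.
  - exact: Mult_null gt.1.
have a3 : (a < +oo)%E.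
  apply: le_lt_trans a2 _; rewrite TE//; apply: le_lt_trans Tfin.
  by apply: le_T => //; exact: Omega_borel.
have a4 : (0 < a)%E.
  have [cT [dT [cT0 dT0 HT]]] := Theta_bounds W.
  have r20 : 0 < r2 by rewrite ltr_pwDl// mulr_ge0// addr_ge0 ?(ltW t0)// mulr_ge0// ltW.
  have q0 : 0 < cT * r2 `^ (- q) by rewrite mulr_gt0// powR_gt0.
  apply: (@lt_le_trans _ _ (\int[lam]_(x in V) (cT * r2 `^ (- q))%:E)%E); last first.
    apply: le_int => //; [exact: Th_measurable|by move=> x _; exact: ltW|move=> x Vx].
    have [h _] := HT _ (gr_C gt.1 x) (gr_neq0 x gt); apply: le_trans h; rewrite ler_pM2l//.
    by apply: powR_anti; [rewrite enorm_gt0 gr_neq0|apply: grb; case: (key _ _ l00 Vx)].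
  rewrite int_cst// mule_gt0 ?lte_fin//.
  have /nbhs_enball[r r0 Hr] : nbhs (x1 : 'rV[R]_m) V by apply: open_nbhs_nbhs.
  have rm0 : 0 < r / (2 * m%:R) by rewrite divr_gt0// mulr_gt0.
  have sub : cube x1 (r / (2 * m%:R)) `<=` V.
    move=> x xQ; apply: Hr; have xx : cube x1 (r / (2 * m%:R)) x1 by move=> i; rewrite lexx ltrDl.
    apply: le_lt_trans (cube_dist xx xQ) _.
    by rewrite invfM mulrCA [X in r * X](_ : _ = 2^-1) ?ltr_pdivrMr// ?ltr_pMr// ?ltr1n// mulrCA divff ?mulr1.
  apply: (@lt_le_trans _ _ (lam (cube x1 (r / (2 * m%:R))))); last first.
    by apply: le_measure; rewrite ?inE//; exact: cube_borel.
  by rewrite lam_cube// mule_gt0 ?lam_cube_gt0// lte_fin exprn_gt0.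
(* By homogeneity and equality of the two measures, [T] of the dilate on this set of normals is at
   least [l2] to the power [m - q] times [a], yet at most [(1 + ep) * a]; since [0 < a < +oo], this
   is absurd. *)
have a5 : ((l2 `^ (m%:R - q))%:E * a <= (1 + ep)%:E * a)%E.
  apply: le_trans a1; rewrite T_tscale// -TE//.
  have h1 : ((l2 `^ (m%:R - q))%:E <= (l0 `^ (m%:R - q))%:E)%E.
    by rewrite lee_fin; apply: (ge0_ler_powR (ltW mq)) => //; rewrite nnegrE ltW.
  have h2 : (0 <= (l2 `^ (m%:R - q))%:E)%E by rewrite lee_fin powR_ge0.
  by apply: lee_pmul => //; exact: ltW.
have afin : a \is a fin_num by rewrite ge0_fin_numE//; exact: ltW.
by move: a5; rewrite lee_pmul2r// lee_fin leNgt epL.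
Qed.

End Uniqueness.

(** * Polyhedral solutions *)

Section PowerBounds.
Context (R : realType) (k : R).
Hypothesis k0 : 0 < k.

Lemma powR_bounded (B w : R) : 0 < B -> 0 <= w -> exists2 b, 0 < b & forall s, 0 < s -> B * s `^ k <= w -> s <= b.
Proof.
move=> B0 w0; pose b := (w / B + 1) `^ k^-1.
have c0 : 0 < w / B + 1 by rewrite ltr_wpDl// divr_ge0// ltW.
have b0 : 0 < b by rewrite powR_gt0.
exists b => // s s0 h; rewrite leNgt; apply/negP => bs.
have : b `^ k < s `^ k by apply: gt0_ltr_powR => //; rewrite nnegrE ltW.
rewrite /b -powRrM mulVf ?gt_eqF// powRr1 ?(ltW c0)// -(ltr_pM2l B0) mulrDr mulr1 mulrC divfK ?gt_eqF//.
lra.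
Qed.

Lemma powR_small (A w : R) : 0 < A -> 0 < w -> exists2 d, 0 < d & forall s, 0 < s -> s <= d -> A * s `^ k <= w.
Proof.
move=> A0 w0; pose d := (w / A) `^ k^-1.
have c0 : 0 < w / A by rewrite divr_gt0.
have d0 : 0 < d by rewrite powR_gt0.
exists d => // s s0 sd.
have : s `^ k <= d `^ k by apply: (ge0_ler_powR (ltW k0)) => //; rewrite nnegrE ltW.
by rewrite /d -powRrM mulVf ?gt_eqF// powRr1 ?(ltW c0)// ler_pdivlMr// mulrC.
Qed.

End PowerBounds.

Section Discrete.
Context (R : realType) (p : nat) (W : wcone R p).
Local Notation m := p.+1.
Local Notation n := p.+2.
Local Notation C := (wC W).
Local Notation e := (we W).
Local Notation q := (wq W).
Local Notation lam := (lam R p).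
Local Notation gam := (gam W).
Local Notation slf := (slf W).

Lemma dotv_gam z s u : pol1 W u -> dotv (gam z s) u = (slf u z - s) * - dotv e u.
Proof.
move=> Pu; rewrite gamE dotvDl dotvZl slfE mulrBl divfK; first by rewrite mulrN opprK.
by rewrite oppr_eq0 lt_eqF// pol1_e0.
Qed.

Lemma slf0 v : slf v 0 = 0.
Proof. by have := slf_lin W v (-1) 0 0; rewrite scaler0 addr0 mulN1r addNr. Qed.

Lemma nrm_slf t x u : pol1 W u -> (forall y, slf u (y - x) <= t y - t x) -> nrm W t x u.
Proof.
move=> Pu H; apply: nrmP => // y; rewrite /gr -gamB dotv_gam//.
by apply: mulr_le0_ge0; [rewrite subr_le0|rewrite oppr_ge0 ltW// pol1_e0].
Qed.

Variables (N : nat) (u : 'I_N.+1 -> 'rV[R]_n) (w : 'I_N.+1 -> R) (c : R).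
Hypothesis c0 : 0 < c.
Hypothesis uc : forall i, Om W c (u i).
Hypothesis uI : injective u.
Hypothesis w0 : forall i, 0 < w i.

Let uO i : Omega C (u i) := Om_Omega c0 (uc i).
Let uP i : pol1 W (u i) := Omega_pol1 (uO i).

(* epi tb = the points of C below the hyperplanes with normals u i through b i *: e. *)
Definition tb (b : 'I_N.+1 -> R) x : R := \big[Num.max/tC W x]_i (slf (u i) x + b i).

Lemma tb_leP b x s : reflect (tC W x <= s /\ forall i, slf (u i) x + b i <= s) (tb b x <= s).
Proof.
apply: (iffP (bigmax_leP _ _ _ _)) => -[h1 h2]; split=> //.
by move=> i; exact: h2.
Qed.

Lemma tb_geC b x : tC W x <= tb b x.
Proof. exact: bigmax_ge_id. Qed.

Lemma tb_ge b x i : slf (u i) x + b i <= tb b x.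
Proof. exact: le_bigmax. Qed.

Lemma tb_face b x : tC W x < tb b x -> exists i, tb b x = slf (u i) x + b i.
Proof.
move=> h; apply: contrapT => Hn; have : tb b x < tb b x; last by rewrite ltxx.
apply/bigmax_ltP; split=> // i _; rewrite lt_neqAle; apply/andP; split; last exact: le_bigmax.
by apply/eqP => E; apply: Hn; exists i.
Qed.

Lemma tb_adm b : adm W (tb b).
Proof.
split; first by move=> x; exact: tb_geC.
- move=> x Z CZ'; apply/tb_leP; have [_ h _] := tC_adm W; split.
    by rewrite (le_trans (h _ _ CZ'))// lerD2r tb_geC.
  move=> i; have := tb_ge b x i; have -> : slf (u i) (x + prj W Z) = slf (u i) x + slf (u i) (prj W Z).
    by have := slf_lin W (u i) 1 x (prj W Z); rewrite scale1r mul1r.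
  have : slf (u i) (prj W Z) <= ht W Z.
    have := (uP i).2 Z CZ'; rewrite -{1}(gamK W Z) dotv_gam// pmulr_lle0 ?subr_le0//.
    by rewrite oppr_gt0 pol1_e0.
  lra.
- move=> x y l l0 l1; apply/tb_leP; have [_ _ h] := tC_adm W; split.
    rewrite (le_trans (h _ _ _ l0 l1))//; apply: lerD; apply: ler_wpM2l => //; rewrite ?subr_ge0//; exact: tb_geC.
  move=> i; rewrite slf_lin -[l *: y]addr0 slf_lin.
  rewrite slf0.
  have h1 : (1 - l) * (slf (u i) x + b i) <= (1 - l) * tb b x by rewrite ler_wpM2l ?subr_ge0// tb_ge.
  have h2 : l * (slf (u i) y + b i) <= l * tb b y by rewrite ler_wpM2l// tb_ge.
  lra.
Qed.

Lemma tb0_ge b i : b i <= tb b 0.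
Proof. by have := tb_ge b 0 i; rewrite slf0 add0r. Qed.

Lemma tb0_le b s : 0 <= s -> (forall i, b i <= s) -> tb b 0 <= s.
Proof. by move=> s0 H; apply/tb_leP; rewrite tC0; split=> // i; rewrite slf0 add0r. Qed.

Lemma tb_good b : 0 < b ord0 -> good W (tb b).
Proof. by move=> b0; split; [exact: tb_adm|exact: lt_le_trans (tb0_ge b ord0)]. Qed.

Lemma tb_shift b b' (d : R) x : 0 <= d -> (forall i, b i <= b' i + d) -> tb b x <= tb b' x + d.
Proof.
move=> d0 H; apply/tb_leP; split; first by rewrite (le_trans (tb_geC b' x))// lerDl.
by move=> i; have := tb_ge b' x i; have := H i; lra.
Qed.

Lemma tb_cvg (bk : nat -> 'I_N.+1 -> R) b x : (forall k i, `|bk k i - b i| <= k.+1%:R^-1) ->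
  tb (bk k) x @[k --> \oo] --> tb b x.
Proof.
move=> H; apply/cvgrPdist_le => d d0; near=> k.
have kd : k.+1%:R^-1 < d by near: k; exact: (near_infty_natSinv_lt (PosNum d0)).
have h1 : tb b x <= tb (bk k) x + d.
  apply: tb_shift => [|i]; [exact: ltW|move: kd (H k i); rewrite ler_norml].
  by move: (_^-1) => z; lra.
have h2 : tb (bk k) x <= tb b x + d.
  apply: tb_shift => [|i]; [exact: ltW|move: kd (H k i); rewrite ler_norml].
  by move: (_^-1) => z; lra.
by rewrite ler_norml; lra.
Unshelve. all: by end_near. Qed.

Definition face b i : set 'rV[R]_m := [set x | tb b x = slf (u i) x + b i].

Lemma face_nrm b i x : face b i x -> nrm W (tb b) x (u i).
Proof.
move=> fx; apply: nrm_slf => // y; rewrite fx slfB.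
by have := tb_ge b y i; lra.
Qed.

Lemma slf_continuous v (r : R) : continuous (fun x => slf v x + r).
Proof.
apply: (@lip_continuous _ _ _ _ (`|- dotv e v|^-1 * (enorm v * m%:R))) => x y.
rewrite opprD addrACA subrr addr0 -slfB slfE normrM normfV mulrC -!mulrA ler_wpM2l ?invr_ge0//.
by rewrite (le_trans (norm_dotv_le _ _))// enorm_iota mulrC ler_wpM2l// enorm_le_norm.
Qed.

Lemma face_borel b i : measurable (face b i : set (borelRV R m)).
Proof.
apply: closed_borel; rewrite (_ : face b i = [set x | tb b x <= slf (u i) x + b i]).
  apply: closed_continuous_le; first exact: adm_continuous (tb_adm b).
  exact: slf_continuous.
apply/seteqP; split=> x; rewrite /face/=; first by move=> ->.
move=> h.
by apply/le_anti; rewrite h tb_ge.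
Qed.

Local Open Scope ereal_scope.

Definition vset (P : pred 'I_N.+1) : set (borelRV R n) := \big[setU/set0]_(i < N.+1 | P i) [set u i].

Lemma vsetP P v : vset P v <-> exists2 i, P i & v = u i.
Proof.
rewrite /vset -bigcup_seq_cond /=; split=> [[i /andP[_ Pi] ->]|[i Pi ->]]; first by exists i.
by exists i => //=; rewrite mem_index_enum.
Qed.

Lemma set1_borel (v : 'rV[R]_n) : measurable ([set v] : set (borelRV R n)).
Proof.
apply: closed_borel; apply: accessible_closed_set1; apply: hausdorff_accessible.
exact: norm_hausdorff.
Qed.

Lemma vset_borel P : measurable (vset P).
Proof. by apply: bigsetU_measurable => i _; exact: set1_borel. Qed.

Lemma vset_measure (M : {measure set (borelRV R n) -> \bar R}) P : M (vset P) = \sum_(i < N.+1 | P i) M [set u i].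
Proof.
rewrite /vset measure_bigsetU_ord_cond//; first by move=> i _; exact: set1_borel.
by move=> i j _ _ [v [-> /uI]].
Qed.

(** Off the null sets [Mult] and [touching], a point with normal [u i] is above the boundary of [C],
    hence on some facet [j], and uniqueness of the normal gives [j = i]. *)
Lemma T_face b i : (0 < b ord0)%R -> T W (tb b) [set u i] = \int[lam]_(x in face b i) (Th W (tb b) x)%:E.
Proof.
move=> b0; have gb := tb_good b0; have ta := gb.1.
have f0 x : (0 <= Th W (tb b) x)%R by rewrite ltW// Th_gt0.
have cu : closed [set u i] by apply: accessible_closed_set1; apply: hausdorff_accessible; exact: norm_hausdorff.
have mh : measurable (has_nrm W (tb b) [set u i] : set (borelRV R m)).
  by apply: closed_borel; exact: has_nrm_closed ta _ cu.
have mf := face_borel b i.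
rewrite T_has_nrm//; apply/eqP; rewrite eq_le; apply/andP; split; last first.
  apply: sub_int => //; first exact: Th_measurable.
  by move=> x fx; exists (u i) => //; exact: face_nrm.
pose Z : set (borelRV R m) := Mult W (tb b) `|` touching W (tb b).
have mZ : measurable Z by apply: measurableU; [exact: Mult_borel ta|exact: touching_borel].
have Z0 : lam Z = 0.
  apply/eqP; rewrite eq_le measure_ge0 andbT; apply: le_trans (measureU2 _ _ _) _.
  - exact: Mult_borel ta.
  - exact: touching_borel.
  by rewrite [X in X + _](Mult_null ta) add0e [X in X <= _](touching_null gb).
rewrite (@ge0_negligible_integral _ _ _ _ _ Z)//; last first.
- by move=> x _; rewrite lee_fin.
- exact: ETh_measurable.
apply: sub_int => //; [exact: measurableD|exact: Th_measurable|move=> x [[_ -> xu] nZ]].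
have [nM nT] : ~ Mult W (tb b) x /\ ~ touching W (tb b) x by split=> h; apply: nZ; [left|right].
have ab : above W (tb b) x.
  by apply: contrapT => nA; apply: nT; split=> //; exists (u i) => //; exact: uO.
have [j fj] := tb_face ab.
have uij : u j = u i.
  by apply: contrapT => h; apply: nM; exists (u j), (u i); split=> //; exact: face_nrm.
by rewrite /face/= -(uI uij).
Qed.

(** Raising the other hyperplanes only cuts facet [i] down, and on what is left both graphs and
    hence both values of [Theta] coincide. *)
Lemma T_face_mono b b' i : (0 < b ord0)%R -> (0 < b' ord0)%R -> (forall j, b j <= b' j)%R -> b i = b' i ->
  T W (tb b') [set u i] <= T W (tb b) [set u i].
Proof.
move=> b0 b'0 bb bi; rewrite !T_face//.
have gb := tb_good b0.
have tbb x : (tb b x <= tb b' x)%R.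
  by have := @tb_shift b b' 0 x (lexx _); rewrite addr0; apply=> j; rewrite addr0.
have sub : face b' i `<=` face b i.
  move=> x; rewrite /face/= => fx; apply/le_anti; rewrite tb_ge andbT (le_trans (tbb x))// fx bi//.
rewrite (_ : \int[lam]_(x in face b' i) _ = \int[lam]_(x in face b' i) (Th W (tb b) x)%:E).
  apply: sub_int => //; try exact: face_borel; first exact: Th_measurable.
  by move=> x _; rewrite ltW// Th_gt0.
apply: eq_integral => x; rewrite inE => fx; congr (_%:E).
by rewrite /Th /gr (sub _ fx) fx bi.
Qed.

Lemma Itot_T b : (0 < b ord0)%R -> Itot W (tb b) = \sum_(i < N.+1) T W (tb b) [set u i].
Proof.
move=> b0; have gb := tb_good b0; have ta := gb.1.
have mv := vset_borel predT.
have [M ME] := T_measure gb.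
transitivity (M (vset predT)).
  rewrite ME//; apply/eqP; rewrite eq_le; apply/andP; split; last first.
    by apply: T_le_I => // v /vsetP[i _ ->]; exact: uO.
  rewrite /Itot /T (@ge0_negligible_integral _ _ _ _ _ (Mult W (tb b) : set (borelRV R m)))//.
  - apply: sub_int.
    + by apply: measurableD; [exact: above_borel|exact: Mult_borel ta].
    + exact: reg_borel ta _ mv.
    + exact: Th_measurable.
    + by move=> x _; rewrite ltW// Th_gt0.
    move=> x [ax nM]; have [i fi] := tb_face ax.
    have xi := face_nrm fi.
    exists (u i); split=> //; first by apply/vsetP; exists i.
    by move=> v xv; apply: contrapT => vu; apply: nM; exists v, (u i).
  - exact: Mult_borel ta.
  - exact: above_borel.
  - exact: ETh_measurable.
  - by move=> x _; rewrite lee_fin ltW// Th_gt0.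
  - exact: Mult_null ta.
by rewrite vset_measure; apply: eq_bigr => i _; rewrite ME//; exact: set1_borel.
Qed.

Lemma T_face_fin b i : (0 < b ord0)%R -> T W (tb b) [set u i] \is a fin_num.
Proof.
move=> b0; have gb := tb_good b0; have [A A0 HA] := T_upper W c0.
rewrite ge0_fin_numE ?T_ge0//; apply: le_lt_trans (ltry (A * tb b 0 `^ (m%:R - q))%R).
apply: le_trans (HA _ gb); apply: le_T => //; first exact: set1_borel.
  by apply: closed_borel; exact: Om_closed.
by move=> v ->; exact: uc.
Qed.

Local Close Scope ereal_scope.

Definition area b i : R := fine (T W (tb b) [set u i]).

Lemma areaE b i : 0 < b ord0 -> T W (tb b) [set u i] = (area b i)%:E.
Proof. by move=> b0; rewrite fineK// T_face_fin. Qed.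

Lemma Itot_area b : 0 < b ord0 -> Itot W (tb b) = (\sum_i area b i)%:E.
Proof. by move=> b0; rewrite Itot_T// -sumEFin; apply: eq_bigr => i _; rewrite areaE. Qed.

Lemma area_mono b b' i : 0 < b ord0 -> 0 < b' ord0 -> (forall j, b j <= b' j) -> b i = b' i -> area b' i <= area b i.
Proof. by move=> b0 b'0 bb bi; rewrite -lee_fin -!areaE//; exact: T_face_mono. Qed.

(* Perron's method: the pointwise supremum of the b with all areas at most the prescribed ones is a solution. *)
Lemma perron : exists2 b, 0 < b ord0 & forall i, area b i = w i.
Proof.
have mq : 0 < m%:R - q by rewrite subr_gt0 wq1.
have [A A0 HA] := T_upper W c0; have [B B0 HB] := I_lower W.
(* [dl] is so small that the constant vector [dl] has all areas at most [w1]; [bt] bounds every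
   candidate, because its total area, at most the sum of the weights, dominates a power of its
   height. *)
pose w1 := \big[Num.min/w ord0]_i w i.
have w10 : 0 < w1 by apply: lt_bigmin.
have [dl dl0 Hdl] := powR_small mq A0 w10.
have ws0 : 0 <= \sum_i w i by apply: sumr_ge0 => i _; exact: ltW.
have [bt bt0 Hbt] := powR_bounded mq B0 ws0.
pose P := [set b : 'I_N.+1 -> R | forall i, dl <= b i /\ area b i <= w i].
have Ppos b : P b -> 0 < b ord0 by move=> /(_ ord0)[h _]; exact: lt_le_trans h.
have P0 : P (fun=> dl).
  move=> i; split=> //; have gd := @tb_good (fun=> dl) dl0.
  have td : tb (fun=> dl) 0 = dl.
    by apply/le_anti; rewrite (tb0_ge (fun=> dl) ord0) andbT tb0_le// ltW.
  apply: (@le_trans _ _ w1); last by apply: bigmin_le_cond.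
  apply: le_trans (Hdl dl dl0 (lexx _)); rewrite -lee_fin -areaE//.
  have := HA _ gd; rewrite td; apply: le_trans; apply: le_T => //; first exact: set1_borel.
    by apply: closed_borel; exact: Om_closed.
  by move=> v ->; exact: uc.
have Pub b i : P b -> b i <= bt.
  move=> Pb; apply: le_trans (tb0_ge b i) _; have b0 := Ppos _ Pb; have gb := tb_good b0.
  apply: Hbt; first exact: gb.2.
  rewrite -lee_fin; apply: le_trans (HB _ gb) _; rewrite Itot_area// lee_fin.
  by apply: ler_sum => j _; case: (Pb j).
have Pmax b b' : P b -> P b' -> P (fun i => Num.max (b i) (b' i)).
  move=> Pb Pb' i; have b0 := Ppos _ Pb; have b'0 := Ppos _ Pb'.
  have bb0 : 0 < Num.max (b ord0) (b' ord0) by rewrite lt_max b0.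
  split; first by rewrite le_max; case: (Pb i) => ->.
  have [bi|bi] := leP (b' i) (b i).
    apply: le_trans (Pb i).2; apply: area_mono => //; first by move=> j; rewrite le_max lexx.
    by rewrite max_l.
  apply: le_trans (Pb' i).2; apply: area_mono => //; first by move=> j; rewrite le_max lexx orbT.
  by rewrite max_r// ltW.
pose bs i := sup [set b i | b in P].
have Psup i : has_sup [set b i | b in P].
  by split; [exists dl; exists (fun=> dl)|exists bt => _ [b Pb <-]; exact: Pub].
have bsub b i : P b -> b i <= bs i by move=> Pb; apply: sup_upper_bound => //; exists b.
have bs0 : 0 < bs ord0 := lt_le_trans dl0 (bsub _ ord0 P0).
have near_sup (ep : R) : 0 < ep -> exists2 b, P b & forall i, bs i - ep < b i.
  move=> e0; have : forall s : seq 'I_N.+1, exists2 b, P b & forall i, i \in s -> bs i - ep < b i.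
    elim=> [|i s [b Pb Hb]]; first by exists (fun=> dl).
    have [_ [b' Pb' <-] hb'] := sup_adherent e0 (Psup i).
    exists (fun j => Num.max (b j) (b' j)); first exact: Pmax.
    by move=> j; rewrite inE lt_max => /orP[/eqP ->|/Hb ->//]; rewrite hb' orbT.
  by move=> /(_ (enum 'I_N.+1))[b Pb Hb]; exists b => // i; apply: Hb; rewrite mem_enum.
have Hk k : exists b, P b /\ forall i, bs i - k.+1%:R^-1 < b i.
  by have [|b Pb Hb] := near_sup k.+1%:R^-1; [rewrite invr_gt0|exists b].
have [bk Hbk] := boolp.choice Hk.
have gs := tb_good bs0.
have usc (bk' : nat -> 'I_N.+1 -> R) i (r : R) : (forall k i, `|bk' k i - bs i| <= k.+1%:R^-1) ->
    (forall k, dl <= bk' k ord0) -> area bs i < r -> \forall k \near \oo, area (bk' k) i < r.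
  move=> cv bk'd ar; have bk'0 k : 0 < bk' k ord0 := lt_le_trans dl0 (bk'd k).
  have gk k := tb_good (bk'0 k).
  have bnd k : dl <= tb (bk' k) 0 <= tb bs 0 + 1.
    rewrite (le_trans (bk'd k) (tb0_ge _ ord0))/=; apply: tb_shift => // j.
    have := cv k j; have : k.+1%:R^-1 <= 1 :> R by rewrite invf_le1// ler1n.
    by rewrite ler_norml; move: (_^-1) => x; lra.
  have cu : closed [set u i] by apply: accessible_closed_set1; apply: hausdorff_accessible; exact: norm_hausdorff.
  have uu : [set u i] `<=` Om W c by move=> v ->; exact: uc.
  have h : (T W (tb bs) [set u i] < r%:E)%E by rewrite areaE// lte_fin.
  have := T_usc gk gs (fun x => tb_cvg (x := x) cv) dl0 c0 bnd cu uu h.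
  by apply: filterS => k; rewrite areaE// lte_fin.
have cvk k i : `|bk k i - bs i| <= k.+1%:R^-1.
  have [Pk /(_ i) hk] := Hbk k; have := bsub _ i Pk.
  by rewrite ler_norml; move: (_^-1) hk => x; lra.
have bkd k : dl <= bk k ord0 by have [/(_ ord0)[]] := Hbk k.
have le_w i : area bs i <= w i.
  rewrite leNgt; apply/negP => wi.
  (* The excess at [i] is cut into more shares than there are other indices. Lower semicontinuity of
     the total and upper semicontinuity of the other areas then force area [i] of some approximant
     above [w i]. *)
  pose ep := (area bs i - w i) / N.+2%:R.
  have ep0 : 0 < ep by rewrite divr_gt0// subr_gt0.
  have gk k : good W (tb (bk k)) by apply: tb_good; exact: lt_le_trans (bkd k).
  have Ibig : ((w i + \sum_(j | j != i) (area bs j + ep))%:E < Itot W (tb bs))%E.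
    rewrite Itot_area// lte_fin [ltRHS](bigD1 i)//= big_split/= addrA addrAC ltrD2r.
    rewrite sumr_const -ltrBrDl -mulr_natr.
    have -> : area bs i - w i = ep * N.+2%:R by rewrite divfK.
    rewrite ltr_pM2l// ltr_nat ltnS; apply: leq_trans (max_card _) _; by rewrite card_ord.
  have e1 := I_lsc gk gs (fun x => tb_cvg (x := x) cvk) Ibig.
  have e2 : \forall k \near \oo, forall j, area (bk k) j < area bs j + ep.
    by apply: filter_forall => j; apply: (usc bk) => //; rewrite ltrDl.
  have [k [h1 h2]] := filter_ex (filterI e1 e2).
  have kd : 0 < bk k ord0 := lt_le_trans dl0 (bkd k).
  move: h1; rewrite Itot_area// lte_fin [ltRHS](bigD1 i)//=; apply/negP; rewrite -leNgt.
  by apply: lerD; [case: (Hbk k) => /(_ i)[]|apply: ler_sum => j _; exact: ltW].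
exists bs => // i; apply/le_anti; rewrite le_w/= leNgt; apply/negP => wi.
(* If area [i] were too small, a slight raise of [b i] would keep it below [w i] by upper
   semicontinuity and only lower the other areas, giving a member of [P] beyond the supremum. *)
pose bk' k j := bs j + (if j == i then k.+1%:R^-1 else 0).
have inv0 k : 0 < k.+1%:R^-1 :> R by rewrite invr_gt0.
have bkg k j : bs j <= bk' k j by rewrite lerDl; case: ifP => // _; exact: ltW.
have bsd j : dl <= bs j by exact: bsub P0.
have : \forall k \near \oo, area (bk' k) i < w i.
  apply: usc => // [k j|k]; last exact: le_trans (bsd _) (bkg _ _).
  by rewrite /bk' addrC addKr; case: ifP => _; [rewrite gtr0_norm|rewrite normr0 ltW].
move=> /filter_ex[k hk].
have Pk : P (bk' k).
  move=> j; split; first exact: le_trans (bsd _) (bkg _ _).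
  have [->|ji] := eqVneq j i; first exact: ltW.
  apply: le_trans (le_w j); apply: area_mono => //; last by rewrite /bk' (negbTE ji) addr0.
  exact: lt_le_trans (bkg _ _).
by have := bsub _ i Pk; rewrite /bk' eqxx gerDl leNgt inv0.
Qed.

Lemma discrete_solution : exists t, [/\ good W t, Itot W t = (\sum_i w i)%:E &
  forall A : set (borelRV R n), measurable A -> ((\sum_(i | u i \in A) w i)%:E <= T W t A)%E].
Proof.
have [b b0 Hb] := perron; have gb := tb_good b0.
exists (tb b); split=> //; first by rewrite Itot_area//; congr (_%:E); apply: eq_bigr => i _; rewrite Hb.
move=> A mA; have [M ME] := T_measure gb; have mv := vset_borel (fun i => u i \in A).
have -> : (\sum_(i | u i \in A) w i)%:E = M (vset (fun i => u i \in A)).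
  rewrite vset_measure -sumEFin; apply: eq_bigr => i _.
  by rewrite ME ?areaE ?Hb//; exact: set1_borel.
rewrite ME//; apply: le_T => // v /vsetP[i iA ->]; by rewrite inE in iA.
Qed.

End Discrete.

(** * Discretization of measures *)

Section Nets.
Context (R : realType) (k : nat).

Lemma finite_net (K : set 'rV[R]_k.+1) (ep : R) : compact K -> 0 < ep ->
  exists l : seq 'rV[R]_k.+1, [/\ uniq l, forall v, v \in l -> K v &
    forall x, K x -> exists2 v, v \in l & enorm (v - x) < ep].
Proof.
move=> cK e0.
have cont (v : 'rV[R]_k.+1) : continuous (fun x : 'rV[R]_k.+1 => enorm (v - x)).
  apply: (@lip_continuous _ _ _ _ k.+1%:R) => y z.
  apply: le_trans (enorm_le_norm (y - z)); rewrite ler_norml.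
  have := enormB_le v y z; have := enormB_le v z y; rewrite (enormC z y); lra.
move: cK; rewrite compact_cover => /(_ _ K (fun v => [set x | enorm (v - x) < ep])).
case=> [v _|x Kx|D DK cov].
- by apply: open_continuous_lt; [exact: cont|exact: cst_continuous].
- by exists x => //=; rewrite subrr enorm0.
exists (finmap.enum_fset D); split; [exact: finmap.fset_uniq|by move=> v vD; have := DK v vD; rewrite inE|].
by move=> x /cov[v vD xv]; exists v.
Qed.

(** Tychonoff on an uncountable product yields a cluster point, not a subsequence: it is approached
    on one finite set at a time. *)
Lemma pointwise_cluster (tk : nat -> 'rV[R]_k.+1 -> R) (lo hi : 'rV[R]_k.+1 -> R) :
  (forall j x, lo x <= tk j x <= hi x) ->
  exists t : 'rV[R]_k.+1 -> R, forall (l : seq 'rV[R]_k.+1) (d : R) N, 0 < d ->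
    exists2 j, (N <= j)%N & forall x, x \in l -> `|tk j x - t x| < d.
Proof.
move=> H.
have cK := @tychonoff 'rV[R]_k.+1 (fun=> R) (fun x => `[lo x, hi x]%classic)
  (fun x => @segment_compact R (lo x) (hi x)).
have [|t [_ ct]] := cK (tk @ \oo) _.
  by exists 0%N => // j _ x /=; rewrite in_itv/=; exact: H.
exists t => l d N d0.
have nb : nbhs t [set f : prod_topology (fun _ : 'rV[R]_k.+1 => R) | forall x, x \in l -> `|f x - t x| < d].
  elim: l => [|y l IH]; first by apply: filterE => f x; rewrite in_nil.
  have hy : nbhs t [set f : prod_topology (fun _ : 'rV[R]_k.+1 => R) | `|f y - t y| < d].
    have := @proj_continuous _ (fun _ : 'rV[R]_k.+1 => R) y t.
    move=> /(_ [set r | `|r - t y| < d]); apply.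
    by apply/nbhs_ballP; exists d => // r; rewrite /ball/= distrC.
  apply: filterS (filterI hy IH) => f [fy fl] x.
  by rewrite inE => /orP[/eqP ->//|/fl].
have FN : (tk @ \oo) [set f : prod_topology (fun _ : 'rV[R]_k.+1 => R) | exists2 j, (N <= j)%N & f = tk j].
  by exists N => // j /= Nj; exists j.
by have [_ [[j Nj ->] hj]] := ct _ _ FN nb; exists j.
Qed.

End Nets.

Section Discretize.
Context (R : realType) (n : nat) (nu : {measure set (borelRV R n.+1) -> \bar R}).
Local Open Scope ereal_scope.

(** Each point of [X] gives its mass to the first member of the list within [ep] of it, so mass in
    [F] ends up at points within [ep] of [F]. *)
Lemma voronoi_weights (ep : R) (l : seq 'rV[R]_n.+1) (X : set (borelRV R n.+1)) : measurable X -> nu X < +oo ->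
  (forall x, X x -> exists2 v, v \in l & (enorm (v - x) < ep)%R) -> uniq l ->
  exists w : 'rV[R]_n.+1 -> R, [/\ forall v, (0 <= w v)%R, nu X = (\sum_(v <- l) w v)%:E &
    forall F G : set (borelRV R n.+1), measurable F ->
      (forall x v, F x -> v \in l -> (enorm (v - x) < ep)%R -> G v) ->
      nu (F `&` X) <= (\sum_(v <- l | v \in G) w v)%:E].
Proof.
elim: l X => [|v l IH] X mX Xfin cov ul.
  have X0 : X = set0 by apply/seteqP; split=> // x /cov[].
  exists (fun=> 0%R); split=> //; first by rewrite X0 measure0 big_nil.
  by move=> F G mF _; rewrite X0 setI0 measure0 big_nil.
pose B : set (borelRV R n.+1) := [set x | (enorm (v - x) < ep)%R].
have mB : measurable B.
  apply: open_borel; apply: open_continuous_lt; last exact: cst_continuous.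
  apply: (@lip_continuous _ _ _ _ n.+1%:R) => y z.
  apply: le_trans (enorm_le_norm (y - z)); rewrite ler_norml.
  have := enormB_le v y z; have := enormB_le v z y; rewrite (enormC z y); lra.
have mXB := measurableI _ _ mX mB; have mXD := measurableD mX mB.
have fin Y : measurable Y -> Y `<=` X -> nu Y \is a fin_num.
  move=> mY YX; rewrite ge0_fin_numE ?measure_ge0//; apply: le_lt_trans Xfin.
  by apply: le_measure; rewrite ?inE.
move: ul => /= /andP[vl ul'].
have hfin : nu (X `\` B) < +oo by rewrite -ge0_fin_numE ?measure_ge0//; apply: fin => // x [].
have hcov x : (X `\` B) x -> exists2 z, z \in l & (enorm (z - x) < ep)%R.
  by move=> [Xx Bx]; have [z] := cov x Xx; rewrite inE => /orP[/eqP ->//|zl zx]; exists z.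
have [w [w0 wX wF]] := IH _ mXD hfin hcov ul'.
pose w' z := if z == v then fine (nu (X `&` B)) else w z.
have w'l (P : pred 'rV[R]_n.+1) : (\sum_(z <- l | P z) w' z = \sum_(z <- l | P z) w z)%R.
  rewrite big_seq_cond [RHS]big_seq_cond; apply: eq_bigr => z /andP[zl _].
  by rewrite /w'; case: eqP => // zv; rewrite zv (negbTE vl) in zl.
have XB : (fine (nu (X `&` B)))%:E = nu (X `&` B) by rewrite fineK// fin// => x [].
exists w'; split.
- by move=> z; rewrite /w'; case: ifP => // _; exact: fine_ge0.
- rewrite big_cons w'l EFinD -wX {1}/w' eqxx XB -measureU//; first by rewrite setIC setDE setIC -setIUr setUv setIT.
  by apply/seteqP; split=> // x [[_ Bx] [_]].
move=> F G mF FG; rewrite big_cons w'l {1}/w' eqxx.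
have h2 := wF F G mF (fun x z Fx zl => FG x z Fx (mem_behead (s := v :: l) zl)).
have sp : nu (F `&` X) <= nu (F `&` (X `&` B)) + nu (F `&` (X `\` B)).
  apply: le_trans (measureU2 _ _ _); try exact: measurableI.
  apply: le_measure; rewrite ?inE; try exact: measurableI; first by apply: measurableU; exact: measurableI.
  by move=> x [Fx Xx]; have [Bx|Bx] := pselect (B x); [left|right].
case: ifPn => vG.
  apply: (le_trans sp); rewrite EFinD XB; apply: leeD => //.
  by apply: le_measure; rewrite ?inE//; exact: measurableI.
apply: (le_trans sp); rewrite (_ : F `&` (X `&` B) = set0) ?measure0 ?add0e//.
apply/seteqP; split=> // x [Fx [_ Bx]]; move/negP: vG; apply; rewrite inE.
by apply: FG Fx _ Bx; exact: mem_head.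
Qed.

Lemma measure_bigcup_le (M : {measure set (borelRV R n.+1) -> \bar R}) (F : nat -> set (borelRV R n.+1)) r :
  (forall i, measurable (F i)) -> (forall i j, (i <= j)%N -> F i `<=` F j) ->
  (forall i, M (F i) <= r) -> M (\bigcup_i F i) <= r.
Proof.
move=> mF inc H.
have h : M \o F @ \oo --> M (\bigcup_i F i).
  apply: nondecreasing_cvg_mu => //; first exact: bigcupT_measurable.
  by move=> i j ij; apply/subsetPset; exact: inc.
rewrite -(cvg_lim _ h)//; apply: lime_le; first by apply/cvg_ex; eexists; exact: h.
by apply: nearW => i; exact: H.
Qed.

Definition shrink (U : set 'rV[R]_n.+1) (i : nat) : set (borelRV R n.+1) :=
  [set v | forall z, ~ U z -> (i.+1%:R^-1 <= enorm (v - z))%R].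

Lemma shrink_closed U i : closed (shrink U i : set 'rV[R]_n.+1).
Proof.
rewrite (_ : shrink U i = \bigcap_(z in ~` U) [set v | (i.+1%:R^-1 <= enorm (v - z))%R]); last by apply/seteqP; split.
apply: closed_bigI => z _; apply: closed_continuous_le; first exact: cst_continuous.
apply: (@lip_continuous _ _ _ _ n.+1%:R) => x y.
apply: le_trans (enorm_le_norm (x - y)); rewrite ler_norml.
have := enormB_le x y z; have := enormB_le y x z; rewrite (enormC y x); lra.
Qed.

Lemma shrink_bigcup U : open U -> \bigcup_i shrink U i = U.
Proof.
move=> oU; apply/seteqP; split=> v.
  move=> [i _ vi]; apply: contrapT => /vi; rewrite subrr enorm0 leNgt => /negP; apply.
  by rewrite invr_gt0.
move=> Uv; have /nbhs_enball[r r0 Hr] := open_nbhs_nbhs (conj oU Uv).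
exists (Num.truncn r^-1) => // z nUz; rewrite leNgt; apply/negP => vz; apply: nUz; apply: Hr.
apply: (lt_le_trans vz); rewrite invf_ple ?posrE// ltW// truncnS_gt.
by [].
Qed.

Lemma shrink_mono U i j : (i <= j)%N -> shrink U i `<=` shrink U j.
Proof.
move=> ij v vi z nUz; apply: le_trans (vi z nUz).
by rewrite lef_pV2 ?posrE// ler_nat ltnS.
Qed.

(* An open set is exhausted by the complements in O of smaller and smaller neighbourhoods of its complement. *)
Lemma measure_eq_of_open (N M : {measure set (borelRV R n.+1) -> \bar R}) (O : set (borelRV R n.+1)) :
  measurable O -> N O < +oo -> M O <= N O ->
  (forall U : set 'rV[R]_n.+1, open U -> N (U `&` O) <= M (U `&` O)) ->
  forall B, measurable B -> B `<=` O -> M B = N B.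
Proof.
move=> mO fN MN NM.
have fM : M O < +oo := le_lt_trans MN fN.
have op U : open U -> M (U `&` O) = N (U `&` O).
  move=> oU; have mU : measurable (U : set (borelRV R n.+1)) by exact: open_borel.
  apply/eqP; rewrite eq_le NM// andbT -{1}(shrink_bigcup oU) setI_bigcupl.
  have ms i : measurable (shrink U i) by apply: closed_borel; exact: shrink_closed.
  apply: measure_bigcup_le.
  - by move=> i; exact: measurableI.
  - by move=> i j /(shrink_mono (U := U)) h x [/h].
  move=> i; pose V := ~` shrink U i.
  have mV : measurable V by exact: measurableC.
  have spl (M' : {measure set (borelRV R n.+1) -> \bar R}) : M' O = M' (V `&` O) + M' (shrink U i `&` O).
    rewrite -measureU//; try exact: measurableI.
      by rewrite -setIUl setUC setUv setTI.
    by apply/seteqP; split=> // x [[Vx _] []].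
  have oV : open (V : set 'rV[R]_n.+1) by apply: closed_openC; exact: shrink_closed.
  have h1 := NM _ oV.
  have fVN : N (V `&` O) \is a fin_num.
    rewrite ge0_fin_numE ?measure_ge0//; apply: le_lt_trans fN; apply: le_measure; rewrite ?inE//.
    exact: measurableI.
  apply: (@le_trans _ _ (N (shrink U i `&` O))).
    rewrite -(@leeD2lE _ (N (V `&` O)))//; rewrite -(spl N); apply: le_trans MN; rewrite (spl M).
    exact: leeD.
  apply: le_measure; rewrite ?inE; try exact: measurableI.
  by move=> x [xi Ox]; split=> //; rewrite -(shrink_bigcup oU); exists i.
move=> B mB BO.
have key : mrestr M mO B = mrestr N mO B.
  apply: (@measure_unique _ R (borelRV R n.+1) (@open 'rV[R]_n.+1) (fun=> setT)) => //.
  - by move=> A A'; exact: openI.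
  - by move=> _; exact: openT.
  - by rewrite bigcup_const.
  - by move=> _; apply: le_lt_trans fM; rewrite -[X in _ <= M X]setTI; exact: lexx.
by move: key; rewrite /mrestr (setIidl BO).
Qed.

End Discretize.

(** * Existence *)

Section Existence.
Context (R : realType) (p : nat) (W : wcone R p).
Local Notation m := p.+1.
Local Notation n := p.+2.
Local Notation C := (wC W).
Local Notation e := (we W).
Local Notation q := (wq W).

(** The common Lipschitz constant turns closeness on a net of mesh [1/(j+1)] in the ball of radius
    [j + 1] into uniform closeness there. The bound [j <= phi j] replaces monotonicity of [phi]. *)
Lemma subsequence (tk : nat -> 'rV[R]_m -> R) (A : R) : (forall k, adm W (tk k)) -> (forall k, tk k 0 <= A) ->
  exists phi t, [/\ adm W t, forall j, (j <= phi j)%N & forall x, tk (phi j) x @[j --> \oo] --> t x].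
Proof.
move=> ta tA; have k0 := kap_gt0 W.
have [t ct] : exists t : 'rV[R]_m -> R, forall (l : seq 'rV[R]_m) (d : R) N, 0 < d ->
    exists2 j, (N <= j)%N & forall x, x \in l -> `|tk j x - t x| < d.
  apply: (@pointwise_cluster R p tk (tC W) (fun x => tC W x + A)) => j x.
  have [h _ _] := ta j; rewrite h/=.
  by apply: le_trans (adm_le_tC x (ta j)) _; rewrite lerD2l.
have tadm : adm W t.
  split.
  - move=> x; apply/ler_addgt0Pr => d d0; have [j _ /(_ x)] := ct [:: x] d 0%N d0.
    by rewrite mem_head => /(_ isT); have [/(_ x) h _ _] := ta j; rewrite ltr_norml; lra.
  - move=> x Z CZ'; apply/ler_addgt0Pr => d d0; have d2 : 0 < d / 2 by rewrite divr_gt0.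
    have [j _ H] := ct [:: x + prj W Z; x] _ 0%N d2; have [_ /(_ x _ CZ') h _] := ta j.
    have := H (x + prj W Z); have := H x; rewrite !inE !eqxx !orbT => /(_ isT) + /(_ isT).
    by rewrite !ltr_norml; lra.
  - move=> x y l l0 l1; apply/ler_addgt0Pr => d d0; have d2 : 0 < d / 2 by rewrite divr_gt0.
    have [j _ H] := ct [:: (1 - l) *: x + l *: y; x; y] _ 0%N d2; have [_ _ /(_ x y l l0 l1) h] := ta j.
    have := H ((1 - l) *: x + l *: y); have := H x; have := H y.
    rewrite !inE !eqxx !orbT => /(_ isT) + /(_ isT) + /(_ isT); rewrite !ltr_norml => hy hx hz.
    have h1 : (1 - l) * tk j x <= (1 - l) * (t x + d / 2) by rewrite ler_wpM2l ?subr_ge0//; lra.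
    have h2 : l * tk j y <= l * (t y + d / 2) by rewrite ler_wpM2l//; lra.
    move: h1 h2; rewrite !mulrDr; lra.
have H j : exists k, (j <= k)%N /\ forall x, enorm x <= j.+1%:R -> `|tk k x - t x| <= (1 + 2 * kap W) * j.+1%:R^-1.
  have i0 : 0 < j.+1%:R^-1 :> R by rewrite invr_gt0.
  have cB : compact [set x : 'rV[R]_m | enorm x <= j.+1%:R].
    by apply: (@compact_enorm_le _ _ j.+1%:R) => //; apply: closed_continuous_le; [exact: enorm_continuous|exact: cst_continuous].
  have [l [_ _ Hl]] := finite_net cB i0.
  have [k jk Hk] := ct l _ j i0.
  exists k; split=> // x xj; have [v vl vx] := Hl x xj.
  have h1 := Hk v vl; have h2 := adm_lip (ta k) x v; have h3 := adm_lip tadm x v.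
  have h4 : kap W * enorm (x - v) <= kap W * j.+1%:R^-1 by rewrite ler_pM2l// ltW// enormC.
  move: h1 h2 h3 h4; move: (_^-1) (enorm (x - v)) => z y.
  by rewrite ltr_norml !ler_norml; lra.
have [phi Hphi] := boolp.choice H.
exists phi, t; split=> //; first by move=> j; case: (Hphi j).
move=> x; apply/cvgrPdist_le => d d0.
have K0 : 0 < 1 + 2 * kap W by rewrite addr_gt0// mulr_gt0.
have a0 : 0 < d / (1 + 2 * kap W) by rewrite divr_gt0.
have b0 : 0 < (enorm x + 1)^-1 by rewrite invr_gt0 ltr_wpDl.
have n1 := near_infty_natSinv_lt (PosNum a0); have n2 := near_infty_natSinv_lt (PosNum b0).
apply: filterS2 n1 n2 => j /= j1 j2; rewrite distrC.
have [_ /(_ x) h] := Hphi j; apply: (le_trans (h _)).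
  by move: j2; rewrite ltf_pV2 ?posrE ?ltr_wpDl// => h1; lra.
by rewrite mulrC -ler_pdivlMr// ltW.
Qed.

Lemma Om_near c d u v : Om W c u -> enorm v = 1 -> enorm (v - u) <= d -> Om W (c - d) v.
Proof.
move=> [u1 H] v1 uv; split=> // x Cx.
have -> : v = u + (v - u) by rewrite addrC subrK.
have h1 := H _ Cx; have h2 := dotv_le x (v - u).
have h3 : enorm x * enorm (v - u) <= d * enorm x by rewrite mulrC ler_wpM2r.
rewrite dotvDr; lra.
Qed.

Variable nu : {measure set (borelRV R n) -> \bar R}.
Hypothesis nufin : (nu (Omega C) < +oo)%E.

Lemma approx_solution (c ep : R) : 0 < c -> 0 < ep -> (0 < nu (Om W c))%E ->
  exists t, [/\ good W t, (Itot W t <= nu (Omega C))%E &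
    forall F G : set (borelRV R n), measurable F -> measurable G -> F `<=` Om W c ->
      (forall x v, F x -> enorm v = 1 -> enorm (v - x) < ep -> G v) -> (nu F <= T W t G)%E].
Proof.
move=> c0 e0 nu0.
have mO : measurable (Om W c : set (borelRV R n)) by apply: closed_borel; exact: Om_closed.
have nuO : (nu (Om W c) <= nu (Omega C))%E.
  by apply: le_measure; rewrite ?inE//; [exact: Omega_borel|move=> v; exact: Om_Omega].
have [l [ul lO Hl]] := finite_net (@Om_compact _ _ W c) e0.
have [w [w0 wO wF]] := voronoi_weights mO (le_lt_trans nuO nufin) Hl ul.
(* Perron's method needs positive weights, so net points without mass are dropped; some remain
   because [nu (Om W c)] is positive. *)
pose s := [seq v <- l | 0 < w v].
have sE (P : pred 'rV[R]_n) : \sum_(v <- l | P v) w v = \sum_(v <- s | P v) w v.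
  rewrite big_filter_cond (bigID (fun v => 0 < w v))/= [X in _ + X]big1 ?addr0.
    by apply: eq_bigl => v; rewrite andbC.
  by move=> v /andP[_]; rewrite -leNgt => h; apply/le_anti; rewrite h w0.
have s0 : (0 < size s)%N.
  rewrite lt0n; apply/eqP => /size0nil sn; move: nu0; rewrite wO sE sn big_nil lte_fin ltxx.
  by [].
have [N sN] : exists N, size s = N.+1 by exists (size s).-1; rewrite prednK.
have us : uniq s by exact: filter_uniq.
pose u (i : 'I_N.+1) := nth 0 s i.
have ls (i : 'I_N.+1) : (i < size s)%N by rewrite sN ltn_ord.
have us_ (i : 'I_N.+1) : u i \in s by rewrite mem_nth.
have uE (P : pred 'rV[R]_n) : \sum_(v <- s | P v) w v = \sum_(i < N.+1 | P (u i)) w (u i).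
  by rewrite (big_nth 0) sN big_mkord.
have uO i : Om W c (u i) by apply: lO; have := us_ i; rewrite mem_filter => /andP[].
have uI : injective u.
  by move=> i j /eqP; rewrite nth_uniq// => /eqP/val_inj.
have wu i : 0 < w (u i) by have := us_ i; rewrite mem_filter => /andP[].
have [t [gt It Ht]] := discrete_solution c0 uO uI wu.
exists t; split=> //; first by rewrite It -(uE predT) -sE -wO.
move=> F G mF mG FO FG; apply: le_trans (Ht G mG).
rewrite -(uE (fun v => v \in G)) -sE -{1}(setIidl FO).
by apply: wF => // x v Fx vl; apply: FG => //; case: (lO _ vl).
Qed.

Hypothesis nu0 : nu (Omega C) != 0%E.

Lemma nu_Om_gt0 : exists2 c, 0 < c & (0 < nu (Om W c))%E.
Proof.
apply: contrapT => Hn; move/eqP: nu0; apply; apply/eqP; rewrite eq_le measure_ge0 andbT.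
have -> : Omega C = \bigcup_k Om W k.+1%:R^-1.
  apply/seteqP; split=> [u /Omega_Om[c c0 Hc]|u [k _]]; last by apply: Om_Omega.
  exists (Num.truncn c^-1) => //; apply: Om_anti Hc.
  by rewrite invf_ple ?posrE// ltW// truncnS_gt.
apply: measure_bigcup_le.
- by move=> k; apply: closed_borel; exact: Om_closed.
- by move=> i j ij v; apply: Om_anti; rewrite lef_pV2 ?posrE// ler_nat ltnS.
by move=> k; rewrite leNgt; apply/negP => h; apply: Hn; exists k.+1%:R^-1.
Qed.

Lemma projected_solution : exists t, [/\ good W t, (Itot W t < +oo)%E &
  forall eta : set (borelRV R n), measurable eta -> eta `<=` Omega C -> T W t eta = nu eta].
Proof.
have [c1 c10 nuc] := nu_Om_gt0.
have mO : measurable (Omega C : set (borelRV R n)) by exact: Omega_borel.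
have mOm c : measurable (Om W c : set (borelRV R n)) by apply: closed_borel; exact: Om_closed.
(* [ck k] is both the level of the compact part of [Omega C] and the mesh of its net. Being at most
   [c1 / 2], it keeps mass of [Om W c1] within [Om W (c1 / 2)]. *)
pose ck k : R := c1 / 2 * k.+1%:R^-1.
have c2 : 0 < c1 / 2 by rewrite divr_gt0.
have ck0 k : 0 < ck k by rewrite mulr_gt0// invr_gt0.
have ck1 k : ck k <= c1 / 2 by rewrite ler_piMr ?(ltW c2)// invf_le1// ler1n.
have ckc k : ck k <= c1 by apply: (le_trans (ck1 k)); rewrite ler_pdivrMr//; lra.
have Hk k : exists t, [/\ good W t, (Itot W t <= nu (Omega C))%E &
    forall F G : set (borelRV R n), measurable F -> measurable G -> F `<=` Om W (ck k) ->
      (forall x v, F x -> enorm v = 1 -> enorm (v - x) < ck k -> G v) -> (nu F <= T W t G)%E].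
  apply: approx_solution => //; apply: (lt_le_trans nuc); apply: le_measure; rewrite ?inE//.
  by move=> u; apply: Om_anti.
have [tk Htk] := boolp.choice Hk.
have gk k : good W (tk k) by case: (Htk k).
have mq : 0 < m%:R - q by rewrite subr_gt0 wq1.
have fnu : nu (Omega C) \is a fin_num by rewrite ge0_fin_numE.
have [B B0 HB] := I_lower W; have [A A0 HA] := T_upper W c2.
have [bt bt0 Hbt] := powR_bounded mq B0 (fine_ge0 (measure_ge0 nu (Omega C))).
have tkub k : tk k 0 <= bt.
  apply: Hbt; first exact: (gk k).2.
  rewrite -lee_fin fineK//; apply: le_trans (HB _ (gk k)) _; by case: (Htk k).
have nucf : nu (Om W c1) \is a fin_num.
  rewrite ge0_fin_numE//; apply: le_lt_trans nufin; apply: le_measure; rewrite ?inE//.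
  by move=> u; exact: Om_Omega.
have w10 : 0 < fine (nu (Om W c1)) / 2 by rewrite divr_gt0// fine_gt0// nuc -ge0_fin_numE.
have [dl dl0 Hdl] := powR_small mq A0 w10.
(* The mass of [Om W c1] survives discretization inside [Om W (c1 / 2)], while by [T_upper] a small
   [tk k 0] would leave too little area there. *)
have tklb k : dl <= tk k 0.
  rewrite leNgt; apply/negP => td; have [_ _ H] := Htk k.
  have : (nu (Om W c1) <= T W (tk k) (Om W (c1 / 2)))%E.
    apply: H => //; first by move=> u; apply: Om_anti.
    move=> x v Ox v1 vx; have -> : c1 / 2 = c1 - c1 / 2 by rewrite {2}[c1]splitr addrK.
    apply: Om_near Ox v1 _; apply: le_trans (ltW vx) (ck1 k).
  move=> /le_trans/(_ (HA _ (gk k))); rewrite -(fineK nucf) lee_fin => h.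
  have := Hdl _ (gk k).2 (ltW td); lra.
have [phi [t [ta phij ct]]] := subsequence (fun k => (gk k).1) tkub.
have t0 : dl <= t 0.
  have := ct 0; move=> h; rewrite -(cvg_lim _ h)//; apply: limr_ge; first by apply/cvg_ex; eexists; exact: h.
  by apply: nearW => j; exact: tklb.
have gt : good W t by split=> //; exact: lt_le_trans t0.
have gphi j := gk (phi j).
have It : (Itot W t <= nu (Omega C))%E.
  rewrite leNgt; apply/negP => h.
  have /filter_ex[j] := I_lsc gphi gt ct h.
  by rewrite ltNge; case: (Htk (phi j)) => _ ->.
exists t; split=> //; first exact: le_lt_trans It nufin.
have [M ME] := T_measure gt.
(* [F i] is a compact exhaustion, and [F i.+1] contains a neighbourhood of [F i] in the sphere. Once
   the mesh is below [d], the mass of [F i] is at most the approximating area on [F i.+1], which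
   passes to the limit by [T_usc]. *)
have open_le (U : set 'rV[R]_n) : open U -> (nu (U `&` Omega C) <= M (U `&` Omega C))%E.
  move=> oU; pose F i : set (borelRV R n) := shrink U i `&` Om W i.+1%:R^-1.
  have cF i : closed (F i : set 'rV[R]_n) by apply: closedI; [exact: shrink_closed|exact: Om_closed].
  have mF i : measurable (F i) by exact: closed_borel.
  have FU i : F i `<=` U `&` Omega C.
    move=> v [vi vO]; split; last exact: Om_Omega vO.
    by rewrite -(shrink_bigcup oU); exists i.
  have UF : U `&` Omega C = \bigcup_i F i.
    apply/seteqP; split=> v; last by move=> [i _ /FU].
    rewrite -{1}(shrink_bigcup oU) => -[[i _ vi] /Omega_Om[c c0 vc]].
    exists (maxn i (Num.truncn c^-1)) => //; split; first exact: shrink_mono (leq_maxl _ _) _ vi.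
    apply: Om_anti vc; rewrite invf_ple ?posrE//; apply: ltW.
    by apply: lt_le_trans (truncnS_gt _) _; rewrite ler_nat ltnS leq_maxr.
  rewrite UF; apply: measure_bigcup_le => //.
    move=> i j ij v [vi vO]; split; first exact: shrink_mono ij _ vi.
    by apply: Om_anti vO; rewrite lef_pV2 ?posrE// ler_nat ltnS.
  move=> i; apply: (@le_trans _ _ (T W t (F i.+1))); last first.
    by rewrite -ME//; apply: le_measure; rewrite ?inE//; [exact: bigcupT_measurable|exact: bigcup_sup].
  rewrite leNgt; apply/negP => h.
  have bnd j : dl <= tk (phi j) 0 <= bt by rewrite tklb tkub.
  have ci : (0 : R) < i.+2%:R^-1 by rewrite invr_gt0.
  have ev := T_usc gphi gt ct dl0 ci bnd (cF i.+1) (fun v => @proj2 _ _) h.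
  pose d : R := i.+1%:R^-1 - i.+2%:R^-1.
  have d0 : 0 < d by rewrite subr_gt0 ltf_pV2 ?posrE// ltr_nat.
  have dd : 0 < d / (c1 / 2) by rewrite divr_gt0.
  have [j [hj /= jd]] := filter_ex (filterI ev (near_infty_natSinv_lt (PosNum dd))).
  have ckd : ck (phi j) <= d.
    rewrite /ck mulrC -ler_pdivlMr//; apply: ltW; apply: le_lt_trans jd.
    by rewrite lef_pV2 ?posrE// ler_nat ltnS.
  have [_ _ /(_ (F i) (F i.+1) (mF i) (mF i.+1))] := Htk (phi j).
  move=> H; move: hj; rewrite ltNge => /negP; apply; apply: H.
    move=> v [_]; apply: Om_anti; apply: (le_trans ckd); rewrite lerBlDr lerDl ltW//.
  move=> x v [xi xO] v1 vx; have vxd := le_trans (ltW vx) ckd; split; last first.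
    by have -> : i.+2%:R^-1 = i.+1%:R^-1 - d by [rewrite /d opprB addrC subrK]; exact: Om_near xO v1 vxd.
  move=> z nUz; have h1 := xi z nUz; have h2 := enormB_le x v z.
  rewrite (enormC x v) in h2; move: vxd h1 h2; rewrite /d.
  by move: (i.+1%:R^-1) (i.+2%:R^-1) (enorm (v - x)) => a b y; lra.
have MN : (M (Omega C) <= nu (Omega C))%E.
  by rewrite ME//; apply: le_trans It; exact: T_le_I.
move=> eta me eO; rewrite -ME//; exact: (measure_eq_of_open mO nufin MN open_le).
Qed.

End Existence.

(** * Volume of the complement *)

Section Volume.
Context (R : realType) (p : nat) (W : wcone R p).
Local Notation m := p.+1.
Local Notation n := p.+2.
Local Notation C := (wC W).
Local Notation e := (we W).
Local Notation q := (wq W).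
Local Notation Theta := (wT W).
Local Notation gam := (gam W).

Lemma ball_cube k (r : R) (x y : 'rV[R]_k.+1) : enorm (x - y) < r -> cube (\row_i (y ord0 i - r)) (2 * r) x.
Proof. by move=> /ball_sub_cube H i; have := H i; rewrite !mxE; lra. Qed.

Lemma hausdorff_ball k (r : R) (y : 'rV[R]_k.+1) (A : set 'rV[R]_k.+1) : 0 < r -> (forall x, A x -> enorm (x - y) < r) ->
  (hausdorff k.+1 A <= ((2 * r) ^+ k.+1 * fine (lam R k (cube 0%R 1%R)))%:E)%E.
Proof.
move=> r0 H; have r2 : 0 < 2 * r by rewrite mulr_gt0.
rewrite EFinM fineK ?lam_unit_fin// -(lam_cube (\row_i (y ord0 i - r)) r2) lamE.
by apply: le_hausdorff => x /H/ball_cube.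
Qed.

(** Doubling fixes the origin but multiplies its finite measure by [2 ^+ k.+1]. *)
Lemma hausdorff_set1_0 k : hausdorff k.+1 [set 0 : 'rV[R]_k.+1] = 0%E.
Proof.
rewrite -lamE; have := lam_affine [set 0 : 'rV[R]_k.+1] 0 (ltr0n R 2).
rewrite image_set1 scaler0 addr0 => h.
have fl : lam R k [set 0%R] \is a fin_num.
  rewrite ge0_fin_numE ?measure_ge0//; apply: le_lt_trans (_ : lam R k (cube 0%R 1%R) < +oo)%E.
    by rewrite !lamE; apply: le_hausdorff => _ -> i; rewrite !mxE add0r lexx ltr01.
  by rewrite -ge0_fin_numE ?measure_ge0// lam_unit_fin.
move: h; rewrite -(fineK fl) -EFinM => -[] h; congr (_%:E).
have h2 : 1 < (2 : R) ^+ k.+1 by rewrite exprn_egt1// ltr1n.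
by move/eqP: h; rewrite -subr_eq0 -{1}[fine _]mul1r -mulrBl mulf_eq0 subr_eq0 lt_eqF//= => /eqP.
Qed.

Section Strip.
Variable t : 'rV[R]_m -> R.
Hypothesis gt : good W t.

Definition strip (A : set 'rV[R]_m) : set 'rV[R]_n :=
  [set X | [/\ A (prj W X), tC W (prj W X) <= ht W X & ht W X < t (prj W X)]].

(** Over a base of diameter [r] the region has height at most [t 0 + 2 * kap W * r]. About [1/r]
    slices of height [r], each inside a ball of radius [K0 * r], give [r ^+ n / r = r ^+ m]. *)
Lemma strip_bound : exists2 K, 0 < K & forall (U : set 'rV[R]_m) r, 0 < r -> r <= 1 ->
  (forall x y, U x -> U y -> enorm (x - y) <= r) -> (hausdorff n (strip U) <= (K * r ^+ m)%:E)%E.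
Proof.
have k0 := kap_gt0 W; have t0 := gt.2; have en0 := enorm_ge0 e.
pose cn := fine (lam R m (cube 0 1)); have cn0 : 0 < cn by exact: lam_unit_gt0.
pose K0 := 2 + enorm e; have K00 : 0 < K0 by rewrite ltr_pwDl.
pose K := (t 0 + 2 * kap W + 1) * ((2 * K0) ^+ n * cn).
have Kp : 0 < K.
  apply: mulr_gt0; first by apply: addr_gt0 => //; apply: addr_gt0 => //; exact: mulr_gt0.
  by apply: mulr_gt0 => //; apply: exprn_gt0; exact: mulr_gt0.
exists K => //.
move=> U r r0 r1 dU.
have K0' : 0 <= K by exact: ltW.
have [[x0 Ux0]|U0] := pselect (U !=set0); last first.
  rewrite (_ : strip U = set0); last first.
    by apply/seteqP; split=> // X [Ux _ _]; case: U0; exists (prj W X).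
  by rewrite hausdorff0 lee_fin; apply: mulr_ge0 => //; apply: exprn_ge0; exact: ltW.
pose b := tC W x0 - kap W * r.
pose P (N : nat) : set 'rV[R]_n := [set X | [/\ U (prj W X), b <= ht W X & ht W X < b + N%:R * r]].
pose v := (2 * (K0 * r)) ^+ n * cn.
have PN N : (hausdorff n (P N) <= (N%:R * v)%:E)%E.
  elim: N => [|N IH].
    rewrite (_ : P 0%N = set0) ?hausdorff0 ?mul0r//.
    by apply/seteqP; split=> // X [_]; rewrite mul0r addr0 => h1; rewrite ltNge h1.
  pose D : set 'rV[R]_n := [set X | [/\ U (prj W X), b + N%:R * r <= ht W X & ht W X < b + N.+1%:R * r]].
  apply: (@le_trans _ _ (hausdorff n (P N `|` D))).
    apply: le_hausdorff => X [UX h1 h2]; have [h|h] := ltP (ht W X) (b + N%:R * r); first by left.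
    by right.
  apply: le_trans (outer_measureU2 (@hausdorff R n n) _ _) _.
  rewrite -natr1 mulrDl mul1r EFinD; apply: leeD => //.
  apply: (@hausdorff_ball m (K0 * r) (gam x0 (b + N%:R * r))); first by rewrite mulr_gt0.
  move=> X [UX h1 h2]; rewrite -{1}(gamK W X) -gamB.
  apply: le_lt_trans (gam_le _ _ _) _; rewrite ger0_norm ?subr_ge0//.
  have h3 := dU _ _ UX Ux0.
  have h4 : (ht W X - (b + N%:R * r)) * enorm e <= r * enorm e.
    by rewrite ler_wpM2r//; move: h2; rewrite -natr1 mulrDl; lra.
  have -> : K0 * r = r + r + r * enorm e by rewrite /K0; ring.
  by move: h4; set y := (_ - _) * _; move: h3 r0; lra.
pose N := (Num.truncn (t 0 / r + 2 * kap W)).+1.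
have tr0 : 0 <= t 0 / r + 2 * kap W.
  by apply: addr_ge0; [apply: divr_ge0; exact: ltW|apply: mulr_ge0 => //; exact: ltW].
have /andP[N1 N2] := truncn_itv tr0; rewrite -/N in N2.
have trr : (t 0 / r + 2 * kap W) * r = t 0 + 2 * kap W * r by rewrite mulrDl divfK ?gt_eqF.
have Nr : t 0 + 2 * kap W * r <= N%:R * r by rewrite -trr ler_pM2r// ltW.
have Nr' : N%:R * r <= t 0 + 2 * kap W + 1.
  have : N%:R * r <= (t 0 / r + 2 * kap W + 1) * r by rewrite ler_pM2r// /N -natr1 lerD2r.
  rewrite mulrDl trr mul1r => /le_trans; apply.
  have : 2 * kap W * r <= 2 * kap W by rewrite ler_piMr// mulr_ge0// ltW.
  lra.
apply: (@le_trans _ _ (hausdorff n (P N))).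
  apply: le_hausdorff => X [UX h1 h2].
  have hC := dU _ _ UX Ux0; have hC' : kap W * enorm (prj W X - x0) <= kap W * r by rewrite ler_pM2l.
  have := adm_lip (tC_adm W) (prj W X) x0; rewrite ler_norml => /andP[h3 h4].
  have h5 := adm_le_tC (prj W X) gt.1.
  by split=> //; rewrite /b; lra.
apply: (le_trans (PN N)); rewrite lee_fin.
have -> : N%:R * v = (N%:R * r) * ((2 * K0) ^+ n * cn) * r ^+ m.
  by rewrite /v (mulrA 2) [(2 * K0 * r) ^+ n]exprMn [r ^+ n]exprS; ring.
rewrite /K ler_pM2r ?exprn_gt0// ler_pM2r// mulr_gt0// exprn_gt0// mulr_gt0//.
Qed.

(** A substitute for Fubini, valid for arbitrary [A]: each member of a cover of [A] is replaced by
    the column over it. *)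
Lemma strip_le : exists2 K, 0 < K & forall A, (hausdorff n (strip A) <= K%:E * hausdorff m A)%E.
Proof.
have [K K0 HK] := strip_bound; have c0 := hcst_gt0 R m.
exists (K / hcst R m); first by rewrite divr_gt0.
have K'0 : 0 < K / hcst R m by rewrite divr_gt0.
move=> A; rewrite -lee_pdivrMl//; apply: le_trans (hdelta_le_hausdorff _ _ ltr01).
apply: hdelta_ge => U [cov dU].
rewrite lee_pdivrMl// -nneseriesZl; last by move=> i _; exact: hweight_ge0.
apply: (@le_trans _ _ (hausdorff n (\bigcup_i strip (U i)))).
  by apply: le_hausdorff => X [/cov[i _ Ui] h1 h2]; exists i.
apply: le_trans (hausdorff_sigma_subadditive _ _) _.
apply: lee_nneseries => [i _ _|i _]; first exact: hausdorff_ge0.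
pose d := fine (diam (U i)).
have dE : diam (U i) = d%:E.
  by rewrite fineK// ge0_fin_numE ?diam_ge0// (le_lt_trans (dU i))// ltry.
have d0 : 0 <= d by rewrite -lee_fin -dE diam_ge0.
have d1 : d <= 1 by rewrite -lee_fin -dE dU.
have dU' x y : U i x -> U i y -> enorm (x - y) <= d.
  by move=> Ux Uy; rewrite -lee_fin -dE; exact: diam_ub.
rewrite /hweight muleA -EFinM divfK ?gt_eqF// dE -EFin_expe -EFinM.
(* A covering set of diameter 0 has weight 0; the column over it is shown null by taking [r]
   arbitrarily small. *)
have [d0'|] := ltP 0 d; first exact: HK.
move=> d00; have dz : d = 0 by apply/le_anti; rewrite d00 d0.
rewrite dz expr0n mulr0; apply/lee_addgt0Pr => ep e0; rewrite add0e.
pose r := Num.min 1 (ep / K).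
have r0 : 0 < r by rewrite lt_min ltr01 divr_gt0.
have r1 : r <= 1 by rewrite ge_min lexx.
have rK : K * r <= ep by rewrite mulrC -ler_pdivlMr// ge_min lexx orbT.
apply: le_trans (HK (U i) r r0 r1 _) _.
  by move=> x y Ux Uy; apply: (le_trans (dU' x y Ux Uy)); rewrite dz ltW.
rewrite lee_fin; apply: le_trans rK; rewrite ler_pM2l//.
by rewrite exprS ler_piMr ?(ltW r0)// exprn_ile1// ltW.
Qed.

(** The graph is at most [t 0 * enorm e] away from [X] along [e], so the graph point over [X] has
    norm at most twice that of [X]. *)
Lemma far_Theta : exists2 k, 0 < k & forall X, C X -> ~ epi W t X -> t 0 * enorm e <= enorm X ->
  Theta X <= k * Th W t (prj W X).
Proof.
have [c [d [c0 d0 HT]]] := Theta_bounds W.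
have en0 : 0 < enorm e by rewrite enorm_gt0 e_neq0.
have h20 : 0 < (2^-1 : R) `^ (- q) by rewrite powR_gt0// invr_gt0.
exists (d * 2^-1 `^ (- q) / c); first by rewrite divr_gt0// mulr_gt0.
move=> X CX neX Xfar; have X0 : X != 0 by rewrite -enorm_gt0 (lt_le_trans _ Xfar)// mulr_gt0// gt.2.
have hX : ht W X < t (prj W X) by rewrite ltNge; apply/negP.
have CX' : tC W (prj W X) <= ht W X by apply/C_gamP; rewrite gamK.
have grX : enorm (gr W t (prj W X)) <= 2 * enorm X.
  have := enormB_le (gr W t (prj W X)) X 0; rewrite !subr0 => /le_trans; apply.
  rewrite -[X in enorm (_ - X)](gamK W X) /gr -gamB subrr gam_e enormZ gtr0_norm ?subr_gt0//.
  have h : (t (prj W X) - ht W X) * enorm e <= t 0 * enorm e.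
    by rewrite ler_pM2r//; have := adm_le_tC (prj W X) gt.1; lra.
  move: h Xfar; set y := (_ - _) * _; lra.
have [_ h1] := HT X CX X0.
have [h2 _] := HT _ (gr_C gt.1 (prj W X)) (gr_neq0 (prj W X) gt).
have ng : 0 < enorm (gr W t (prj W X)) by rewrite enorm_gt0 gr_neq0.
have h3 : enorm X `^ (- q) <= (2^-1 * enorm (gr W t (prj W X))) `^ (- q).
  by apply: powR_anti; [rewrite mulr_gt0// invr_gt0|rewrite ler_pdivrMl].
rewrite powRM ?invr_ge0 ?(ltW ng)// in h3.
apply: (le_trans h1); apply: (@le_trans _ _ (d * (2^-1 `^ (- q) * enorm (gr W t (prj W X)) `^ (- q)))).
  by rewrite ler_pM2l.
rewrite -/(Th W t (prj W X)) in h2.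
move: h2; set b := 2^-1 `^ _; set g := _ `^ _; set Y := Th _ _ _ => h2.
have -> : d * (b * g) = d * b / c * (c * g) by field; rewrite gt_eqF.
by rewrite ler_pM2l// divr_gt0// mulr_gt0.
Qed.

Let I : set R := `[0%R, +oo[%classic.

Lemma layer_lam_measurable k (A : set 'rV[R]_k.+1) (f : 'rV[R]_k.+1 -> R) :
  measurable_fun I (fun s => lam R k (A `&` [set x | (s < f x)%R])).
Proof.
rewrite (_ : (fun s => _) = (fun s => hausdorff k.+1 (A `&` [set x | s < f x]))).
  exact: measurable_hausdorff_sup.
by apply/funext => s; rewrite lamE.
Qed.

(* Near the origin the volume is summed over dyadic shells, where Theta ~ rho^-q and the volume is ~ rho^n with n > q;
   far from it the region between the cone and the graph has height at most t 0, so its volume is controlled by the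
   base measure of the projection, and Theta is comparable to its values on the graph. *)
Lemma Vtheta_fin : (Itot W t < +oo)%E -> (Vtheta C Theta (epi W t) < +oo)%E.
Proof.
move=> Ifin; have [K K0 HK] := strip_le; have [k k0 Hk] := far_Theta.
have [c [d [c0 d0 HT]]] := Theta_bounds W.
have en0 : 0 < enorm e by rewrite enorm_gt0 e_neq0.
pose r0 := t 0 * enorm e; have r00 : 0 < r0 by rewrite mulr_gt0// gt.2.
pose rho (j : nat) := r0 / 2 ^+ j.
have e2 j : 0 < (2 : R) ^+ j by rewrite exprn_gt0.
have rho0 j : 0 < rho j by rewrite divr_gt0.
have rhoS j : rho j.+1 = rho j / 2 by rewrite /rho exprS invfM mulrCA mulrC.
pose Tj j := d * rho j.+1 `^ (- q).
have Tj0 j : 0 <= Tj j by rewrite mulr_ge0 ?(ltW d0)// powR_ge0.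
pose Q j : set (borelRV R n) := cube (\row__ - rho j) (2 * rho j).
have mQ j : measurable (Q j) by exact: cube_borel.
pose F s : \bar R := lam R p (above W t `&` [set x | s < k * Th W t x]).
pose G j s : \bar R := lam R m (Q j `&` [set X | s < Tj j]).
have key (s : R) : (hausdorff n ((C `\` epi W t) `&` [set x | (s < Theta x)%R]) <= K%:E * F s + \sum_(j <oo) G j s)%E.
  (* The origin is split off because [Theta] is unconstrained there. *)
  apply: (@le_trans _ _ (hausdorff n ([set 0%R] `|` (strip (above W t `&` [set x | (s < k * Th W t x)%R]) `|`
      \bigcup_j (Q j `&` [set X | (s < Tj j)%R])))))%E.
    apply: le_hausdorff => X [[CX neX] /= sX].
    have [->|X0] := eqVneq X 0; [by left|right].
    have nX : 0 < enorm X by rewrite enorm_gt0.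
    have [Xr|Xr] := leP r0 (enorm X).
      left; have hX : ht W X < t (prj W X) by rewrite ltNge; apply/negP.
      have CX' : tC W (prj W X) <= ht W X by apply/C_gamP; rewrite gamK.
      split=> //; split; first exact: le_lt_trans CX' hX.
      by rewrite /=; apply: lt_le_trans sX _; exact: Hk.
    right; have exj : exists j, rho j.+1 <= enorm X.
      exists (Num.truncn (r0 / enorm X)); rewrite ler_pdivrMr// -ler_pdivrMl// mulrC.
      apply: ltW; apply: (lt_le_trans (truncnS_gt _)); rewrite -natrX ler_nat.
      exact: ltnW (ltn_expl _ _).
    have Xj := ex_minnP exj; case: Xj => j Xj jmin.
    have Xj' : enorm X < rho j.
      case: j Xj jmin => [_ _|j _ jmin]; first by rewrite /rho expr0 divr1.
      by rewrite ltNge; apply/negP => /jmin; rewrite ltnn.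
    exists j => //; split; first exact: ball_sub_cube.
    rewrite /=; apply: (lt_le_trans sX); apply: (le_trans (HT X CX X0).2).
    by rewrite ler_pM2l//; apply: powR_anti.
  apply: le_trans (outer_measureU2 (@hausdorff R n n) _ _) _.
  rewrite [X in (X + _)%E](hausdorff_set1_0 m) add0e.
  apply: le_trans (outer_measureU2 (@hausdorff R n n) _ _) _.
  apply: leeD; first by apply: le_trans (HK _) _; rewrite /F lamE.
  apply: le_trans (hausdorff_sigma_subadditive _ _) _.
  apply: lee_nneseries => [j _ _|j _]; first exact: hausdorff_ge0.
  by rewrite /G lamE.
have F0 s : (0 <= F s)%E by exact: measure_ge0.
have G0 j s : (0 <= G j s)%E by exact: measure_ge0.
have mI : measurable (I : set (measurableTypeR R)) by exact: measurable_itv.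
have mF : measurable_fun I F by exact: layer_lam_measurable.
have mG j : measurable_fun I (G j) by exact: (layer_lam_measurable (Q j) (fun=> Tj j)).
have mKF : measurable_fun I (fun s => (K%:E * F s)%E) by exact: measurable_funeM.
have mSG : measurable_fun I (fun s => (\sum_(j <oo) G j s)%E).
  exact: (@ge0_emeasurable_sum _ _ _ _ G predT).
have KF0 s : (0 <= K%:E * F s)%E by rewrite mule_ge0// lee_fin ltW.
have SG0 s : (0 <= \sum_(j <oo) G j s)%E by apply: nneseries_ge0.
rewrite /Vtheta /hint.
apply: (@le_lt_trans _ _ (\int[@lebesgue_measure R]_(s in I) (K%:E * F s + \sum_(j <oo) G j s))%E).
  apply: ge0_le_integral => //.
  - by move=> s _; exact: hausdorff_ge0.
  - exact: measurable_hausdorff_sup.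
  - exact: emeasurable_funD.
rewrite ge0_integralD// ge0_integralZl_EFin ?(ltW K0)// integral_nneseries//.
have FE : (\int[@lebesgue_measure R]_(s in I) F s = k%:E * Itot W t)%E.
  rewrite /F (layer_cake (sigma_finite_lam R p) (above_borel gt.1)).
  - rewrite /Itot -ge0_integralZl_EFin//; try exact: ltW.
    + exact: above_borel gt.1.
    + by move=> x _; rewrite lee_fin ltW// Th_gt0.
    + exact: ETh_measurable.
  - by apply: measurable_funM; [exact: measurable_cst|exact: Th_measurable].
  - by move=> x _; rewrite mulr_ge0 ?(ltW k0)// ltW// Th_gt0.
have GE j : (\int[@lebesgue_measure R]_(s in I) G j s = (Tj j)%:E * lam R m (Q j))%E.
  by rewrite /G (layer_cake (sigma_finite_lam R m) (mQ j))// int_cst.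
rewrite FE; apply: lte_add_pinfty.
  by rewrite !lte_mul_pinfty ?lee_fin ?(ltW K0) ?(ltW k0)//.
pose cn := fine (lam R m (cube 0 1)).
have cn0 : 0 < cn by exact: lam_unit_gt0.
pose b := d * 2^-1 `^ (- q) * 2 ^+ n * cn.
have b0 : 0 <= b.
  apply: mulr_ge0; last exact: ltW.
  by apply: mulr_ge0; [apply: mulr_ge0; [exact: ltW|exact: powR_ge0]|exact: exprn_ge0].
(* The j-th shell contributes at most [b * rho j] times [rho j] to the power [m - q]. Bounding that
   power by the one of [r0] leaves the geometric series with terms [a / 2 ^ j.+1]. *)
pose a := b * r0 `^ (m%:R - q) * r0 * 2.
have a0 : 0 <= a.
  apply: mulr_ge0 => //; apply: mulr_ge0; last exact: ltW.
  by apply: mulr_ge0 => //; exact: powR_ge0.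
apply: (@le_lt_trans _ _ a%:E); last exact: ltry.
apply: le_trans (epsilon_trick0 predT a0).
apply: lee_nneseries => [j _ _|j _]; first by apply: integral_ge0.
have rj2 : 0 < 2 * rho j by rewrite mulr_gt0.
rewrite GE /Q (lam_cube _ rj2) -(fineK (lam_unit_fin R m)) -!EFinM lee_fin.
have rE : rho j `^ (- q) * rho j ^+ m <= r0 `^ (m%:R - q).
  rewrite mulrC powR_split//; apply: ge0_ler_powR.
  - by rewrite subr_ge0 ltW// wq1.
  - by rewrite nnegrE ltW.
  - by rewrite nnegrE ltW.
  by rewrite ler_pdivrMr// ler_peMr ?(ltW r00)// exprn_ege1// ler1n.
have -> : a / (2 ^ j.+1)%:R = b * rho j * r0 `^ (m%:R - q).
  rewrite /a /rho natrX exprS; move: (_ `^ _) => x; field.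
  by rewrite gt_eqF.
have -> : Tj j * ((2 * rho j) ^+ n * fine (lam R m (cube 0 1))) =
    b * rho j * (rho j `^ (- q) * rho j ^+ m).
  rewrite /Tj /b rhoS powRM ?invr_ge0 ?(ltW (rho0 j))// [(2 * rho j) ^+ n]exprMn [rho j ^+ n]exprS /cn; ring.
by apply: ler_wpM2l rE; apply: mulr_ge0 => //; exact: ltW.
Qed.

End Strip.
End Volume.

(** * The theorem *)

Section Main.
Context (R : realType) (p : nat) (W : wcone R p).
Local Notation n := p.+2.
Local Notation C := (wC W).
Local Notation Theta := (wT W).
Variable mu : {measure set (borelRV R n) -> \bar R}.
Hypothesis mufin : (mu (Omega C) < +oo)%E.
Hypothesis mu0 : mu (Omega C) != 0%E.

Lemma minkowski_existence : exists E, close_set C Theta E /\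
  forall eta : set (borelRV R n), measurable eta -> eta `<=` Omega C -> Stheta C Theta E eta = mu eta.
Proof.
have [nu [nufin nu0 Hnu]] := projected_measure mufin mu0.
have [t [gt It Tt]] := projected_solution nufin nu0.
exists (epi W t); split; last exact: (Hnu t gt).2 Tt.
by split; [exact: good_pseudo_cone|exact: Vtheta_fin].
Qed.

Lemma minkowski_uniqueness (omega K L : set 'rV[R]_n) : compact omega -> omega `<=` Omega C ->
  pseudo_cone C K -> pseudo_cone C L -> C_determined C K omega -> C_determined C L omega ->
  (forall eta : set (borelRV R n), measurable eta -> eta `<=` Omega C -> Stheta C Theta K eta = mu eta) ->
  (forall eta : set (borelRV R n), measurable eta -> eta `<=` Omega C -> Stheta C Theta L eta = mu eta) ->
  K = L.
Proof.
move=> cO OO /pseudo_cone_epi[t gt ->] /pseudo_cone_epi[s gs ->].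
have [nu [nufin nu0 Hnu]] := projected_measure mufin mu0.
have det f : C_determined C (epi W f) omega -> forall x r, tC W x <= r -> r < f x ->
    exists2 u, omega u & forall Y, epi W f Y -> dotv Y u < dotv (gam W x r) u.
  move=> df x r Cr rf; apply: contrapT => Hn.
  suff : epi W f (gam W x r) by rewrite epi_gam leNgt rf.
  rewrite df; split; first exact/C_gamP.
  move=> u ou; rewrite leNgt; apply/negP => h; apply: Hn; exists u => // Y eY.
  by rewrite -lte_fin; apply: le_lt_trans h; apply: ereal_sup_ubound; exists Y.
move=> /det dt /det ds /(Hnu t gt).1 Tt /(Hnu s gs).1 Ts.
have mO : measurable (Omega C : set (borelRV R n)) by exact: Omega_borel.
have ts x : t x <= s x.
  apply: (epi_unique_le gt gs cO OO dt) => [eta me eO|]; first by rewrite Tt// Ts.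
  by rewrite Ts.
have st x : s x <= t x.
  apply: (epi_unique_le gs gt cO OO ds) => [eta me eO|]; first by rewrite Tt// Ts.
  by rewrite Tt.
by congr (epi W _); apply/funext => x; apply/le_anti; rewrite ts st.
Qed.

End Main.

(** Projection along [e] onto the hyperplane of vanishing first coordinate requires [e] to leave it;
    an interior point can be moved slightly along the first axis. *)
Lemma interior_frame (R : realType) (k : nat) (A : set 'rV[R]_k.+1) : interior A !=set0 ->
  exists2 e : 'rV[R]_k.+1, interior A e & e ord0 ord0 != 0.
Proof.
move=> [x Ax]; have [x0|x0] := eqVneq (x ord0 ord0) 0; last by exists x.
have /nbhs_enball[r r0 Hr] : nbhs x (interior A) by apply: open_nbhs_nbhs; split=> //; exact: open_interior.
pose d : 'rV[R]_k.+1 := delta_mx ord0 ord0.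
have D0 : 0 < enorm d + 1 by rewrite ltr_wpDl.
have s0 : 0 < r / (enorm d + 1) by rewrite divr_gt0.
exists (x + (r / (enorm d + 1)) *: d).
  apply: Hr; rewrite opprD addNKr enormN enormZ gtr0_norm// mulrAC ltr_pdivrMr// ltr_pM2l//.
  by rewrite ltrDl.
by rewrite !mxE x0 add0r eqxx mulr1 gt_eqF.
Qed.

Theorem theorem1p4 (R : realType) (n : nat) (hn : (2 <= n)%N)
  (C : set 'rV[R]_n) (hC : proper_cone C)
  (q : R) (hq0 : 0 <= q) (hq1 : q < (n - 1)%:R)
  (Theta : 'rV[R]_n -> R)
  (Theta_pos : forall x, C x -> x != 0 -> 0 < Theta x)
  (Theta_cont : {within C `\ 0, continuous Theta})
  (Theta_hom : forall x (l : R), C x -> x != 0 -> 0 < l ->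
                 Theta (l *: x) = l `^ (- q) * Theta x)
  (mu : {measure set (borelRV R n) -> \bar R})
  (mu_fin : (mu (Omega C) < +oo)%E) (mu_nz : mu (Omega C) != 0%E) :
  (exists E : set 'rV[R]_n, close_set C Theta E /\
     forall eta : set (borelRV R n), measurable eta -> eta `<=` Omega C ->
       Stheta C Theta E eta = mu eta)
  /\
  (forall omega : set 'rV[R]_n, omega !=set0 -> compact omega ->
     omega `<=` Omega C ->
     forall K L : set 'rV[R]_n, pseudo_cone C K -> pseudo_cone C L ->
       C_determined C K omega -> C_determined C L omega ->
       (forall eta : set (borelRV R n), measurable eta -> eta `<=` Omega C ->
          Stheta C Theta K eta = mu eta) ->
       (forall eta : set (borelRV R n), measurable eta -> eta `<=` Omega C ->
          Stheta C Theta L eta = mu eta) ->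
       K = L).
Proof.
case: n hn C hC q hq0 hq1 Theta Theta_pos Theta_cont Theta_hom mu mu_fin mu_nz
  => [|[|p]]// _ C hC q hq0 hq1 Theta Theta_pos Theta_cont Theta_hom mu mu_fin mu_nz.
have [e ei e0] : exists2 e, interior C e & e ord0 ord0 != 0.
  by apply: interior_frame; case: hC.
pose W := @Wcone R p C hC e ei e0 q hq0 hq1 Theta Theta_pos Theta_cont Theta_hom.
split; first exact: (@minkowski_existence R p W mu mu_fin mu_nz).
move=> omega _ cO OO K L pK pL dK dL.
exact: (@minkowski_uniqueness R p W mu mu_fin mu_nz omega K L cO OO pK pL dK dL).
Qed.
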